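(* Let $k \geq 1$, $0 \leq r \leq k$, and $d > 2k - r$. Let $\Delta_k \subset \mathbf{F}_q^d$ be a $k$-simplex with rank $r$, and let $\alpha \geq Cq^{(2k - d - r)/(k + 1)}$ for some sufficiently large constant $C > 0$ depending only on $k$. Then for any set $A \subseteq \mathbf{F}_q^d$ with $|A| = \alpha q^d$, the number of $k$-simplices $\Delta_k' \subset A$ with $\Delta_k' \simeq \Delta_k$ is equal to $$\Big(\alpha^{k + 1} + O\big(\alpha^{(k + 1)/2}q^{k - (d + r)/2}\big)\Big)\, q^{(k + 1)d - \binom{k + 1}{2}},$$ where the constant implied by the $O$-notation may depend on $k$ but on no other parameter.
   Context: $\mathbf{F}_q$ is the finite field with $q$ elements, of odd characteristic. For $v, w \in \mathbf{F}_q^d$, $v \cdot w := \sum_{i=1}^d v_i w_i \in \mathbf{F}_q$. A $k$-simplex in $\mathbf{F}_q^d$ is a set of $k+1$ points $\{v_0, v_1, \ldots, v_k\} \subseteq \mathbf{F}_q^d$ for which the vectors $v_1 - v_0, \ldots, v_k - v_0$ are linearly independent. Two $k$-simplices $\Delta_k, \Delta_k' \subset \mathbf{F}_q^d$ are isometric, written $\Delta_k \simeq \Delta_k'$, if they can be ordered $\Delta_k = \{v_0, v_1, \ldots, v_k\}$ and $\Delta_k' = \{y_0, y_1, \ldots, y_k\}$ so that $(v_i - v_0) \cdot (v_j - v_0) = (y_i - y_0) \cdot (y_j - y_0)$ for all $1 \leq i \leq j \leq k$. To the $k$-simplex $\Delta_k = \{v_0, v_1, \ldots, v_k\}$ one associates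 the subspace $V = \operatorname{Span}(v_1 - v_0, \ldots, v_k - v_0)$ and its orthogonal complement $V^\perp = \{w \in \mathbf{F}_q^d : v \cdot w = 0 \text{ for all } v \in V\}$; the rank of $\Delta_k$ is $k - \dim(V \cap V^\perp)$.
   Formalization: The k-simplices are counted with an ordering of their vertices matching a fixed ordering of the given simplex; counted as sets, the formula is off by the number of self-isometries of the simplex (a factor 2 already for k = 1). *)

(* Defs.v *)
From mathcomp Require Import all_boot all_order all_algebra.

Set Implicit Arguments.
Unset Strict Implicit.
Unset Printing Implicit Defensive.

Import GRing.Theory.
Local Open Scope ring_scope.

Section Simplices.
Context {F : finFieldType} {d : nat}.
Implicit Types (v w : 'rV[F]_d) (V : {vspace 'rV[F]_d}).

Definition dot v w : F := \sum_(i < d) v 0 i * w 0 i.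

Definition orthoset V : {set 'rV[F]_d} :=
  [set w | [forall v, (v \in V) ==> (dot v w == 0)]].

(* [orthoset V] is already a subspace: taking the span only packages it as a
   {vspace _}. *)
Definition perp V : {vspace 'rV[F]_d} := <<enum (orthoset V)>>%VS.

Lemma memv_perp V w :
  reflect (forall v, v \in V -> dot v w = 0) (w \in perp V).
Proof.
apply: (iffP idP) => [wP v vV|H]; last first.
  apply: memv_span; rewrite mem_enum inE; apply/forallP => v.
  by apply/implyP => /H ->.
rewrite (coord_span (X := in_tuple (enum (orthoset V))) wP) /dot.
under eq_bigr => i _ do rewrite summxE mulr_sumr.
rewrite exchange_big big1 //= => j _.
under eq_bigr => i _ do rewrite mxE mulrCA.
rewrite -mulr_sumr.
have : (enum (orthoset V))`_j \in orthoset V by rewrite -mem_enum mem_nth.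
rewrite inE => /forallP /(_ v); rewrite vV => /eqP.
by rewrite /dot => ->; rewrite mulr0.
Qed.

Variable k : nat.
Implicit Types x y : {ffun 'I_k.+1 -> 'rV[F]_d}.

(* An ordered list of vertices x_0, ..., x_k; [edge x i] is x_(i+1) - x_0. *)
Definition edge x (i : 'I_k) : 'rV[F]_d := x (lift ord0 i) - x ord0.

Definition edges x : seq 'rV[F]_d := [seq edge x i | i : 'I_k].

Definition simplex x : bool := free (edges x).

Definition simplex_span x : {vspace 'rV[F]_d} := <<edges x>>%VS.

Definition simplex_rank x : nat :=
  k - \dim (simplex_span x :&: perp (simplex_span x))%VS.

Definition isometric x y : bool :=
  [forall i : 'I_k, forall j : 'I_k, (i <= j)%N ==>
     (dot (edge x i) (edge x j) == dot (edge y i) (edge y j))].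

(* Simplices are counted with an ordering of their vertices that matches the
   ordering of x.  Each vertex set {y_0, ..., y_k} is thus counted as many times
   as there are permutations s of 'I_k.+1 with x and x \o s isometric; this is
   2 for every x when k = 1.  The asymptotic main term
   alpha^(k+1) q^((k+1)d - binom(k+1,2)), with no symmetry factor, is the one of
   this ordered count. *)
Definition isometric_copies (A : {set 'rV[F]_d}) x :
    {set {ffun 'I_k.+1 -> 'rV[F]_d}} :=
  [set y | [&& simplex y, [forall i, y i \in A] & isometric x y]].

End Simplices.

(* Main.v *)
Require Import Defs.
From HB Require Import structures.
From mathcomp Require Import all_boot all_order all_algebra.
From mathcomp Require Import all_field mxabelem.
From mathcomp Require Import zify ring lra.
From mathcomp Require Import reals exp.

Set Implicit Arguments.
Unset Strict Implicit.
Unset Printing Implicit Defensive.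

Import Order.TTheory GRing.Theory Num.Theory.
Local Open Scope ring_scope.

(** Record the edge vectors of an ordered simplex as the rows of a matrix X with
    k rows and d columns.  Being a simplex means that X is row free, being
    isometric to Delta means that X X^T is the Gram matrix G of Delta, and the
    rank r of Delta is the rank of G, because h |-> h X identifies the kernel of
    G with the radical of the span.  So one counts pairs (X, v) with X row free,
    X X^T = G, and v and all v + row i X in A.  Write a = |A| and let N_m be this
    count for m edges.

    The count is by induction on m ([copies_main]).  Split off one edge w, so
    that G has a corner c, a column b and a remaining Gram matrix G'.  Once the
    other edges X are fixed, w ranges over the sphere X w = b, w.w = c with the
    span of X removed, which has about q^(d-m-1) points.  For a vertex v let
    D(X, v) be the number of such w with v + w in A, minus a / q^(m+1).  Then
    N_(m+1) - (a / q^(m+1)) N_m is the sum of D over the pairs counted by N_m,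
    and Cauchy-Schwarz bounds its square by N_m times the sum of D^2 over all X
    and all v, the restriction to A being dropped.  Parseval in v turns the last
    sum into an average of |hat A|^2 against |E_X|^2, where E_X is the Fourier
    transform of the sphere minus its main term ([variance_grams]).  Passing
    from m+1 to m edges changes the rank by at most 2 ([rank_corner]), and this
    is just small enough for every error term to stay below the claimed one, so
    any edge may be split off.

    The heart of the matter is thus a pointwise bound for the Fourier transform
    of the sphere ([free_sphere_hat_le]): at xi it is the main term at 0, plus a
    peak of height q^(d-m-1) when xi lies in the span of X, plus
    O(q^((d - rank G)/2)).  The peak is harmless because few X span a given
    nonzero xi ([card_grams_span]).  To get the bound, detect the equation
    w.w = c by a character with frequency t.  For t <> 0 completing squares gives
    a product of two quadratic Gauss sums, one on F^d and one for the form G'.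
    Their size is known, and they depend only on the square class of t.  When
    the rank of G exceeds that of G' by 2, at most one t contributes.  When both
    ranks agree, the trivial bound in t suffices.  When they differ by 1, a sum
    of chi(a t + b / t), twisted by a function of the square class of t, remains,
    and square root cancellation in t is indispensable ([norm_twisted]).  That
    sum is a combination of a Kloosterman sum and of a Salie sum.  The latter is
    elementary; the former needs the Weil bound |K| <= 2 sqrt(q).

    The Weil bound for K is proved in two steps.  First, the L-series of the
    weight f |-> chi(sum of x + c/x over the roots x of f) on monic polynomials is
    1 + K T + q T^2 ([lseries_recursion] and the values after it), so that the
    Kloosterman sums K_n over the fields with q^n elements satisfy
    K_(n+2) = - K K_(n+1) - q K_n; if K^2 > 4 q, then |K_n| q^(-n/2) is unbounded
    along even n.  Second, Stepanov's method, in the form found by Bombieri where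
    derivatives are replaced by the Frobenius map, gives |K_n| = O(q^(n/2)) for
    even n, with a constant depending on q ([stepanov_bound],
    [lift_kloosterman_bound]).  All these fields are taken inside one algebraic
    closure of F, as the fixed points of powers of the Frobenius map. *)

(** * Powers of the Frobenius map *)

Section Frobenius.
Variables (F : finFieldType) (L : idomainType) (iota : {rmorphism F -> L}).
Local Notation q := #|F|.

Lemma pchar_nat_card_exp n : [pchar L].-nat (q ^ n)%N.
Proof.
have [p pr_p pF] := finPcharP F.
have pL : p \in [pchar L] by apply: (rmorph_pchar iota).
rewrite (eq_pnat _ (pcharf_eq pL)) pnatX; apply/orP; left.
by have := card_pprimeChar pF; rewrite [_ #|_|]/= => ->; rewrite pnatX pnat_id.
Qed.

Lemma expf_cardD n (x y : L) : (x + y) ^+ (q ^ n) = x ^+ (q ^ n) + y ^+ (q ^ n).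
Proof. exact: (exprDn_pchar _ _ (pchar_nat_card_exp n)). Qed.

Lemma expf_card_sum n I (r : seq I) (E : I -> L) :
  (\sum_(i <- r) E i) ^+ (q ^ n) = \sum_(i <- r) E i ^+ (q ^ n).
Proof.
elim: r => [|i r IH]; last by rewrite !big_cons expf_cardD IH.
by rewrite !big_nil expr0n expn_eq0 eqn0Ngt (ltnW (finNzRing_gt1 F)).
Qed.

Lemma odd_card_exp n : 2 \notin [pchar F] -> odd (q ^ n).
Proof.
move=> F2; have [p pr_p pF] := finPcharP F.
have := card_pprimeChar pF; rewrite [_ #|_|]/= => ->.
rewrite oddX oddX; apply/orP; right; apply/orP; right.
by case: (even_prime pr_p) => [p2|->//]; move: pF; rewrite p2 (negPf F2).
Qed.

Lemma expf_cardN n (x : L) : (- x) ^+ (q ^ n) = - x ^+ (q ^ n).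
Proof.
apply/eqP; rewrite -subr_eq0 opprK -expf_cardD addNr.
by rewrite expr0n expn_eq0 eqn0Ngt (ltnW (finNzRing_gt1 F)).
Qed.

Lemma expf_cardB n (x y : L) : (x - y) ^+ (q ^ n) = x ^+ (q ^ n) - y ^+ (q ^ n).
Proof. by rewrite expf_cardD expf_cardN. Qed.

Lemma expf_card_iota n (x : F) : iota x ^+ (q ^ n) = iota x.
Proof.
elim: n => [|n IH]; first by rewrite expn0 expr1.
by rewrite expnS exprM -rmorphXn expf_card IH.
Qed.

(** Polynomials over F commute with the powers of the Frobenius map: raising
    a value at y to the power r = q^n gives the value at y^r.  This replaces the
    derivatives of Stepanov's original argument. *)
Lemma horner_expf_card n (p : {poly F}) (x : L) :
  (map_poly iota p).[x] ^+ (q ^ n) = (map_poly iota p).[x ^+ (q ^ n)].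
Proof.
rewrite !horner_coef expf_card_sum; apply: eq_bigr => i _.
by rewrite exprMn coef_map expf_card_iota -!exprM mulnC.
Qed.

Lemma expf_card_inj n : injective (fun x : L => x ^+ (q ^ n)).
Proof.
move=> x y exy; apply/eqP; rewrite -subr_eq0.
suff: (x - y) ^+ (q ^ n) == 0 by rewrite expf_eq0 => /andP[].
by rewrite expf_cardB exy subrr.
Qed.

End Frobenius.

(** * The discriminant polynomial of x + c/x = y^q - y *)

Section AuxPoly.
Variables (F : finFieldType) (c : F).
Hypothesis (F2 : 2 \notin [pchar F]) (c0 : c != 0).
Local Notation q := #|F|.
Local Notation g := ('X^q - 'X : {poly F}).
Local Notation D := (g ^+ 2 - (4%:R * c)%:P).

Lemma card_gt1 : (1 < q)%N. Proof. exact: finNzRing_gt1. Qed.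

Lemma size_XnsubX : size g = q.+1.
Proof.
by rewrite size_polyDl size_polyXn // size_polyN size_polyX ltnS card_gt1.
Qed.

Lemma size_disc : size D = (2 * q).+1.
Proof.
have g2 : size (g ^+ 2) = (2 * q).+1.
  have := size_exp g 2; rewrite size_XnsubX /= mulnC => <-.
  by rewrite prednK // lt0n size_poly_eq0 expf_eq0 /= -size_poly_eq0 size_XnsubX.
rewrite size_polyDl g2 // size_polyN (leq_ltn_trans (size_polyC_leq1 _)) //.
by have := card_gt1; lia.
Qed.

Lemma natr_card_eq0 : q%:R = 0 :> F.
Proof.
have [p pr_p pF] := finPcharP F.
have := card_pprimeChar pF; rewrite [_ #|_|]/= => e.
apply/eqP; rewrite -(dvdn_pcharf pF) e dvdn_exp //.
by rewrite lt0n; apply/eqP => z; move: e card_gt1; rewrite z expn0 => ->.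
Qed.

Lemma deriv_XnsubX : g^`() = - 1.
Proof.
by rewrite derivB derivXn derivX -scaler_nat natr_card_eq0 scale0r sub0r.
Qed.

Lemma nat2_neq0 : 2%:R != 0 :> F.
Proof. by apply: contra F2 => /eqP e; rewrite inE /= e eqxx. Qed.

Lemma deriv_disc : D^`() = - (2%:R *: g).
Proof.
rewrite derivB derivC subr0 expr2 derivM deriv_XnsubX mulrN1 mulN1r -opprD.
by rewrite scaler_nat mulr2n.
Qed.

(** The polynomial D = (y^q - y)^2 - 4c has derivative - 2 (y^q - y), which is
    nonzero at the roots of D since c is; hence D is separable, and a root of D
    has odd multiplicity in D l2^2 but even multiplicity in l1^2. *)
Lemma disc_times_square (l1 l2 : {poly F}) : l1 ^+ 2 = D * l2 ^+ 2 -> l2 = 0.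
Proof.
move=> e; apply/eqP; apply: contraT => l20.
have [L [iota _]] := countable_algebraic_closure F.
pose i := map_poly iota.
have D0 : D != 0 by rewrite -size_poly_eq0 size_disc.
have l10 : l1 != 0.
  apply: contraNneq l20 => l10; move/esym/eqP: e; rewrite l10 expr0n /=.
  by rewrite mulf_eq0 (negPf D0) expf_eq0.
have /closed_rootP [x rx] : size (i D) != 1%N.
  by rewrite size_map_poly size_disc; have := card_gt1; lia.
have iD0 : i D != 0 by rewrite map_poly_eq0.
have m1 : mup x (i D) = 1%N.
  apply/eqP; rewrite eqn_leq mup_leq // (mup_geq _ 1) // expr1 dvdp_XsubCl rx andbT.
  apply/negP => /dvdpP [s es].
  have : (i D)^`().[x] = 0.
    by rewrite es derivM expr2 derivM !hornerE /= subrr !(mulr0, mul0r, addr0).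
  rewrite deriv_map deriv_disc rmorphN hornerN /= map_polyZ hornerZ => /eqP.
  rewrite oppr_eq0 mulf_eq0 fmorph_eq0 (negPf nat2_neq0) /= => /eqP gx.
  move: rx; rewrite /root /i rmorphB rmorphXn /= map_polyC !hornerE gx expr0n /=.
  rewrite sub0r oppr_eq0 fmorph_eq0 mulf_eq0 (negPf c0) orbF.
  by rewrite (natrM _ 2 2) mulf_eq0 (negPf nat2_neq0).
have ei : i l1 * i l1 = i D * (i l2 * i l2) by rewrite /i -!rmorphM -!expr2 e.
have := congr1 (mup x) ei.
rewrite !mupM ?mulf_neq0 ?map_poly_eq0 // m1; lia.
Qed.

End AuxPoly.

Section YDegree.
Variable F : finFieldType.

(** A bivariate polynomial is a polynomial in an outer variable Y whose
    coefficients are polynomials in an inner variable y; this bounds the degree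
    in y. *)
Definition coef_size_le n (W : {poly {poly F}}) := forall i, (size (W`_i)%R <= n)%N.

Lemma coef_size_leM m n V W : coef_size_le m.+1 V -> coef_size_le n.+1 W -> coef_size_le (m + n).+1 (V * W).
Proof.
move=> hV hW i; rewrite coefM (leq_trans (size_sum _ _ _)) //.
apply/bigmax_leqP => j _; apply: (leq_trans (size_polyMleq _ _)).
by have := hV j; have := hW (i - j)%N; lia.
Qed.

Lemma coef_size_leB n V W : coef_size_le n V -> coef_size_le n W -> coef_size_le n (V - W).
Proof.
move=> hV hW i; rewrite coefB (leq_trans (size_polyD _ _)) //.
by rewrite size_polyN geq_max hV hW.
Qed.

Lemma coef_size_leC n (p : {poly F}) : (size p <= n)%N -> coef_size_le n p%:P.
Proof. by move=> h i; rewrite coefC; case: eqP => // _; rewrite size_poly0. Qed.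

Lemma coef_size_le_map (p : {poly F}) : coef_size_le 1 (map_poly polyC p).
Proof. by move=> i; rewrite coef_map size_polyC_leq1. Qed.

(** Uniqueness of the expansion in base G: if the digits have degree smaller
    than that of G, then substituting G for Y loses no information. *)
Lemma base_expansion_eq0 (r : nat) (G : {poly F}) (W : {poly {poly F}}) :
  size G = r.+1 -> coef_size_le r W -> W.[G] = 0 -> W = 0.
Proof.
move=> sG; elim/poly_ind: W => // W w IH hW.
have hw : (size w <= r)%N by have := hW 0%N; rewrite coefD coefMX coefC add0r.
have hW' : coef_size_le r W by move=> i; have := hW i.+1; rewrite coefD coefMX coefC addr0.
rewrite hornerMXaddC => /eqP; rewrite addr_eq0 => /eqP e.
suff WG : W.[G] = 0.
  by move/eqP: e; rewrite WG mul0r eq_sym oppr_eq0 => /eqP ->; rewrite IH // mul0r addr0.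
apply/eqP; apply: contraT => n0.
have : size (W.[G] * G) = size w by rewrite e size_polyN.
rewrite size_mul // ?sG.
  move: n0; rewrite -size_poly_gt0 => n0 h2; exfalso; move: h2 hw n0; rewrite addnS /= => <-; rewrite -{2}[r]add0n leq_add2r leqNgt => /negP h /h [].
by rewrite -size_poly_eq0 sG.
Qed.

End YDegree.

(** * Auxiliary polynomials *)

Section Eval.
Variables (F : finFieldType) (I A : nat).
Local Notation q := #|F|.
Implicit Types (a b : 'M[F]_(I, A)) (p G D : {poly F}).

(** The bivariate polynomial whose i-th coefficient has the i-th row of a as
    its list of coefficients.  Indexing by matrices makes the space of candidates
    a finite type, to which the pigeonhole principle applies. *)
Definition biv a : {poly {poly F}} :=
  \sum_(i < I) (rVpoly (row i a))%:P * 'X^i.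

(** The value of [biv a] at y = p and Y = G. *)
Definition eval_biv a p G : {poly F} := \sum_(i < I) (rVpoly (row i a) \Po p) * G ^+ i.

Lemma eval_bivB a b p G : eval_biv (a - b) p G = eval_biv a p G - eval_biv b p G.
Proof.
rewrite /eval_biv -sumrB; apply: eq_bigr => i _.
by rewrite !linearB /= mulrBl.
Qed.

Lemma horner_biv a G : (biv a).[G] = eval_biv a 'X G.
Proof.
rewrite /biv horner_sum; apply: eq_bigr => i _.
by rewrite hornerM hornerC hornerXn comp_polyXr.
Qed.

Lemma coef_biv a (i : 'I_I) : (biv a)`_i = rVpoly (row i a).
Proof.
rewrite /biv coef_sum (bigD1 i) //= big1 ?addr0.
  by rewrite coefCM coefXn eqxx mulr1.
by move=> j ji; rewrite coefCM coefXn eq_sym (inj_eq val_inj) (negPf ji) mulr0.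
Qed.

Lemma biv_eq0 a : biv a = 0 -> a = 0.
Proof.
move=> e; apply/row_matrixP => i; rewrite row0 -[row i a]rVpolyK -coef_biv e.
by rewrite coef0 linear0.
Qed.

Lemma coef_size_le_biv a : coef_size_le A (biv a).
Proof.
move=> i; rewrite /biv coef_sum (leq_trans (size_sum _ _ _)) //.
apply/bigmax_leqP => j _; rewrite coefCM coefXn.
by case: eqP; rewrite ?mulr0 ?size_poly0 // mulr1 size_poly.
Qed.

Lemma size_eval_biv a p G (m n : nat) : (size p <= m.+1)%N -> (size G <= n.+1)%N ->
  (size (eval_biv a p G) <= (A * m + I * n).+1)%N.
Proof.
have lep (s k : nat) : (s <= k.+1)%N -> (s.-1 <= k)%N by case: s.
move=> hp hG; rewrite (leq_trans (size_sum _ _ _)) //.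
apply/bigmax_leqP => i _; rewrite (leq_trans (size_polyMleq _ _)) //.
have h1 := size_comp_poly_leq (rVpoly (row i a)) p.
have h2 := size_poly_exp_leq G i.
have h3 : ((size (rVpoly (row i a))).-1 * (size p).-1 <= A * m)%N.
  apply: leq_mul; last exact: lep.
  by rewrite (leq_trans (leq_pred _)) ?size_poly.
have h4 : ((size G).-1 * i <= I * n)%N.
  by rewrite mulnC leq_mul // ?(ltnW (ltn_ord i)) // lep.
have {}h1 := leq_trans h1 (h3 : (_.+1 <= _.+1)%N).
have {}h2 := leq_trans h2 (h4 : (_.+1 <= _.+1)%N).
apply: leq_trans (_ : ((A * m).+1 + (I * n).+1).-1 <= _)%N; last by rewrite addnS.
by rewrite addnS /= addSn; apply: lep; rewrite -addSn -addnS leq_add.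
Qed.

(** Pigeonhole: there are more pairs (a, b) than polynomials of the size of
    a(y^r, y) + D^e b(y^r, y), so two pairs have the same image, and their
    difference is killed.  Note that y^r is put into the inner variable and y into
    the outer one. *)
Lemma exists_vanishing_pair D e E : (size D <= (2 * q).+1)%N ->
  forall r, (2 * q * e + A * r + I < E)%N -> (E < 2 * I * A)%N ->
  exists a b, [/\ (a != 0) || (b != 0) &
    eval_biv a 'X^r 'X + D ^+ e * eval_biv b 'X^r 'X = 0].
Proof.
move=> hD r hE hEA.
pose phi (ab : 'M[F]_(I, A) * 'M[F]_(I, A)) : {poly F} :=
  eval_biv ab.1 'X^r 'X + D ^+ e * eval_biv ab.2 'X^r 'X.
have sphi ab : (size (phi ab) <= E)%N.
  rewrite (leq_trans (size_polyD _ _)) // geq_max.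
  have h a : (size (eval_biv a 'X^r 'X) <= (A * r + I).+1)%N.
    by have := @size_eval_biv a 'X^r 'X r 1 _ _; rewrite size_polyXn size_polyX muln1; apply.
  have hDe : (size (D ^+ e) <= (2 * q * e).+1)%N.
    rewrite (leq_trans (size_poly_exp_leq _ _)) // ltnS leq_mul2r.
    by case: (size D) hD => [|s] hs; rewrite orbC -?(ltnS s) ?hs.
  apply/andP; split; first by rewrite (leq_trans (h _)) //; lia.
  rewrite (leq_trans (size_polyMleq _ _)) //; move: (h ab.2) hDe.
  by set s1 := size _; set s2 := size _; lia.
have : ~~ injectiveb (fun ab => poly_rV (phi ab) : 'rV[F]_E).
  apply/negP => /injectiveP /leq_card.
  rewrite card_prod !card_mx -expnD mul1n leq_exp2l ?finNzRing_gt1 //; lia.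
case/injectivePn => -[a b] [[a' b'] ne].
move/(congr1 rVpoly); rewrite !poly_rV_K ?sphi // => epos.
exists (a - a'), (b - b'); split.
  by apply: contraR ne; rewrite negb_or !negbK !subr_eq0 => /andP[/eqP-> /eqP->].
rewrite !eval_bivB mulrBr addrACA -opprD -/(phi (a, b)) -/(phi (a', b')).
by apply/eqP; rewrite subr_eq0 epos.
Qed.

End Eval.

Section AuxNonzero.
Variables (F : finFieldType) (c u : F) (nu I A : nat).
Hypothesis (F2 : 2 \notin [pchar F]) (c0 : c != 0).
Local Notation q := #|F|.
Local Notation D := (('X^q - 'X) ^+ 2 - (4%:R * c)%:P : {poly F}).
Local Notation r := (q ^ nu)%N.

Lemma comp_disc (p : {poly F}) : D \Po p = (p ^+ q - p) ^+ 2 - (4%:R * c)%:P.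
Proof. by rewrite rmorphB rmorphXn rmorphB /= comp_polyC comp_polyX comp_Xn_poly. Qed.

(** Frobenius turns D(y)^r into D(y^r), and D is invariant under translation
    by elements of F because y^q - y is. *)
Lemma disc_exp_card : D ^+ r = D \Po ('X^r - u%:P).
Proof.
have i1 := @expf_card_iota _ _ (@polyC F).
rewrite comp_disc (expf_cardB (@polyC F)) -exprM (mulnC 2) exprM.
rewrite (expf_cardB (@polyC F)) i1.
have /= -> := expf_cardB (@polyC F) 1 'X^r u%:P.
have /= := i1 1%N u; rewrite !expn1 => ->.
rewrite -!exprM (mulnC q); congr (_ ^+ 2 - _); ring.
Qed.

Hypothesis (A0 : (0 < A)%N) (rA : (2 * q + 2 * A < r)%N).

(** With the roles of y and y^r exchanged and y^r shifted by u, no cancellation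
    is possible.  Indeed a + D^((r+1)/2) b = 0 gives a^2 = D(y) D(Y) b^2 at
    Y = y^r - u after squaring, and the degrees in y are below r, so that this is
    an identity in two independent variables.  Comparing leading coefficients
    in Y makes D(y) times a square a square. *)
Lemma substituted_pair_eq0 e (a b : 'M[F]_(I, A)) : (2 * e = r + 1)%N ->
  eval_biv a 'X ('X^r - u%:P) + D ^+ e * eval_biv b 'X ('X^r - u%:P) = 0 ->
  (a == 0) && (b == 0).
Proof.
move=> he; set G := 'X^r - u%:P => /eqP; rewrite addr_eq0 => /eqP e0.
have sG : size G = r.+1.
  rewrite size_polyDl size_polyXn // size_polyN.
  by rewrite (leq_ltn_trans (size_polyC_leq1 _)) // ltnS expn_gt0 (ltnW (finNzRing_gt1 F)).
pose W := biv a ^+ 2 - D%:P * map_poly polyC D * biv b ^+ 2.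
have W0 : W = 0.
  apply: (base_expansion_eq0 sG).
    rewrite /W !expr2; case: A A0 rA a b {W e0} => // A' _ rA' a b.
    have ha := coef_size_leM (coef_size_le_biv a) (coef_size_le_biv a).
    have hb := coef_size_leM (coef_size_le_biv b) (coef_size_le_biv b).
    have hD : coef_size_le (2 * q + 0).+1 (D%:P * map_poly polyC D).
      apply: coef_size_leM; last exact: coef_size_le_map.
      by apply: coef_size_leC; rewrite size_disc.
    have h2 := coef_size_leM hD hb.
    apply: coef_size_leB => i; [apply: (leq_trans (ha i))|apply: (leq_trans (h2 i))]; lia.
  rewrite /W !expr2 hornerD hornerN !hornerM !horner_biv hornerC.
  rewrite -[(map_poly polyC _).[G]]/(_ \Po G) -disc_exp_card e0 mulrNN.
  rewrite mulrACA -exprD (_ : (e + e)%N = (1 + r)%N); last by lia.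
  by rewrite exprD expr1 subrr.
have b0 : biv b = 0.
  apply/eqP; rewrite -lead_coef_eq0; apply/eqP.
  apply: (disc_times_square F2 c0 (l1 := lead_coef (biv a))).
  move/eqP: W0; rewrite subr_eq0 => /eqP /(congr1 lead_coef).
  rewrite !expr2 !lead_coefM lead_coefC lead_coef_map_inj ?polyC0 //; last exact: polyC_inj.
  suff -> : lead_coef D = 1 by rewrite mulr1.
  have lg : lead_coef ('X^q - 'X : {poly F}) = 1.
    rewrite lead_coefDl ?lead_coefXn // size_polyN size_polyX size_polyXn ltnS.
    exact: finNzRing_gt1.
  rewrite lead_coefDl ?lead_coef_exp ?lg ?expr1n //.
  have := size_exp ('X^q - 'X : {poly F}) 2; rewrite size_XnsubX /= => sg.
  rewrite size_polyN (leq_ltn_trans (size_polyC_leq1 _)) //.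
  have := finNzRing_gt1 F.
  by case: (size _) sg => [|[|n]] //= /esym/eqP; rewrite muln_eq0 orbF => /eqP ->.
have a0 : biv a = 0.
  by move/eqP: W0; rewrite /W b0 expr0n mulr0 subr0 expf_eq0 => /andP[_ /eqP].
by rewrite (biv_eq0 a0) (biv_eq0 b0) !eqxx.
Qed.
End AuxNonzero.

(** * The Stepanov-Bombieri bound *)

(** The choice of parameters.  The number 2 I A of unknowns must exceed the
    number of equations, 2 A must stay below r - 2 q so that the base expansion is
    unique, and the degree of the auxiliary polynomial, about r I, must be
    r^2 / 2 + O(r). *)
Lemma stepanov_arith (Q R : nat) : (3 <= Q)%N -> (9 * Q <= R)%N -> odd R ->
  let A := (R.-1./2 - Q)%N in let I := (R + 8 * Q + 1)./2 in
  let e := R.+1./2 in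
  [/\ (0 < A)%N, (2 * Q + 2 * A < R)%N, (2 * e = R + 1)%N,
      (2 * Q * e + A * R + I < (2 * Q * e + A * R + I).+1 < 2 * I * A)%N &
      (2 * (2 * Q * e + A + I * R) <= R * R + 12 * Q * R)%N].
Proof.
move=> Q3 RQ oR A I e.
have eA : (R = 2 * A + 2 * Q + 1)%N by rewrite /A; lia.
have eI : (I = A + 5 * Q + 1)%N by rewrite /I; lia.
have ee : (e = A + Q + 1)%N by rewrite /e; lia.
move: A I e eA eI ee => A I e eA eI ee.
rewrite eI ee; rewrite eA in RQ *; clear eI ee eA oR.
have hA : (7 * Q <= 2 * A + 1)%N by lia.
have h1 : (Q * (7 * Q) <= Q * (2 * A + 1))%N by rewrite leq_mul2l hA orbT.
have h2 : (Q * 3 <= Q * Q)%N by rewrite leq_mul2l Q3 orbT.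
have h3 : (Q * 3 <= Q * A)%N by rewrite leq_mul2l; apply/orP; right; lia.
have h4 : (A * 3 <= A * Q)%N by rewrite leq_mul2l Q3 orbT.
split; [lia|lia|lia| rewrite ltnSn /=; lia | ].
lia.
Qed.

Section Stepanov.
Variables (F : finFieldType) (L : fieldType) (iota : {rmorphism F -> L}).
Variables (c u : F) (nu : nat).
Hypothesis (F2 : 2 \notin [pchar F]) (c0 : c != 0) (nu3 : (3 <= nu)%N).
Local Notation q := #|F|.
Local Notation D := (('X^q - 'X) ^+ 2 - (4%:R * c)%:P : {poly F}).
Local Notation r := (q ^ nu)%N.
Local Notation "p ^:" := (map_poly iota p) (at level 2).

Lemma horner_eval_biv I A (a : 'M[F]_(I, A)) (p G : {poly F}) (y : L) :
  (eval_biv a p G)^:.[y] =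
  \sum_(i < I) (rVpoly (row i a))^:.[p^:.[y]] * G^:.[y] ^+ i.
Proof.
rewrite rmorph_sum horner_sum; apply: eq_bigr => i _.
by rewrite rmorphM rmorphXn /= hornerM horner_exp map_comp_poly horner_comp.
Qed.

Lemma card_ge3 : (3 <= q)%N.
Proof.
have := odd_card_exp 1 F2; have := finNzRing_gt1 F; rewrite expn1.
by case: q => [|[|[|]]].
Qed.

(** Let h be the auxiliary polynomial a(y, y^r - u) + D^e b(y, y^r - u) with
    e = (r+1)/2.  At the points considered, raising h to the power r replaces
    y^r - u by y and leaves D^e = (z^2)^e unchanged, because z^(r^2) = z; so
    h^r equals a(y^r, y) + D^e b(y^r, y), which is 0.  Hence all the points are
    roots of h.  About half of the r^2 solutions of y^(r^2) = y + u have D(y)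
    equal to a square, so the bound is sharp to first order. *)
Lemma stepanov_bound (ys : seq L) : uniq ys ->
  (forall y, y \in ys -> y ^+ (r * r) = y + iota u /\
     exists2 z : L, z ^+ (r * r) = z & z ^+ 2 = D^:.[y]) ->
  (2 * size ys <= r * r + 12 * q * r)%N.
Proof.
move=> uys hys.
have q3 := card_ge3; have odr := odd_card_exp nu F2.
have rq : (9 * q <= r)%N.
  rewrite -(subnK nu3) expnD (leq_trans (_ : _ <= q ^ 3)%N) //.
    by rewrite !expnS expn0 muln1 [leqRHS]mulnA mulnC [leqRHS]mulnC leq_mul2l (leq_mul q3 q3) orbT.
  by rewrite leq_pmull // expn_gt0 (ltnW (finNzRing_gt1 F)).
have [] := stepanov_arith q3 rq odr.
set A := (_ - _)%N; set I := (r + _ + _)./2; set e := r.+1./2.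
move=> A0 rA he /andP[_ hE] hdeg.
have [] := @exists_vanishing_pair F I A D e _ _ r (ltnSn _) hE; first by rewrite size_disc.
move=> a [b [nz star]].
pose G := 'X^r - u%:P; pose h := eval_biv a 'X G + D ^+ e * eval_biv b 'X G.
have h0 : h != 0.
  apply: contraL nz => /eqP /(substituted_pair_eq0 F2 c0 A0 rA he) /andP[/eqP-> /eqP->].
  by rewrite eqxx.
have sG : (size G <= r.+1)%N.
  rewrite (leq_trans (size_polyD _ _)) // size_polyN size_polyXn geq_max leqnn /=.
  by rewrite (leq_trans (size_polyC_leq1 _)).
have sX : (size ('X : {poly F}) <= 2)%N by rewrite size_polyX.
have sh : (size h <= (2 * q * e + A + I * r).+1)%N.
  have s1 := size_eval_biv a sX sG; have s2 := size_eval_biv b sX sG.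
  have s3 : (size (D ^+ e) <= (2 * q * e).+1)%N.
    by rewrite (leq_trans (size_poly_exp_leq _ _)) // size_disc.
  rewrite (leq_trans (size_polyD _ _)) // geq_max; apply/andP; split.
    by rewrite (leq_trans s1) //; lia.
  rewrite (leq_trans (size_polyMleq _ _)) //.
  by move: s2 s3; set x := size _; set y := size _; lia.
have ih0 : h^: != 0 by rewrite map_poly_eq0.
suff rh : all (root h^:) ys.
  have := max_poly_roots ih0 rh uys; rewrite size_map_poly => hs.
  have : (size ys <= 2 * q * e + A + I * r)%N by rewrite -ltnS (leq_trans hs).
  by move/(leq_mul (leqnn 2)) => /leq_trans; apply.
apply/allP => y /hys [yQ [z zQ zD]].
suff: h^:.[y] ^+ r == 0 by rewrite expf_eq0 => /andP[].
have hG : G^:.[y] = y ^+ r - iota u.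
  by rewrite rmorphB /= map_polyXn map_polyC /= hornerD hornerN hornerC hornerXn.
have hGr : (G^:.[y]) ^+ r = y.
  by rewrite hG (expf_cardB iota) expf_card_iota -exprM yQ addrK.
have evr (x : 'M_(I, A)) : (eval_biv x 'X G)^:.[y] ^+ r = (eval_biv x 'X^r 'X)^:.[y].
  rewrite !horner_eval_biv (expf_card_sum iota); apply: eq_bigr => i _.
  rewrite exprMn horner_expf_card -exprM mulnC exprM hGr.
  by rewrite map_polyX map_polyXn hornerX hornerXn.
rewrite rmorphD rmorphM rmorphXn hornerD hornerM horner_exp -zD.
rewrite (expf_cardD iota) exprMn !evr.
have -> : ((z ^+ 2) ^+ e) ^+ r = (z ^+ 2) ^+ e.
  by rewrite -!exprM ?mulnA he mulnDl mul1n exprD zQ addnC exprD expr1.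
have /(congr1 (fun p => p^:.[y])) := star.
by rewrite rmorphD rmorphM rmorphXn hornerD hornerM horner_exp -zD rmorph0 horner0 => ->.
Qed.

End Stepanov.

(** * Points over the extension fields *)

Section Points.
Variables (F : finFieldType) (L : closedFieldType) (iota : {rmorphism F -> L}).
Local Notation q := #|F|.

(** The roots in L of the Artin-Schreier polynomial X^(q^n) - X - a. *)
Definition as_roots n (a : L) : seq L :=
  sval (closed_field_poly_normal ('X^(q ^ n) - 'X - a%:P)).

Lemma card_exp_gt0 n : (0 < q ^ n)%N.
Proof. by rewrite expn_gt0 (ltnW (finNzRing_gt1 F)). Qed.

Lemma card_exp_gt1 n : (0 < n)%N -> (1 < q ^ n)%N.
Proof. by move=> n0; rewrite -(expn0 q) ltn_exp2l // finNzRing_gt1. Qed.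

Section AS.
Variables (n : nat) (a : L).
Hypothesis n0 : (0 < n)%N.
Local Notation P := ('X^(q ^ n) - 'X - a%:P : {poly L}).

Lemma size_as_poly : size P = (q ^ n).+1.
Proof.
have qn := card_exp_gt1 n0.
have s1 : size ('X^(q ^ n) - 'X : {poly L}) = (q ^ n).+1.
  by rewrite size_polyDl size_polyXn // size_polyN size_polyX ltnS.
rewrite size_polyDl s1 // size_polyN.
by rewrite (leq_ltn_trans (size_polyC_leq1 _)) // ltnS card_exp_gt0.
Qed.

Lemma lead_as_poly : lead_coef P = 1.
Proof.
rewrite lead_coefE size_as_poly /= !coefB coefXn coefX coefC eqxx.
by have := card_exp_gt1 n0; case: (q ^ n)%N => [|[|m]] //=; rewrite !subr0.
Qed.

Lemma as_rootsE : P = \prod_(z <- as_roots n a) ('X - z%:P).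
Proof.
rewrite /as_roots; case: (closed_field_poly_normal _) => s /= es.
by rewrite {1}es lead_as_poly scale1r.
Qed.

Lemma size_as_roots : size (as_roots n a) = (q ^ n)%N.
Proof. by have := size_as_poly; rewrite as_rootsE size_prod_XsubC => -[]. Qed.

Lemma mem_as_roots y : (y \in as_roots n a) = (y ^+ (q ^ n) - y == a).
Proof.
rewrite -root_prod_XsubC -as_rootsE /root !hornerD !hornerN hornerXn hornerX hornerC.
by rewrite subr_eq0.
Qed.

Lemma uniq_as_roots : uniq (as_roots n a).
Proof.
rewrite -separable_prod_XsubC -as_rootsE separable_poly.unlock.
have -> : P^`() = - 1.
  rewrite !derivB derivXn derivX derivC subr0 -scaler_nat.
  suff -> : (q ^ n)%:R = 0 :> L by rewrite scale0r sub0r.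
  rewrite -(rmorph_nat iota) natrX (natr_card_eq0 F) expr0n.
  by case: n n0 => // m _; rewrite rmorph0.
by rewrite -(scaleN1r (1 : {poly L})) coprimepZr ?oppr_eq0 ?oner_eq0 // coprimep1.
Qed.

End AS.

(** The elements of the subfield of L with q^n elements. *)
Definition frob_fixed n := as_roots n 0.

Lemma mem_frob_fixed n x : (0 < n)%N -> (x \in frob_fixed n) = (x ^+ (q ^ n) == x).
Proof. by move=> n0; rewrite mem_as_roots // subr_eq0. Qed.

Lemma uniq_frob_fixed n : (0 < n)%N -> uniq (frob_fixed n).
Proof. exact: uniq_as_roots. Qed.

Lemma size_frob_fixed n : (0 < n)%N -> size (frob_fixed n) = (q ^ n)%N.
Proof. exact: size_as_roots. Qed.

(** The trace from the field with q^n elements to F, as an element of L. *)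
Definition frob_trace n (z : L) := \sum_(i < n) z ^+ (q ^ i).

(** Telescoping.  For y^q - y = f this says that the q^n-power map translates
    y by the trace of f. *)
Lemma frob_trace_as n (y : L) : frob_trace n (y ^+ q - y) = y ^+ (q ^ n) - y.
Proof.
rewrite /frob_trace; elim: n => [|n IH]; first by rewrite big_ord0 expr1 subrr.
by rewrite big_ord_recr /= IH (expf_cardB iota) -exprM -expnS addrC addrA subrK.
Qed.

Variable c : F.
Hypothesis (F2 : 2 \notin [pchar F]) (c0 : c != 0).

Definition kl_fun (x : L) : L := x + iota c / x.

Definition trace_fibre_card n u :=
  size [seq x <- frob_fixed n | (x != 0) && (frob_trace n (kl_fun x) == iota u)].

(** Each x in the fibre yields q points y with y^q - y = x + c/x, and each y
    comes from at most two x, the roots of X^2 - (y^q - y) X + c.  The y satisfy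
    y^(q^n) = y + u, and (x - c/x)^2 = D(y), so the bound for y applies. *)
Lemma trace_fibre_bound nu u : (3 <= nu)%N ->
  (q * trace_fibre_card (nu + nu) u <= q ^ nu * q ^ nu + 12 * q * q ^ nu)%N.
Proof.
move=> nu3; have n0 : (0 < nu + nu)%N by lia.
rewrite /trace_fibre_card; set xs := [seq x <- _ | _].
have uxs : uniq xs by rewrite filter_uniq // uniq_frob_fixed.
pose ys := undup (flatten [seq as_roots 1 (kl_fun x) | x <- xs]).
have uys : uniq ys by apply: undup_uniq.
have memys y : y \in ys -> exists2 x, x \in xs & y ^+ q - y = kl_fun x.
  rewrite mem_undup => /flatten_mapP [x xin]; rewrite mem_as_roots // expn1 => /eqP.
  by exists x.
have h1 : (2 * size ys <= q ^ nu * q ^ nu + 12 * q * q ^ nu)%N.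
  apply: (stepanov_bound F2 c0 nu3 (iota := iota) (u := u) uys) => y /memys [x].
  rewrite mem_filter => /andP[/andP[x0 /eqP Tx]]; rewrite mem_frob_fixed // => /eqP xQ yx.
  rewrite -expnD; split.
    by rewrite -Tx -yx frob_trace_as addrC subrK.
  exists (x - iota c / x).
    by rewrite (expf_cardB iota) exprMn exprVn expf_card_iota xQ.
  rewrite rmorphB rmorphXn rmorphB /= map_polyXn map_polyX map_polyC /=.
  rewrite hornerD hornerN hornerC !expr2 hornerM hornerD hornerN hornerXn hornerX.
  rewrite yx /kl_fun rmorphM rmorph_nat.
  by field.
apply: leq_trans h1.
have -> : (q * size xs = \sum_(x <- xs) q)%N by rewrite big_const_seq count_predT iter_addn_0 mulnC.
have -> : (2 * size ys = \sum_(y <- ys) 2)%N by rewrite big_const_seq count_predT iter_addn_0 mulnC.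
apply: (@leq_trans (\sum_(x <- xs) \sum_(y <- ys | (y ^+ q - y == kl_fun x)%R) 1)%N).
  rewrite big_seq [leqRHS]big_seq; apply: leq_sum => x xin.
  rewrite sum1_count -size_filter -{1}(expn1 q) -(@size_as_roots 1 (kl_fun x)) //.
  apply: uniq_leq_size; first exact: uniq_as_roots.
  move=> y yin; rewrite mem_filter; move: (yin); rewrite mem_as_roots // expn1 => -> /=.
  by rewrite mem_undup; apply/flatten_mapP; exists x.
rewrite (exchange_big_dep predT) //=; apply: leq_sum => y _.
rewrite sum1_count -size_filter.
pose P := 'X^2 - (y ^+ q - y) *: 'X + (iota c)%:P.
have sP : size P = 3%N.
  rewrite /P -addrA size_polyDl size_polyXn // (leq_ltn_trans (size_polyD _ _)) //.
  rewrite gtn_max size_polyN (leq_ltn_trans (size_scale_leq _ _)) ?size_polyX //.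
  by rewrite (leq_ltn_trans (size_polyC_leq1 _)).
rewrite -ltnS -sP; apply: max_poly_roots; first by rewrite -size_poly_eq0 sP.
  apply/allP => x; rewrite !mem_filter => /and3P[/eqP yx /andP[x0 _] _].
  rewrite /root /P hornerD hornerC hornerD hornerN hornerZ hornerX hornerXn yx /kl_fun.
  by apply/eqP; field.
by rewrite !filter_uniq // uniq_frob_fixed.
Qed.
End Points.

(** * Frobenius norms of points *)

Section Descent.
Variables (F : finFieldType) (L : closedFieldType) (iota : {rmorphism F -> L}).
Local Notation q := #|F|.
Local Notation "p ^:" := (map_poly iota p) (at level 2).

Lemma fixed_iota z : z ^+ q = z -> exists a, z = iota a.
Proof.
move=> zq; have : z \in [seq iota a | a : F].
  have [||| _ ->] := @uniq_min_size _ [seq iota a | a : F] (frob_fixed F L 1).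
  - by rewrite map_inj_uniq ?enum_uniq //; apply: fmorph_inj.
  - by move=> _ /mapP [a _ ->]; rewrite mem_frob_fixed // expf_card_iota.
  - by rewrite size_map -cardE size_frob_fixed // expn1.
  by rewrite mem_frob_fixed // expn1 zq.
by case/mapP => a _ ->; exists a.
Qed.

(** The inverse of the embedding of F into L, with default value 0. *)
Definition descend (z : L) : F := odflt 0 [pick a | iota a == z].

Lemma descendK a : descend (iota a) = a.
Proof.
rewrite /descend; case: pickP => [b /eqP /fmorph_inj //|].
by move/(_ a); rewrite eqxx.
Qed.

Lemma descend_fixed z : z ^+ q = z -> iota (descend z) = z.
Proof. by case/fixed_iota => a ->; rewrite descendK. Qed.

Definition frob (x : L) := x ^+ q.
Lemma frob_zmod : zmod_morphism frob.
Proof. by move=> x y; rewrite /frob -[q]expn1 (expf_cardB iota). Qed.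
Lemma frob_monoid : monoid_morphism frob.
Proof. by split=> [|x y]; rewrite /frob ?expr1n // exprMn. Qed.
HB.instance Definition _ := GRing.isZmodMorphism.Build L L frob frob_zmod.
HB.instance Definition _ := GRing.isMonoidMorphism.Build L L frob frob_monoid.

(** The norm of X - x from the field with q^m elements to F, when x lies in
    that field: a power of the minimal polynomial of x. *)
Definition normpoly m (x : L) : {poly L} := \prod_(i < m) ('X - (x ^+ (q ^ i))%:P).

Lemma normpolyE m x :
  normpoly m x = \prod_(z <- mkseq (fun i => x ^+ (q ^ i)) m) ('X - z%:P).
Proof.
rewrite /normpoly big_map -(big_mkord xpredT (fun i => 'X - (x ^+ (q ^ i))%:P)).
by rewrite /index_iota subn0.
Qed.

Lemma normpolyD m n x : x ^+ (q ^ m) = x ->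
  normpoly (m + n) x = normpoly m x * normpoly n x.
Proof.
move=> xm; rewrite /normpoly big_split_ord /=; congr (_ * _).
by apply: eq_bigr => i _; rewrite expnD exprM xm.
Qed.

Lemma normpoly_monic m x : normpoly m x \is monic.
Proof. by rewrite normpolyE monic_prod_XsubC. Qed.

Lemma size_normpoly m x : size (normpoly m x) = m.+1.
Proof. by rewrite normpolyE size_prod_XsubC size_mkseq. Qed.

Lemma normpoly_frob m x : (0 < m)%N -> x ^+ (q ^ m) = x ->
  map_poly frob (normpoly m x) = normpoly m x.
Proof.
case: m => // m _ xm; rewrite /normpoly rmorph_prod /= big_ord_recr /=.
rewrite [in RHS]big_ord_recl mulrC; congr (_ * _).
  rewrite rmorphB /= map_polyX map_polyC /= /frob -exprM -expnSr xm.
  by rewrite expn0 expr1.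
apply: eq_bigr => i _; rewrite rmorphB /= map_polyX map_polyC /= /frob.
by rewrite -exprM -expnSr.
Qed.

Definition normpolyF m x : {poly F} := map_poly descend (normpoly m x).

Lemma descend0 : descend 0 = 0.
Proof. by rewrite -(rmorph0 iota) descendK. Qed.

Lemma normpolyFK m x : (0 < m)%N -> x ^+ (q ^ m) = x -> (normpolyF m x)^: = normpoly m x.
Proof.
move=> m0 xm; apply/polyP => i; rewrite coef_map /= coef_map_id0 ?descend0 //.
rewrite descend_fixed //; have /(congr1 (fun p : {poly L} => p`_i)) := normpoly_frob m0 xm.
by rewrite coef_map.
Qed.

Lemma root_frob (f : {poly F}) x i : root f^: x -> root f^: (x ^+ (q ^ i)).
Proof.
rewrite /root -horner_expf_card => /eqP ->.
by rewrite expr0n -leqn0 leqNgt card_exp_gt0.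
Qed.

(** If P is the minimal polynomial of x, of degree e, then the norms of X - x
    from the fields with q^(j e) elements are the powers P^j, and P^j divides f
    exactly when j is at most the multiplicity of x in f.  Summed over the roots
    of f, this count replaces unique factorization in the proof of the Euler
    product. *)
Lemma count_normpoly (f : {poly F}) x M : f \is monic -> (size f <= M.+1)%N ->
  (\sum_(1 <= m < M.+1) ((x ^+ (q ^ m) == x) && (normpoly m x %| f^:)%R) =
   mup x f^:)%N.
Proof.
move: {2}(size f) (leqnn (size f)) => s; elim: s f M => [|s IH] f M.
  rewrite leqn0 size_poly_eq0 => /eqP -> /monicP; rewrite lead_coef0 => /eqP.
  by rewrite eq_sym oner_eq0.
move=> sf fm fM.
have f0 : f^: != 0 by rewrite map_poly_eq0 monic_neq0.
have [rx|nrx] := boolP (root f^: x); last first.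
  rewrite mupNroot // big_nat_cond big1 // => m; rewrite andbT => /andP[m1 _].
  apply/eqP; rewrite eqb0; apply: contra nrx => /andP[_].
  rewrite -dvdp_XsubCl; apply: dvdp_trans; rewrite dvdp_XsubCl.
  rewrite normpolyE root_prod_XsubC; apply/mapP; exists 0%N; first by rewrite mem_iota.
  by rewrite expn0 expr1.
have exE : exists e, (0 < e)%N && (x ^+ (q ^ e) == x).
  pose xs := mkseq (fun i => x ^+ (q ^ i)) (size f).
  have : ~~ uniq xs.
    apply/negP => uxs; have := max_poly_roots f0 _ uxs.
    rewrite size_mkseq size_map_poly ltnn => h.
    suff: false by []; apply: h.
    by apply/allP => _ /mapP [i _ ->]; apply: root_frob.
  (* Two conjugates of x coincide, and the Frobenius map is injective. *)
  case/(uniqPn 0) => i [j [ij jlt]]; rewrite size_mkseq in jlt.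
  rewrite !nth_mkseq // ?(ltn_trans ij) // => exy.
  exists (j - i)%N; rewrite subn_gt0 ij /=.
  apply/eqP/(@expf_card_inj F L iota i); rewrite -exprM -expnD subnK ?exy //.
  exact: ltnW.
case: (ex_minnP exE) => e /andP[e0 /eqP xe] emin.
have ue : uniq (mkseq (fun i => x ^+ (q ^ i)) e).
  apply/mkseq_uniqP => i j; rewrite !inE => ie je.
  wlog ij : i j ie je / (i <= j)%N.
    by move=> h; case: (leqP i j) => [/h|/ltnW /h h' e']; [apply|rewrite h'].
  move=> exy; apply/eqP; rewrite eqn_leq ij /=; apply: contraT; rewrite -ltnNge => {}ij.
  have : (0 < j - i)%N && (x ^+ (q ^ (j - i)) == x).
    rewrite subn_gt0 ij /=; apply/eqP/(@expf_card_inj F L iota i).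
    by rewrite -exprM -expnD subnK ?exy // ltnW.
  by move/emin; rewrite leqNgt (leq_ltn_trans (leq_subr _ _)).
have dP : normpoly e x %| f^:.
  rewrite normpolyE; apply: uniq_roots_dvdp; last by rewrite uniq_rootsE.
  by apply/allP => _ /mapP [i _ ->]; apply: root_frob.
move: (dP); rewrite -(normpolyFK e0 xe) dvdp_map => /dvdpP [f' ff'].
have Pm : normpolyF e x \is monic by rewrite -(map_monic iota) normpolyFK // normpoly_monic.
have sP : size (normpolyF e x) = e.+1 by rewrite -(size_map_poly iota) normpolyFK // size_normpoly.
have f'm : f' \is monic by move: fm; rewrite ff' monicMr.
have sf' : size f = (size f' + e)%N.
  by rewrite ff' size_mul ?monic_neq0 // sP addnS.
have f'0 : f'^: != 0 by rewrite map_poly_eq0 monic_neq0.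
have P0 : normpoly e x != 0 by rewrite monic_neq0 // normpoly_monic.
have fE : f^: = normpoly e x * f'^: by rewrite ff' rmorphM /= normpolyFK // mulrC.
have mP : mup x (normpoly e x) = 1%N.
  move: ue P0; rewrite normpolyE; case: e e0 {xe emin dP ff' Pm sP sf' fE} => // e _.
  rewrite /mkseq /= expn0 expr1 big_cons => /andP[xn _] P0.
  rewrite mulf_eq0 negb_or in P0; case/andP: P0 => P1 P2.
  rewrite mupM // [X in (_ + X)%N]mupNroot ?root_prod_XsubC //.
  by have := mup_XsubCX 1 x x; rewrite expr1 eqxx => ->.
rewrite fE mupM // mP.
have eM : (e <= M)%N by rewrite sf' in fM; have := size_poly_gt0 f'; rewrite monic_neq0 //; lia.
(* Terms below the minimal exponent e vanish, the term at e is 1, and the terms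
   beyond e are those of the cofactor f', shifted by e. *)
rewrite (@big_cat_nat _ _ _ e) //=; last by rewrite leqW.
rewrite big_nat_cond big1 ?add0n; last first.
  move=> m; rewrite andbT => /andP[m1 me]; apply/eqP; rewrite eqb0; apply/negP.
  by case/andP=> xm _; have := emin m; rewrite m1 xm leqNgt me => /(_ isT).
rewrite big_nat_recl ?ltnS // xe eqxx dvdp_mulr ?dvdpp //=.
have hs : (size f' <= s)%N by rewrite sf' in sf; lia.
have hM : (size f' <= (M - e).+1)%N by rewrite sf' in fM; lia.
congr (_ + _)%N; rewrite -(IH f' (M - e)%N) //.
rewrite big_add1 -{1}(add0n e) big_addn /=; apply: eq_bigr => i _.
rewrite (_ : (i + e).+1 = e + i.+1)%N; last by rewrite addnC addnS.
by rewrite expnD exprM xe normpolyD // dvdp_mul2l.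
Qed.

End Descent.

(** * The L-series of a Kloosterman sum *)

Section LFun.
Variables (F : finFieldType) (L : closedFieldType) (iota : {rmorphism F -> L}).
Variables (c : F) (chi : F -> algC).
Hypothesis (chiD : forall x y, chi (x + y) = chi x * chi y).
Local Notation q := #|F|.
Local Notation "p ^:" := (map_poly iota p) (at level 2).
Local Notation kl := (kl_fun iota c).
Local Notation desc := (descend iota).

Definition proots (p : {poly L}) := sval (closed_field_poly_normal p).

Lemma prootsE p : p \is monic -> p = \prod_(z <- proots p) ('X - z%:P).
Proof.
move/monicP=> pm; rewrite /proots; case: closed_field_poly_normal => s /= {1}->.
by rewrite pm scale1r.
Qed.

Lemma perm_proots s : perm_eq (proots (\prod_(z <- s) ('X - z%:P))) s.
Proof. by apply: prod_XsubC_eq; rewrite -prootsE // monic_prod_XsubC. Qed.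

Lemma sum_kl_fun_roots (s : seq L) : s != [::] -> 0 \notin s ->
  let P := \prod_(z <- s) ('X - z%:P) in
  \sum_(z <- s) kl z = - P`_(size s).-1 - iota c * P`_1 / P`_0.
Proof.
move=> s0 sn P; rewrite big_split /= /P coefPn_prod_XsubC ?opprK; last by rewrite size_eq0.
congr (_ + _); rewrite -mulr_sumr -mulrA -mulrN; congr (_ * _).
elim: s {s0 P} sn => [|z s IH]; first by rewrite !big_nil !coefC /= mul0r oppr0.
rewrite inE negb_or eq_sym => /andP[z0 sn]; rewrite !big_cons IH //.
have Q0 : (\prod_(x <- s) ('X - x%:P))`_0 != 0.
  by rewrite -horner_coef0 -[_ == 0]/(root _ 0) root_prod_XsubC.
set Q := \prod_(x <- s) _ in Q0 *.
rewrite !mulrBl !coefB !coefXM !coefCM /= sub0r.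
by field; rewrite oppr_eq0 mulf_neq0 ?z0 ?Q0.
Qed.

Definition root_weight (f : {poly F}) : L := \sum_(z <- proots f^:) kl z.
(** The same sum in terms of the coefficients of a monic f, by Vieta. *)
Definition coef_weight (f : {poly F}) : F := - f`_(size f).-2 - c * f`_1 / f`_0.

Lemma root_weightE f : f \is monic -> (1 < size f)%N -> f`_0 != 0 ->
  root_weight f = iota (coef_weight f).
Proof.
move=> fm sf f0; have fLm : f^: \is monic by rewrite map_monic.
have e := prootsE fLm; rewrite /root_weight /coef_weight.
have ss : size f = (size (proots f^:)).+1.
  by rewrite -(size_map_poly iota) {1}e size_prod_XsubC.
rewrite sum_kl_fun_roots -?e.
- by rewrite ss /= !coef_map rmorphB rmorphN rmorphM rmorphM fmorphV.
- by rewrite -size_eq0 -lt0n -ltnS -ss.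
by rewrite -root_prod_XsubC -e /root horner_coef0 coef_map fmorph_eq0.
Qed.

Lemma root_weight1 f : f \is monic -> (size f <= 1)%N -> root_weight f = 0.
Proof.
move=> fm sf; have fLm : f^: \is monic by rewrite map_monic.
have e := prootsE fLm; have := size_map_poly iota f; rewrite /root_weight {1}e size_prod_XsubC.
by move=> h; rewrite -h ltnS leqn0 size_eq0 in sf; rewrite (eqP sf) big_nil.
Qed.

Lemma root_weight_in f : f \is monic -> f`_0 != 0 -> exists a, root_weight f = iota a.
Proof.
move=> fm f0; have [sf|sf] := ltnP 1 (size f).
  by exists (coef_weight f); apply: root_weightE.
by exists 0; rewrite root_weight1 // rmorph0.
Qed.

Lemma root_weightM f g : f \is monic -> g \is monic -> root_weight (f * g) = root_weight f + root_weight g.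
Proof.
move=> fm gm; rewrite /root_weight -big_cat /=; apply: perm_big.
have fLm : f^: \is monic by rewrite map_monic.
have gLm : g^: \is monic by rewrite map_monic.
rewrite rmorphM /= {1}(prootsE fLm) {1}(prootsE gLm) -big_cat /=.
exact: perm_proots.
Qed.

(** A completely multiplicative function on monic polynomials; the Kloosterman
    sum is its sum over linear polynomials. *)
Definition char_weight (f : {poly F}) : algC := if f`_0 == 0 then 0 else chi (desc (root_weight f)).

Lemma char_weightM f g : f \is monic -> g \is monic -> char_weight (f * g) = char_weight f * char_weight g.
Proof.
move=> fm gm; rewrite /char_weight root_weightM // coef0M mulf_eq0.
have [f0|f0] := eqVneq f`_0 0; first by rewrite mul0r.
have [g0|g0] := eqVneq g`_0 0; first by rewrite mulr0.
have [a ->] := root_weight_in fm f0; have [b ->] := root_weight_in gm g0.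
by rewrite -rmorphD !descendK chiD.
Qed.

Lemma kl_fun_exp x i : kl x ^+ (q ^ i) = kl (x ^+ (q ^ i)).
Proof. by rewrite /kl_fun (expf_cardD iota) exprMn exprVn expf_card_iota. Qed.

(** The roots of the norm polynomial are the conjugates of x, so that its
    weight is the character at a trace: a term of the Kloosterman sum over the
    field with q^m elements. *)
Lemma char_weight_normpolyF m x : (0 < m)%N -> x ^+ (q ^ m) = x ->
  char_weight (normpolyF iota m x) = if x == 0 then 0 else chi (desc (frob_trace F m (kl x))).
Proof.
move=> m0 xm; rewrite /char_weight /root_weight normpolyFK // -(fmorph_eq0 iota) -coef_map normpolyFK //.
have -> : ((normpoly F m x)`_0 == 0) = (x == 0).
  rewrite -horner_coef0 -[_ == 0]/(root _ 0) normpolyE root_prod_XsubC.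
  apply/mapP/eqP => [[i _ /esym /eqP]|->].
    by rewrite expf_eq0 => /andP[_ /eqP].
  by exists 0%N; rewrite ?mem_iota ?add0n // expr0n expn_eq0 ?expr1.
case: ifP => // x0; congr (chi (desc _)).
rewrite normpolyE (perm_big _ (perm_proots _)) /= big_map /frob_trace.
rewrite -(big_mkord xpredT (fun i => kl x ^+ (q ^ i))) /index_iota subn0.
by apply: eq_bigr => i _; rewrite kl_fun_exp.
Qed.

Definition monics n : seq {poly F} := [seq 'X^n + rVpoly v | v : 'rV[F]_n].

Lemma size_monic n (v : 'rV[F]_n) : size ('X^n + rVpoly v) = n.+1.
Proof. by rewrite size_polyDl size_polyXn // ltnS size_poly. Qed.

Lemma mem_monics n f : (f \in monics n) = (f \is monic) && (size f == n.+1).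
Proof.
apply/mapP/andP => [[v _ ->]|[fm /eqP sf]].
  rewrite size_monic eqxx; split=> //.
  by apply/monicP; rewrite lead_coefDl ?lead_coefXn // size_polyXn ltnS size_poly.
exists (poly_rV (f - 'X^n)); first by rewrite mem_enum.
rewrite poly_rV_K; first by rewrite addrC subrK.
apply/leq_sizeP => j nj; rewrite coefB coefXn.
move: nj; rewrite leq_eqVlt => /orP[/eqP <-|nj].
  by rewrite eqxx; move/monicP: fm; rewrite lead_coefE sf /= => ->; rewrite subrr.
by rewrite nth_default ?sf // gtn_eqF // subrr.
Qed.

Lemma uniq_monics n : uniq (monics n).
Proof.
rewrite map_inj_uniq ?enum_uniq // => v w /addrI /(congr1 (@poly_rV _ n)).
by rewrite !rVpolyK.
Qed.

(** The coefficient of T^n in the L-series of [char_weight]. *)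
Definition lseries n : algC := \sum_(f <- monics n) char_weight f.
(** The Kloosterman sum over the field with q^n elements, for the character
    chi composed with the trace. *)
Definition lift_kloosterman n : algC := \sum_(x <- frob_fixed F L n) char_weight (normpolyF iota n x).

Lemma sum_multiples n m P : (m <= n)%N -> P \in monics m ->
  \sum_(f <- monics n | P %| f) char_weight f = char_weight P * lseries (n - m).
Proof.
rewrite mem_monics => mn /andP[Pm /eqP sP].
rewrite -big_filter /lseries big_distrr /=.
have pe : perm_eq [seq f <- monics n | P %| f] [seq P * g | g <- monics (n - m)].
  apply: uniq_perm.
  - by rewrite filter_uniq // uniq_monics.
  - by rewrite map_inj_uniq ?uniq_monics //; apply: mulfI; apply: monic_neq0.
  move=> f; rewrite mem_filter mem_monics; apply/andP/mapP => [[]|].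
    case/dvdpP => g -> /andP[]; rewrite monicMr // => gm.
    rewrite size_mul ?monic_neq0 // sP addnS /= => /eqP sg.
    exists g; last by rewrite mulrC.
    by rewrite mem_monics gm -(eqn_add2r m) sg addSn subnK ?eqxx.
  case=> g; rewrite mem_monics => /andP[gm /eqP sg] ->.
  rewrite dvdp_mulr // monicMl // gm size_mul ?monic_neq0 // sP sg /=; split=> //.
  by rewrite addnS subnKC ?eqxx.
rewrite (perm_big _ pe) /= big_map big_seq [RHS]big_seq.
by apply: eq_bigr => g; rewrite mem_monics => /andP[gm _]; rewrite char_weightM.
Qed.

(** The coefficientwise form of the logarithmic derivative of an Euler product:
    the degree of f is the number of its roots, counted through
    [count_normpoly]. *)
Lemma count_points n f : f \in monics n ->
  (\sum_(1 <= m < n.+1) \sum_(x <- frob_fixed F L m | (normpoly F m x %| f^:)%R) 1 = n)%N.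
Proof.
rewrite mem_monics => /andP[fm /eqP sf].
have fLm : f^: \is monic by rewrite map_monic.
have f0 : f^: != 0 by rewrite monic_neq0.
pose rs := undup (proots f^:).
transitivity (\sum_(1 <= m < n.+1) \sum_(x <- rs)
  ((x ^+ (q ^ m) == x)%R && (normpoly F m x %| f^:)%R))%N.
  rewrite !big_nat; apply: eq_bigr => m /andP[m1 _].
  rewrite [RHS](_ : _ = \sum_(x <- rs | (x ^+ (q ^ m) == x)%R && (normpoly F m x %| f^:)%R) 1)%N; last first.
    by rewrite [RHS]big_mkcond /=; apply: eq_bigr => x _; case: (_ && _).
  rewrite -big_filter -[RHS]big_filter; apply: perm_big; apply: uniq_perm.
  - by rewrite filter_uniq // uniq_frob_fixed.
  - by rewrite filter_uniq // undup_uniq.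
  move=> x; rewrite !mem_filter mem_frob_fixed // mem_undup.
  rewrite -root_prod_XsubC -prootsE //.
  case: eqP => xm; last by rewrite andbF.
  rewrite andbT /=; case dv: (_ %| _) => //=; symmetry.
  rewrite -dvdp_XsubCl; apply: dvdp_trans dv; rewrite dvdp_XsubCl.
  rewrite normpolyE root_prod_XsubC; apply/mapP; exists 0%N; first by rewrite mem_iota.
  by rewrite expn0 expr1.
rewrite exchange_big /=.
transitivity (\sum_(x <- rs) count_mem x (proots f^:))%N.
  apply: eq_bigr => x _; rewrite count_normpoly ?sf //.
  rewrite {1}(prootsE fLm); elim: (proots _) => [|z s IH].
    by rewrite big_nil mupNroot // root1.
  rewrite big_cons mupM ?IH /=.
  - by have := mup_XsubCX 1 x z; rewrite expr1 => ->; rewrite eq_sym; case: eqP.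
  - by rewrite polyXsubC_eq0.
  by rewrite monic_neq0 // monic_prod_XsubC.
have -> : n = size (proots f^:).
  have := size_map_poly iota f; rewrite sf {1}(prootsE fLm) size_prod_XsubC.
  by case.
rewrite -(perm_size (perm_count_undup (proots f^:))) size_flatten sumnE !big_map.
by apply: eq_bigr => x _; rewrite size_nseq.
Qed.

(** This is T L'(T) = L(T) times the sum of the K_m T^m, read off at T^n.
    Insert [count_points] for the factor n and exchange the sums: the multiples
    of the norm of a point x contribute the weight of that norm times a
    coefficient of lower degree. *)
Lemma lseries_recursion n : n%:R * lseries n = \sum_(1 <= m < n.+1) lift_kloosterman m * lseries (n - m).
Proof.
rewrite /lseries big_distrr /=.
transitivity (\sum_(f <- monics n) \sum_(1 <= m < n.+1)
   \sum_(x <- frob_fixed F L m | normpoly F m x %| f^:) char_weight f).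
  rewrite big_seq [RHS]big_seq; apply: eq_bigr => f fn.
  rewrite -{1}(count_points fn) natr_sum mulr_suml; apply: eq_bigr => m _.
  by rewrite natr_sum mulr_suml; apply: eq_bigr => x _; rewrite mul1r.
rewrite exchange_big /= !big_nat; apply: eq_bigr => m /andP[m1 mn].
rewrite (exchange_big_dep xpredT) //= /lift_kloosterman big_distrl /= big_seq [RHS]big_seq.
apply: eq_bigr => x; rewrite mem_frob_fixed // => /eqP xm.
rewrite -[RHS]sum_multiples //.
  by apply: eq_bigl => f; rewrite -(normpolyFK iota m1 xm) dvdp_map.
rewrite mem_monics -(map_monic iota) -(size_map_poly iota) normpolyFK //.
by rewrite normpoly_monic size_normpoly eqxx.
Qed.
End LFun.

(** * Additive characters *)

(** Only one nontrivial character is ever needed: all others are x |-> chi(a x). *)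
Record is_add_char (F : finFieldType) (chi : F -> algC) : Prop := AddChar {
  char0 : chi 0 = 1;
  charD : forall x y, chi (x + y) = chi x * chi y;
  char_nontriv : exists a, chi a != 1 }.

Section AddChar.
Variables (F : finFieldType) (chi : F -> algC).
Hypothesis chiP : is_add_char chi.
Local Notation q := #|F|.

Lemma charN_mul x : chi x * chi (- x) = 1.
Proof. by rewrite -(charD chiP) subrr (char0 chiP). Qed.

Lemma char_neq0 x : chi x != 0.
Proof.
by apply/eqP => e; have := charN_mul x; rewrite e mul0r => /eqP; rewrite eq_sym oner_eq0.
Qed.

Lemma char_natmul x n : chi (x *+ n) = chi x ^+ n.
Proof.
elim: n => [|n IH]; first by rewrite mulr0n expr0 (char0 chiP).
by rewrite mulrS exprS (charD chiP) IH.
Qed.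

Lemma norm_char x : `|chi x| = 1.
Proof.
have [p pr_p pF] := finPcharP F.
have : chi x ^+ p = 1 by rewrite -char_natmul mulrn_pchar // (char0 chiP).
move/(congr1 Num.norm); rewrite normrX normr1 => /eqP.
by rewrite pexpr_eq1 ?prime_gt0 // => /eqP.
Qed.

Lemma char_conj x : (chi x)^* = chi (- x).
Proof.
apply: (mulfI (char_neq0 x)); rewrite charN_mul -normCK norm_char.
by rewrite expr1n.
Qed.

Lemma sum_char a : \sum_x chi (a * x) = if a == 0 then q%:R else 0.
Proof.
have [->|a0] := eqVneq a 0.
  rewrite (eq_bigr (fun=> 1)); first by rewrite sumr_const.
  by move=> x _; rewrite mul0r (char0 chiP).
have [b hb] := char_nontriv chiP.
set s := \sum_x _; have e : s = chi b * s.
  rewrite {1}/s (reindex_inj (addrI (b / a))) /= /s mulr_sumr; apply: eq_bigr => x _.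
  by rewrite mulrDr (charD chiP) (mulrC a (b / a)) divfK //.
apply/eqP; move/eqP: e; rewrite -subr_eq0 -{1}[s]mul1r -mulrBl mulf_eq0.
by rewrite subr_eq0 eq_sym (negPf hb).
Qed.

End AddChar.

(** Take a nonzero coordinate of F over its prime field and send it to a power
    of a primitive p-th root of unity. *)
Lemma exists_add_char (F : finFieldType) : exists chi : F -> algC, is_add_char chi.
Proof.
have [p pr_p pF] := finPcharP F.
pose V := pPrimeCharType pF.
have [z pz] := C_prim_root_exists (prime_gt0 pr_p).
have dV : (0 < \dim {:V})%N.
  by rewrite lt0n dimv_eq0 -subv0; apply/negP => /subvP /(_ 1 (memvf _)); rewrite memv0 oner_eq0.
pose i := Ordinal dV.
pose co (x : F) : 'F_p := coord (vbasis {:V}) i (x : V).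
have coD x y : co (x + y) = co x + co y by rewrite /co -linearD.
exists (fun x => z ^+ (co x)); split.
- by rewrite /co linear0 expr0.
- move=> x y; rewrite coD -exprD -[RHS](prim_expr_mod pz) /=.
  by congr (_ ^+ (_ %% _)); apply: Fp_cast.
exists ((vbasis {:V})`_i); rewrite /co coord_free ?(basis_free (vbasisP _)) // eqxx.
by rewrite -(prim_order_dvd pz) /= modn_small ?Fp_cast ?prime_gt1 // gtnNdvd ?prime_gt1.
Qed.

(** * The Weil bound for Kloosterman sums *)

Section KloostermanClosure.
Variables (F : finFieldType) (L : closedFieldType) (iota : {rmorphism F -> L}).
Variables (c : F) (chi : F -> algC).
Hypothesis (F2 : 2 \notin [pchar F]) (c0 : c != 0) (chiP : is_add_char chi).
Local Notation q := #|F|.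
Local Notation "p ^:" := (map_poly iota p) (at level 2).
Local Notation cn := (lseries iota c chi).
Local Notation Kn := (lift_kloosterman iota c chi).
Local Notation lam := (char_weight iota c chi).
Definition kloosterman : algC := \sum_(t | t != 0) chi (t + c / t).

Let chi0 := char0 chiP.
Let chiD := charD chiP.

Lemma char_weightE f : f \is monic -> (1 < size f)%N ->
  lam f = if f`_0 == 0 then 0 else chi (coef_weight c f).
Proof.
by move=> fm sf; rewrite /char_weight; case: eqP => // /eqP f0; rewrite root_weightE // descendK.
Qed.

Lemma monics0 : perm_eq (monics F 0) [:: 1].
Proof.
apply: uniq_perm; rewrite ?uniq_monics // => f; rewrite mem_monics inE.
apply/andP/eqP => [[/monicP fm /eqP sf]|->]; last by rewrite monic1 size_poly1.
by move: fm; rewrite lead_coefE sf /= => f0; rewrite (size1_polyC (eq_leq sf)) f0.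
Qed.

Lemma lseries0 : cn 0 = 1.
Proof.
rewrite /lseries (perm_big _ monics0) big_seq1 /char_weight coef1 /= oner_eq0.
by rewrite root_weight1 ?monic1 ?size_poly1 // descend0 chi0.
Qed.

Lemma lseriesS n : cn n.+1 = \sum_(g <- monics F n) \sum_(a : F) lam (g * 'X + a%:P).
Proof.
have p : perm_eq (monics F n.+1) [seq g * 'X + a%:P | g <- monics F n, a <- enum F].
  apply: uniq_perm; rewrite ?uniq_monics //.
    apply: allpairs_uniq; rewrite ?uniq_monics ?enum_uniq // => -[g a] [h b] _ _ /= e.
    have ea : a = b.
      by have := congr1 (fun p : {poly F} => p`_0) e; rewrite !coefD !coefMX !coefC !add0r.
    by move: e; rewrite ea => /addIr /(mulIf (negbT (polyX_eq0 F))) ->.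
  move=> f; rewrite mem_monics; apply/andP/allpairsP => [[fm /eqP sf]|].
    exists (drop_poly 1 f, f`_0); rewrite mem_enum; split=> //=; last first.
      rewrite -{1}(poly_take_drop 1 f) addrC expr1; congr (_ + _); apply/polyP => i.
    by rewrite coef_take_poly coefC; case: i.
    rewrite mem_monics size_drop_poly sf subn1 eqxx andbT.
    move/monicP: fm; rewrite monicE !lead_coefE size_drop_poly sf subn1 /=.
    by rewrite coef_drop_poly addn1 => ->.
  case=> -[g a] /= []; rewrite mem_monics => /andP[gm /eqP sg] _ ->.
  have g0 : g != 0 by apply: monic_neq0.
  rewrite -cons_poly_def size_cons_poly nil_poly (negPf g0) sg eqxx; split=> //.
  rewrite monicE cons_poly_def lead_coefDl; first by rewrite lead_coefMX -monicE.
  by rewrite size_mulX // sg (leq_ltn_trans (size_polyC_leq1 _)).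
rewrite /lseries (perm_big _ p) /= big_allpairs_dep /=.
by apply: eq_bigr => g _; rewrite big_enum.
Qed.

Lemma lseries1 : cn 1 = kloosterman.
Proof.
rewrite lseriesS (perm_big _ monics0) big_seq1 /= mul1r.
rewrite /kloosterman [RHS](reindex_inj oppr_inj) /= [RHS]big_mkcond.
apply: eq_bigr => a _; rewrite char_weightE ?monicXaddC ?size_XaddC //.
rewrite /coef_weight size_XaddC coefD coefX coefC add0r /= oppr_eq0.
rewrite coefD coefX coefC /= addr0 mulr1 invrN mulrN.
by case: (a == 0).
Qed.

Lemma monics1 : perm_eq (monics F 1) [seq 'X + b%:P | b : F].
Proof.
apply: uniq_perm; rewrite ?uniq_monics //.
  by rewrite map_inj_uniq ?enum_uniq // => a b /addrI /polyC_inj.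
move=> f; rewrite mem_monics; apply/andP/mapP => [[/monicP fm /eqP sf]|[b _ ->]].
  exists f`_0; rewrite ?mem_enum //; move: fm; rewrite lead_coefE sf /= => f1.
  apply/polyP => i; rewrite coefD coefX coefC.
  case: i => [|[|i]]; rewrite ?add0r ?addr0 //= nth_default ?sf //.
by rewrite monicXaddC size_XaddC.
Qed.

(** The weight of X^2 + b X + a is chi(- b (1 + c / a)); the sum over b vanishes
    unless a = - c. *)
Lemma lseries2 : cn 2 = q%:R.
Proof.
rewrite lseriesS (perm_big _ monics1) /= big_map big_enum /= exchange_big /=.
transitivity (\sum_(a | a != 0) \sum_b chi ((- (1 + c / a)) * b)).
  rewrite [RHS]big_mkcond; apply: eq_bigr => a _.
  have lE b : lam (('X + b%:P) * 'X + a%:P) =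
              if a == 0 then 0 else chi (- (1 + c / a) * b).
    have g0 : 'X + b%:P != 0 :> {poly F} by rewrite -size_poly_eq0 size_XaddC.
    have sf : size (('X + b%:P) * 'X + a%:P) = 3%N.
      by rewrite -cons_poly_def size_cons_poly nil_poly (negPf g0) size_XaddC.
    have fm : ('X + b%:P) * 'X + a%:P \is monic.
      by rewrite monicE lead_coefE sf coefD coefMX coefC coefD coefX coefC /= !addr0.
    rewrite char_weightE ?sf // /coef_weight sf /= !coefD !coefMX !coefC coefD coefX coefC /=.
    rewrite !add0r addr0; case: eqP => // _; congr chi.
    by rewrite mulrAC mulNr mulrDl mul1r opprD.
  by case: ifPn => [a0|/negPn /eqP a0]; [|apply: big1 => b _]; rewrite ?lE ?a0 ?eqxx //;
    apply: eq_bigr => b _; rewrite lE (negPf a0).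
rewrite (eq_bigr (fun a => if a == - c then q%:R else 0)); last first.
  move=> a a0; rewrite (sum_char chiP) oppr_eq0; congr (if _ then _ else _).
  rewrite -(inj_eq (mulIf a0)) mulrDl divfK // mul1r mul0r.
  by rewrite addr_eq0.
rewrite -big_mkcondr (big_pred1 (- c)) // => a /=.
by case: (eqVneq a (- c)) => [->|]; rewrite ?andbF // oppr_eq0 c0.
Qed.

(** In degree n >= 3 the coefficient of X^(n-1) enters the weight additively and
    independently of the two lowest coefficients, so translating it multiplies
    the sum by a value of chi different from 1. *)
Lemma lseries_ge3 n : (3 <= n)%N -> cn n = 0.
Proof.
case: n => // n n2; have [t ht] := char_nontriv chiP.
pose sh (f : {poly F}) := f - t *: 'X^n.
have st : size (t *: 'X^n) = n.+1.
  rewrite size_scale ?size_polyXn //.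
  by apply: contraNneq ht => ->; rewrite chi0.
have shE f : f \in monics F n.+1 -> sh f \in monics F n.+1.
  rewrite !mem_monics => /andP[/monicP fm /eqP sf].
  have s : size (sh f) = n.+2 by rewrite size_polyDl ?size_polyN ?st ?sf.
  by rewrite s eqxx monicE lead_coefDl ?fm ?eqxx // size_polyN st sf.
have inj : injective sh by move=> f g /addIr.
have p : perm_eq (map sh (monics F n.+1)) (monics F n.+1).
  have us : uniq (map sh (monics F n.+1)) by rewrite map_inj_uniq ?uniq_monics.
  apply: uniq_perm; rewrite ?uniq_monics //.
  have hs : {subset map sh (monics F n.+1) <= monics F n.+1}.
    by move=> _ /mapP [f fin ->]; apply: shE.
  have hz : (size (monics F n.+1) <= size (map sh (monics F n.+1)))%N by rewrite size_map.
  by have [_ h] := uniq_min_size us hs hz.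
have e : cn n.+1 = chi t * cn n.+1.
  rewrite {1}/lseries -(perm_big _ p) /= big_map /lseries big_distrr /= big_seq [RHS]big_seq.
  apply: eq_bigr => f fin; have := shE _ fin; move: fin.
  rewrite !mem_monics => /andP[fm /eqP sf] /andP[shm /eqP ssh].
  rewrite !char_weightE ?sf ?ssh // /coef_weight sf ssh /=.
  rewrite /sh !coefB !coefZ !coefXn eqxx !(ltn_eqF, gtn_eqF) //; last exact: ltnW.
  rewrite !mulr0 !subr0 mulr1; case: eqP => _; first by rewrite mulr0.
  by rewrite -chiD; congr chi; ring.
apply/eqP; move/eqP: e; rewrite -subr_eq0 -{1}[lseries _ _ _ _]mul1r -mulrBl mulf_eq0.
by rewrite subr_eq0 eq_sym (negPf ht).
Qed.

Lemma lift_kloosterman1 : Kn 1 = kloosterman.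
Proof.
have := lseries_recursion iota c chiD 1; rewrite big_nat1 subnn lseries0 lseries1 mulr1.
by rewrite mul1r.
Qed.

Lemma lift_kloosterman2 : Kn 2 = 2%:R * q%:R - kloosterman ^+ 2.
Proof.
have := lseries_recursion iota c chiD 2.
rewrite big_nat_recr //= big_nat1 subnn lseries0 lseries1 lseries2 mulr1 lift_kloosterman1 => ->.
by ring.
Qed.

Lemma lift_kloosterman_rec n : Kn n.+3 = - kloosterman * Kn n.+2 - q%:R * Kn n.+1.
Proof.
have := lseries_recursion iota c chiD n.+3.
rewrite lseries_ge3 // mulr0 big_nat_recr //= big_nat_recr //= big_nat_recr //=.
rewrite big_nat_cond big1 ?add0r; last first.
  by move=> m; rewrite andbT => /andP[_ mn]; rewrite lseries_ge3 ?mulr0 // ltn_subRL addnC; lia.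
have -> : (n.+3 - n.+1 = 2)%N by lia.
have -> : (n.+3 - n.+2 = 1)%N by lia.
rewrite subnn lseries0 lseries1 lseries2 mulr1 => /esym/eqP; rewrite addrC addr_eq0 => /eqP ->.
by ring.
Qed.

Lemma lift_kloosterman_even n : Kn n.+1.+4 =
  (kloosterman ^+ 2 - 2%:R * q%:R) * Kn n.+3 - q%:R ^+ 2 * Kn n.+1.
Proof.
have h1 := lift_kloosterman_rec n; have h2 := lift_kloosterman_rec n.+1; have h3 := lift_kloosterman_rec n.+2.
by rewrite h3 h2 h1; ring.
Qed.

Lemma frob_trace_fixed m (z : L) : z ^+ (q ^ m) = z -> frob_trace F m z ^+ q = frob_trace F m z.
Proof.
move=> zm; apply/eqP; rewrite -subr_eq0.
have /= := frob_trace_as iota m z.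
rewrite zm subrr /frob_trace => h0.
rewrite -[X in _ == X]h0 -[X in _ ^+ X - _]expn1 (expf_card_sum iota) -sumrB.
apply/eqP; apply: eq_bigr => i _.
by rewrite (expf_cardB iota) expn1 -!exprM mulnC.
Qed.

Lemma lift_kloostermanE m : (0 < m)%N -> Kn m = \sum_(u : F) chi u * (trace_fibre_card iota c m u)%:R.
Proof.
move=> m0; transitivity (\sum_(x <- frob_fixed F L m | x != 0)
    chi (descend iota (frob_trace F m (kl_fun iota c x)))).
  rewrite /lift_kloosterman [RHS]big_mkcond big_seq [RHS]big_seq; apply: eq_bigr => x.
  by rewrite mem_frob_fixed // => /eqP xm; rewrite char_weight_normpolyF //; case: eqP.
transitivity (\sum_(u : F) \sum_(x <- frob_fixed F L m |
     (x != 0) && (frob_trace F m (kl_fun iota c x) == iota u)) chi u).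
  rewrite (exchange_big_dep (fun x => x != 0)) /=; last by move=> u x _ /andP[].
  rewrite big_seq_cond [RHS]big_seq_cond; apply: eq_bigr => x /andP[].
  rewrite mem_frob_fixed // => /eqP xm x0; rewrite (big_pred1 (descend iota (frob_trace F m (kl_fun iota c x)))) // => u.
  rewrite x0 /=; apply/eqP/eqP => [->|->]; first by rewrite descendK.
  by rewrite descend_fixed // frob_trace_fixed // kl_fun_exp xm.
apply: eq_bigr => u _; rewrite /trace_fibre_card size_filter -sum1_count natr_sum big_distrr /=.
by apply: eq_bigr => x _; rewrite mulr1.
Qed.

Lemma sum_trace_fibre_card m : (0 < m)%N -> (\sum_(u : F) trace_fibre_card iota c m u = (q ^ m).-1)%N.
Proof.
move=> m0; transitivity (\sum_(x <- frob_fixed F L m | (x != 0)%R) 1)%N.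
  transitivity (\sum_(u : F) \sum_(x <- frob_fixed F L m |
     (x != 0)%R && (frob_trace F m (kl_fun iota c x) == iota u)%R) 1)%N.
    by apply: eq_bigr => u _; rewrite sum1_count -size_filter.
  rewrite (exchange_big_dep (fun x => x != 0)) /=; last by move=> u x _ /andP[].
  rewrite big_seq_cond [RHS]big_seq_cond; apply: eq_bigr => x /andP[].
  rewrite mem_frob_fixed // => /eqP xm x0; rewrite (big_pred1 (descend iota (frob_trace F m (kl_fun iota c x)))) // => u.
  rewrite x0 /=; apply/eqP/eqP => [->|->]; first by rewrite descendK.
  by rewrite descend_fixed // frob_trace_fixed // kl_fun_exp xm.
rewrite sum1_count -size_filter -(@size_frob_fixed F L m m0).
have z : 0 \in frob_fixed F L m by rewrite mem_frob_fixed // expr0n -leqn0 leqNgt card_exp_gt0.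
by rewrite -(rem_filter _ (uniq_frob_fixed iota m0)) size_rem.
Qed.

(** By [trace_fibre_bound] every fibre of the trace has at most q^n / q + 12 q^(n/2)
    elements, for n = 2 nu.  The fibres have q^n - 1 elements altogether, so the
    upper bounds imply lower bounds, and K_n, the character sum over the fibre
    sizes, only sees the deviations from the mean. *)
Lemma lift_kloosterman_bound nu : (3 <= nu)%N -> `|Kn (nu + nu)| <= (25 * q * q ^ nu)%:R.
Proof.
move=> nu3; have n0 : (0 < nu + nu)%N by lia.
have q1 := finNzRing_gt1 F; have q0 := ltnW q1.
pose C : int := (q ^ (nu + nu).-1)%N; pose B : int := (12 * q ^ nu)%N.
have qC : Posz (q ^ nu * q ^ nu) = Posz q * C.
  by rewrite /C -expnD -{1}(prednK n0) expnS.
pose e u : int := (trace_fibre_card iota c (nu + nu) u)%:Z - C.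
have eB u : e u <= B.
  have := trace_fibre_bound iota F2 c0 u nu3; rewrite -lez_nat PoszD qC => h.
  have h2 : Posz q * e u <= Posz q * B.
    rewrite /e /B mulrBr lerBlDr addrC; move: h; rewrite !PoszM.
    by rewrite -!mulrA [_ * (q%:Z * _)]mulrCA.
  by rewrite ler_pM2l // in h2.
have -> : Kn (nu + nu) = \sum_u chi u * (e u)%:~R.
  rewrite lift_kloostermanE // (eq_bigr (fun u => chi u * (e u)%:~R + chi (1 * u) * C%:~R)).
    by rewrite big_split /= -mulr_suml (sum_char chiP) oner_eq0 mul0r addr0.
  by move=> u _; rewrite mul1r -mulrDr -intrD /e subrK.
apply: (le_trans (ler_norm_sum _ _ _)).
have h (u : F) : `|chi u * (e u)%:~R| <= (2 * B - e u)%:~R.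
  rewrite normrM (norm_char chiP) mul1r -intr_norm ler_int.
  have := eB u; have : 0 <= B by []. 
  lia.
apply: (le_trans (ler_sum _ (fun u _ => h u))).
rewrite -rmorph_sum /= sumrB sumr_const.
have -> : \sum_u e u = - 1.
  rewrite /e sumrB sumr_const -(big_morph Posz PoszD (erefl _)) sum_trace_fibre_card //.
  rewrite -mulr_natr mulrC -(_ : Posz q = q%:R) ?natz // -qC -expnD.
  by have := card_exp_gt0 F (nu + nu); lia.
rewrite [leRHS]pmulrn ler_int opprK (_ : #|xpredT| = q) // /B.
have := card_exp_gt0 F nu; set r := (q ^ nu)%N => r0.
have h3 : (0 < q * r)%N by rewrite muln_gt0 q0.
by rewrite -mulr_natr natz; lia.
Qed.
Lemma kloosterman_conj : kloosterman^* = kloosterman.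
Proof.
rewrite /kloosterman rmorph_sum [RHS](reindex_inj oppr_inj) /=.
apply: eq_big => t; first by rewrite oppr_eq0.
by rewrite (char_conj chiP) opprD invrN mulrN.
Qed.

(** Normalize the even terms to sigma_m = - K_(2m+2) / q^(m+1).  They satisfy
    sigma_(m+2) = tau sigma_(m+1) - sigma_m with tau = K^2 / q - 2.  If tau > 2, the
    increments never decrease, so sigma grows at least linearly, while
    [lift_kloosterman_bound] keeps it bounded. *)
Lemma kloosterman_sq_le_closure : kloosterman ^+ 2 <= 4%:R * q%:R.
Proof.
set K := kloosterman.
have Kr : K ^+ 2 \is Num.real by rewrite rpredX // CrealE kloosterman_conj.
have qr : 4%:R * q%:R \is @Num.real algC by rewrite -natrM realn.
have [//|Kbig] := real_leP Kr qr.
have q0 : 0 < q%:R :> algC by rewrite ltr0n (ltnW (finNzRing_gt1 F)).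
have qn0 : q%:R != 0 :> algC by rewrite gt_eqF.
pose tau := (K ^+ 2 - 2%:R * q%:R) / q%:R; pose delta := tau - 2%:R.
pose sigma m := - Kn (m + m).+2 / q%:R ^+ m.+1.
have d0 : 0 < delta.
  have -> : delta = (K ^+ 2 - 4%:R * q%:R) / q%:R by rewrite /delta /tau; field.
  by rewrite divr_gt0 // subr_gt0.
have s0 : sigma 0 = delta + 2%:R by rewrite /sigma /delta /tau lift_kloosterman2 -/K expr1; field.
have s1 : sigma 1 = (delta + 2%:R) ^+ 2 - 2%:R.
  rewrite /sigma (lift_kloosterman_rec 1) (lift_kloosterman_rec 0) lift_kloosterman1 lift_kloosterman2 -/K /delta /tau.
  by field.
have sS m : sigma m.+2 = (delta + 2%:R) * sigma m.+1 - sigma m.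
  rewrite /sigma !addSn !addnS (lift_kloosterman_even (m + m).+1) -/K /delta /tau !exprS.
  by field; rewrite qn0 expf_neq0.
have grow m : m.+1%:R * delta <= sigma m /\ delta <= sigma m.+1 - sigma m.
  elim: m => [|m [h1 h2]].
    rewrite mul1r s0 s1 lerDl ler0n; split=> //.
    have -> : (delta + 2%:R) ^+ 2 - 2%:R - (delta + 2%:R) = delta + (delta * delta + 2%:R * delta).
      by ring.
    by rewrite lerDl addr_ge0 // mulr_ge0 ?ler0n // ltW.
  have h3 : m.+2%:R * delta <= sigma m.+1.
    have := lerD h1 h2; rewrite [sigma m + _]addrC subrK.
    by rewrite -[in X in _ -> X]natr1 mulrDl mul1r.
  split=> //.
  have -> : sigma m.+2 - sigma m.+1 = delta * sigma m.+1 + (sigma m.+1 - sigma m).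
    by rewrite sS; ring.
  rewrite (le_trans h2) // lerDr mulr_ge0 ?(ltW d0) //.
  by apply: le_trans h3; rewrite mulr_ge0 ?ler0n // ltW.
have bnd m : (2 <= m)%N -> sigma m <= (25 * q)%:R.
  move=> m2; have := lift_kloosterman_bound (nu := m.+1) m2; rewrite addSn addnS => kb.
  have [h _] := grow m.
  have s_ge0 : 0 <= sigma m by apply: le_trans h; rewrite mulr_ge0 ?ler0n // ltW.
  rewrite -(ger0_norm s_ge0) /sigma normrM normrN normfV normrX normr_nat.
  by rewrite ler_pdivrMr ?exprn_gt0 // -natrX -natrM.
pose M := Num.bound ((25 * q)%:R / delta).
have hM : (25 * q)%:R / delta < M.+2%:R.
  apply: (lt_trans (archi_boundP _)); first by rewrite divr_ge0 ?ler0n // ltW.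
  by rewrite ltr_nat.
rewrite ltr_pdivrMr // in hM.
have [h _] := grow M.+2.
have := le_trans h (bnd M.+2 isT); rewrite lt_geF //.
by apply: (lt_trans hM); rewrite ltr_pM2r // ltr_nat.
Qed.
End KloostermanClosure.

Section Kloosterman.
Variables (F : finFieldType) (chi : F -> algC).
Hypothesis (F2 : 2 \notin [pchar F]) (chiP : is_add_char chi).

Lemma kloosterman_sq_le (c : F) : c != 0 ->
  (\sum_(t | t != 0) chi (t + c / t)) ^+ 2 <= 4%:R * #|F|%:R.
Proof.
move=> c0; have [L [iota _]] := countable_algebraic_closure F.
exact: (kloosterman_sq_le_closure iota F2 c0 chiP).
Qed.

Lemma norm_kloosterman_sq (a b : F) : a != 0 -> b != 0 ->
  `|\sum_(t | t != 0) chi (a * t + b / t)| ^+ 2 <= 4%:R * #|F|%:R.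
Proof.
move=> a0 b0.
rewrite (reindex_inj (mulfI (invr_neq0 a0))) /=.
rewrite (eq_bigr (fun t => chi (t + (a * b) / t))); last first.
  by move=> t _; rewrite mulVKf // invfM invrK mulrCA mulrA.
rewrite (eq_bigl (fun t => t != 0)); last first.
  by move=> t; rewrite mulf_eq0 invr_eq0 (negPf a0).
have := kloosterman_conj (a * b) chiP; rewrite /kloosterman => kc.
by rewrite normCK kc -expr2 kloosterman_sq_le // mulf_neq0.
Qed.

End Kloosterman.

(** * Squares in a finite field *)

Section Squares.
Variable F : finFieldType.
Hypothesis F2 : 2 \notin [pchar F].
Local Notation q := #|F|.

Lemma opp_neq (y : F) : y != 0 -> y != - y.
Proof.
move=> y0; rewrite -addr_eq0 -mulr2n -mulr_natr mulf_neq0 //.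
Qed.

Lemma card_sqr (y0 : F) : y0 != 0 -> #|[set y | y ^+ 2 == y0 ^+ 2]| = 2%N.
Proof.
move=> y0n; rewrite (_ : [set y | _] = [set y0; - y0]) ?cards2 ?opp_neq //.
by apply/setP => y; rewrite !inE eqf_sqr.
Qed.

Lemma card_squares : (2 * #|[set y ^+ 2 | y in [set y : F | y != 0%R]]| = q.-1)%N.
Proof.
set A := imset _ _.
rewrite -(cardC1 (0 : F)) -[RHS]sum1_card.
rewrite [RHS](partition_big (fun y : F => y ^+ 2) (mem A)) /=; last first.
  by move=> y y0; apply: imset_f; rewrite inE.
rewrite mulnC -sum_nat_const; apply: eq_bigr => x /imsetP [y0]; rewrite inE => y0n ->.
rewrite -[LHS](card_sqr y0n) -[LHS]sum1dep_card; apply: eq_bigl => y.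
rewrite inE andbC; case: eqP => // e; symmetry.
by have := congr1 (fun x => x == 0) e; rewrite /= !expf_eq0 /= => ->.
Qed.

(** There are (q - 1) / 2 nonzero squares, since squaring is two to one, so the
    squares and their multiples by a nonsquare eps exhaust the nonzero elements. *)
Lemma square_classes : exists eps : F, [/\ eps != 0, forall y, y ^+ 2 != eps &
  forall x, x != 0 -> (exists y, x = y ^+ 2) \/ (exists y, x = eps * y ^+ 2)].
Proof.
pose A := [set y ^+ 2 | y in [set y : F | y != 0]].
have cA : (2 * #|A| = q.-1)%N := card_squares.
have A0 x : x \in A -> x != 0 by case/imsetP => y; rewrite inE => y0 ->; rewrite expf_neq0.
have q1 := finNzRing_gt1 F.
have [eps e0 eA] : exists2 eps : F, eps != 0 & eps \notin A.
  have /subsetPn [y] : ~~ ([set y : F | y != 0] \subset A).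
    have : (#|A| < #|[set y : F | (y != 0)%R]|)%N.
      rewrite cardsE cardC1 -cA -[ltnLHS]mul1n ltn_pmul2r //; apply/card_gt0P.
      by exists 1; apply/imsetP; exists 1; rewrite ?inE ?oner_eq0 ?expr1n.
    by rewrite ltnNge; apply: contra => /subset_leq_card.
  by rewrite inE; exists y.
have eps_ns y : y ^+ 2 != eps.
  apply: contraNneq eA => ye; apply/imsetP; exists y => //; rewrite inE.
  by apply: contraNneq e0 => y0; rewrite -ye y0 expr0n.
exists eps; split=> // x x0.
pose B := [set eps * x | x in A].
have dAB : [disjoint A & B].
  apply/pred0P => z /=; apply/negP => /andP[/imsetP [y _ ->] /imsetP [w wA]].
  case/imsetP: (wA) => v; rewrite inE => v0 -> e.
  have := eps_ns (y / v); rewrite exprMn exprVn e mulfK ?eqxx //.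
  by rewrite expf_neq0.
have AB : A :|: B = [set y | y != 0].
  apply/eqP; rewrite eqEcard; apply/andP; split.
    apply/subsetP => z; rewrite !inE => /orP[/A0 //|/imsetP [w /A0 w0 ->]].
    by rewrite mulf_neq0.
  rewrite cardsE cardC1 -cA cardsU (disjoint_setI0 dAB) cards0 subn0.
  by rewrite [X in (_ <= _ + X)%N]card_imset ?mul2n ?addnn //; apply: mulfI.
have : x \in A :|: B by rewrite AB inE.
rewrite inE => /orP[/imsetP [y _ ->]|/imsetP [w /imsetP [y _ ->] ->]].
  by left; exists y.
by right; exists y.
Qed.

End Squares.

(** * Quadratic Gauss sums and Salie sums *)

Section Gauss.
Variables (F : finFieldType) (chi : F -> algC).
Hypothesis (F2 : 2 \notin [pchar F]) (chiP : is_add_char chi).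
Local Notation q := #|F|.
Let chiD := charD chiP.
Let two0 : 2%:R != 0 :> F := nat2_neq0 F2.

Definition gauss_sum t : algC := \sum_y chi (t * y ^+ 2).

Lemma gauss_sqr t u : u != 0 -> gauss_sum (t * u ^+ 2) = gauss_sum t.
Proof.
move=> u0; rewrite /gauss_sum [RHS](reindex_inj (mulfI u0)) /=.
by apply: eq_bigr => y _; congr chi; ring.
Qed.

(** Expand the square and substitute y + h for one of the variables: the sum
    over y kills all h <> 0. *)
Lemma norm_gauss t : t != 0 -> `|gauss_sum t| ^+ 2 = q%:R.
Proof.
move=> t0; rewrite normCK mulrC /gauss_sum rmorph_sum mulr_suml.
transitivity (\sum_h \sum_y chi (t * h ^+ 2) * chi ((2%:R * t * h) * y)).
  rewrite [RHS]exchange_big /=; apply: eq_bigr => y _.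
  rewrite mulr_sumr (reindex_inj (addrI y)) /=.
  apply: eq_bigr => h _; rewrite (char_conj chiP) -!chiD; congr chi; ring.
rewrite (bigD1 0) //= [X in _ + X]big1 ?addr0.
  rewrite (eq_bigr (fun=> 1)) ?sumr_const // => y _.
  by rewrite expr0n /= !mulr0 mul0r (char0 chiP) mulr1.
move=> h h0; rewrite -mulr_sumr (sum_char chiP) (negPf (mulf_neq0 _ h0)) ?mulr0 //.
exact: mulf_neq0.
Qed.

Lemma gauss_neq0 t : t != 0 -> gauss_sum t != 0.
Proof.
move=> t0; apply/eqP => g0; have := norm_gauss t0.
rewrite g0 normr0 expr0n /= => /esym/eqP.
by rewrite pnatr_eq0 -leqn0 leqNgt (ltnW (finNzRing_gt1 F)).
Qed.

(** Every x is hit twice in total by y^2 and eps y^2, so that the two Gauss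
    sums add up to a full character sum. *)
Lemma gauss_nonsq eps t : eps != 0 -> (forall y, y ^+ 2 != eps) -> t != 0 ->
  (forall x, x != 0 -> (exists y, x = y ^+ 2) \/ (exists y, x = eps * y ^+ 2)) ->
  gauss_sum (eps * t) = - gauss_sum t.
Proof.
move=> e0 ens t0 dich; apply/eqP; rewrite -addr_eq0 addrC.
pose N x := #|[set y : F | y ^+ 2 == x]|.
have gE s : gauss_sum s = \sum_x (N x)%:R * chi (s * x).
  rewrite /gauss_sum (partition_big (fun y : F => y ^+ 2) xpredT) //=.
  apply: eq_bigr => x _; rewrite /N -sum1dep_card natr_sum mulr_suml.
  by apply: eq_bigr => y /eqP ->; rewrite mul1r.
have gE' : gauss_sum (eps * t) = \sum_x (N (x / eps))%:R * chi (t * x).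
  rewrite gE [RHS](reindex_inj (mulfI e0)) /=; apply: eq_bigr => x _.
  by rewrite (mulrC eps x) mulfK //; congr (_ * chi _); ring.
rewrite gE gE' -big_split /= (eq_bigr (fun x => 2%:R * chi (t * x))).
  by rewrite -mulr_sumr (sum_char chiP) (negPf t0) mulr0.
move=> x _; rewrite -mulrDl -natrD; congr (_%:R * _).
have N0 : N 0 = 1%N.
  rewrite /N (_ : [set y | _] = [set 0]) ?cards1 //.
  by apply/setP => y; rewrite !inE expf_eq0.
have [->|x0] := eqVneq x 0; first by rewrite mul0r N0.
have Nns z : (forall y, y ^+ 2 != z) -> N z = 0%N.
  by move=> h; apply: eq_card0 => y; rewrite inE (negPf (h y)).
have [[y ex]|[y ex]] := dich x x0.
  have y0 : y != 0 by apply: contraNneq x0 => y0; rewrite ex y0 expr0n.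
  have -> : N x = 2%N by rewrite /N ex card_sqr.
  suff -> : N (x / eps) = 0%N by [].
  apply: Nns => z; apply: contra (ens (y / z)) => /eqP ez.
  rewrite exprMn exprVn ez ex invfM invrK mulrA divff ?mul1r //.
  by rewrite expf_neq0.
have y0 : y != 0 by apply: contraNneq x0 => y0; rewrite ex y0 expr0n mulr0.
have -> : N (x / eps) = 2%N by rewrite /N ex mulrC mulKf // card_sqr.
suff -> : N x = 0%N by [].
apply: Nns => z; apply: contra (ens (z / y)) => /eqP ez.
by rewrite exprMn exprVn ez ex mulfK // expf_neq0.
Qed.

(** The factor G(t) chi(- (l t + e)^2 / t) is the sum over y of
    chi(t y^2 + 2 (l t + e) y), by completing the square.  Summing this over
    t first leaves only the two solutions of y^2 + 2 l y = 0; the missing term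
    t = 0 would contribute a full character sum, which vanishes. *)
Lemma salie_square (l e : F) : l != 0 -> e != 0 ->
  `|\sum_(t | t != 0) gauss_sum t * chi (- (l ^+ 2 * t) - e ^+ 2 / t)| <= 2%:R * q%:R.
Proof.
move=> l0 e0.
have E : chi (- (2%:R * l * e)) * (\sum_(t | t != 0) gauss_sum t * chi (- (l ^+ 2 * t) - e ^+ 2 / t))
  = q%:R * (1 + chi (- (2%:R * 2%:R * l * e))).
  transitivity (\sum_(t | t != 0) \sum_y chi (2%:R * e * y) * chi ((y ^+ 2 + 2%:R * l * y) * t)).
    rewrite mulr_sumr; apply: eq_bigr => t t0.
    rewrite mulrCA -chiD /gauss_sum mulr_suml (reindex_inj (addrI (l + e / t))) /=.
    by apply: eq_bigr => y _; rewrite -!chiD; congr chi; field.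
  rewrite exchange_big /=.
  transitivity (\sum_y (chi (2%:R * e * y) * (if y ^+ 2 + 2%:R * l * y == 0 then q%:R else 0)
                 - chi (2%:R * e * y))).
    apply: eq_bigr => y _; rewrite -mulr_sumr -(sum_char chiP) -[X in _ - X]mulr1 -mulrBr.
    by rewrite [in RHS](bigD1 0) //= mulr0 (char0 chiP) [1 + _]addrC addrK.
  rewrite sumrB (sum_char chiP) (negPf (mulf_neq0 two0 e0)) subr0.
  have l20 : - (2%:R * l) != 0 by rewrite oppr_eq0 mulf_neq0.
  rewrite (bigD1 0) //= (bigD1 (- (2%:R * l))) //= big1 ?addr0.
    rewrite !mulr0 (char0 chiP) expr0n addr0 eqxx mul1r mulrN mulrN sqrrN.
    rewrite -expr2 subrr eqxx mulrDr mulr1 [q%:R * _]mulrC; congr (_ + chi _ * _).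
    by ring.
  move=> y /andP[y0 yl]; rewrite expr2 -mulrDl mulf_eq0 (negPf y0) orbF addr_eq0.
  by rewrite (negPf yl) mulr0.
have -> : `|\sum_(t | t != 0) gauss_sum t * chi (- (l ^+ 2 * t) - e ^+ 2 / t)| =
   `|q%:R * (1 + chi (- (2%:R * 2%:R * l * e)))|.
  by rewrite -E normrM (norm_char chiP) mul1r.
rewrite normrM normr_nat mulrC ler_wpM2r ?ler0n //.
by rewrite (le_trans (ler_normD _ _)) // normr1 (norm_char chiP).
Qed.

End Gauss.

(** * Twists by functions of the square class *)

Section Twisted.
Variables (F : finFieldType) (chi : F -> algC).
Hypothesis (F2 : 2 \notin [pchar F]) (chiP : is_add_char chi).
Local Notation q := #|F|.
Local Notation gauss := (gauss_sum chi).
Let chiD := charD chiP.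
Let two0 : 2%:R != 0 :> F := nat2_neq0 F2.
Local Notation s := (sqrtC (q%:R : algC)).

Lemma sqrt_q2 : s ^+ 2 = q%:R. Proof. exact: sqrtCK. Qed.
Lemma sqrt_q_gt0 : 0 < s.
Proof. by rewrite sqrtC_gt0 ltr0n (ltnW (finNzRing_gt1 F)). Qed.
Lemma sqrt_q_ge1 : 1 <= s.
Proof.
rewrite -(@ler_pXn2r _ 2) ?nnegrE ?ler01 ?(ltW sqrt_q_gt0) //.
by rewrite sqrt_q2 expr1n ler1n (ltnW (finNzRing_gt1 F)).
Qed.

Lemma norm_gauss_sqrt t : t != 0 -> `|gauss t| = s.
Proof. by move=> t0; rewrite -(norm_gauss F2 chiP t0) sqrCK. Qed.

Lemma norm_kloosterman_le (a b : F) : a != 0 ->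
  `|\sum_(t | t != 0) chi (a * t + b / t)| <= 2%:R * s.
Proof.
move=> a0; have s0 := sqrt_q_gt0.
have [->|b0] := eqVneq b 0.
  have := sum_char chiP a; rewrite (negPf a0) (bigD1 0) //= mulr0 (char0 chiP).
  move/eqP; rewrite addrC addr_eq0 => /eqP e.
  rewrite (eq_bigr (fun t => chi (a * t))); last by move=> t _; rewrite mul0r addr0.
  rewrite e normrN normr1 (le_trans sqrt_q_ge1) // ler_peMl ?ler1n // ltW //.
rewrite -(@ler_pXn2r _ 2) ?nnegrE ?mulr_ge0 ?ler0n ?(ltW s0) //.
rewrite exprMn sqrt_q2 -natrX; exact: norm_kloosterman_sq.
Qed.

(** For b = 0 the sum counts the square roots of - a.  Otherwise rescale t so
    that a = -1, at the cost of a sign.  If a b is a square this is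
    [salie_square]; if not, t |-> a b / t preserves the character and changes
    the sign of the Gauss sum, so the sum is zero. *)
Lemma norm_salie (a b : F) : a != 0 ->
  `|\sum_(t | t != 0) gauss t * chi (a * t + b / t)| <= 2%:R * q%:R.
Proof.
move=> a0; have [eps [e0 ens dich]] := square_classes F2.
have [->|b0] := eqVneq b 0.
  have E : \sum_(t | t != 0) gauss t * chi (a * t + 0 / t) =
           q%:R * #|[set y : F | y ^+ 2 == - a]|%:R - q%:R.
    transitivity (\sum_t gauss t * chi (a * t) - q%:R).
      rewrite [in RHS](bigD1 0) //= mulr0 (char0 chiP) mulr1.
      have -> : gauss 0 = q%:R.
        rewrite /gauss_sum (eq_bigr (fun=> 1)) ?sumr_const // => y _.
        by rewrite mul0r (char0 chiP).
      by rewrite [q%:R + _]addrC addrK; apply: eq_bigr => t _; rewrite mul0r addr0.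
    congr (_ - _); transitivity (\sum_y \sum_t chi ((y ^+ 2 + a) * t)).
      rewrite exchange_big /=; apply: eq_bigr => t _; rewrite /gauss_sum mulr_suml.
      by apply: eq_bigr => y _; rewrite -chiD; congr chi; ring.
    rewrite -sum1dep_card natr_sum mulr_sumr [RHS]big_mkcond; apply: eq_bigr => y _.
    by rewrite (sum_char chiP) addr_eq0 mulr1.
  rewrite E.
  have [/existsP [y /eqP ya]|] := boolP [exists y : F, y ^+ 2 == - a].
    rewrite -ya card_sqr //; last first.
      by apply: contraNneq a0 => y0; rewrite -oppr_eq0 -ya y0 expr0n.
    by rewrite mulr_natr mulr2n addrK normr_nat ler_peMl ?ler0n ?ler1n.
  rewrite negb_exists => /forallP h.
  rewrite eq_card0 => [|y]; last by rewrite inE (negPf (h y)).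
  by rewrite mulr0 sub0r normrN normr_nat ler_peMl ?ler0n ?ler1n.
have ab0 : a * b != 0 by rewrite mulf_neq0.
pose k := - a^-1; have k0 : k != 0 by rewrite oppr_eq0 invr_eq0.
pose S := \sum_(t | t != 0) gauss t * chi (- t - a * b / t).
have -> : `|\sum_(t | t != 0) gauss t * chi (a * t + b / t)| = `|S|.
  have hk : exists2 z : algC, `|z| = 1 & forall t, t != 0 -> gauss (k * t) = z * gauss t.
    have [[y ky]|[y ky]] := dich k k0; have y0 : y != 0.
    - by apply: contraNneq k0 => y0; rewrite ky y0 expr0n.
    - exists 1; rewrite ?normr1 // => t t0.
      by rewrite mul1r ky mulrC gauss_sqr.
    - by apply: contraNneq k0 => y0; rewrite ky y0 expr0n mulr0.
    exists (-1); rewrite ?normrN1 // => t t0.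
    by rewrite ky mulrAC gauss_sqr // mulN1r (gauss_nonsq F2 chiP e0 ens).
  have [z z1 hz] := hk.
  rewrite (reindex_inj (mulfI k0)) /= (eq_bigl (fun t => t != 0)); last first.
    by move=> t; rewrite mulf_eq0 (negPf k0).
  rewrite (eq_bigr (fun t => z * (gauss t * chi (- t - a * b / t)))).
    by rewrite -mulr_sumr normrM z1 mul1r.
  move=> t t0; rewrite hz // -mulrA; congr (_ * (_ * chi _)).
  by rewrite /k; field; rewrite t0 a0 oppr_eq0 oner_neq0.
have [[e abe]|[e abe]] := dich _ ab0.
  have en0 : e != 0 by apply: contraNneq ab0 => e0'; rewrite abe e0' expr0n.
  have := salie_square F2 chiP (oner_neq0 F) en0; rewrite /S abe.
  by rewrite (eq_bigr (fun t => gauss t * chi (- t - e ^+ 2 / t))) // => t _; rewrite expr1n mul1r.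
have S0 : S = - S.
  rewrite {1}/S (reindex_inj (h := fun t => a * b / t)) /=; last first.
    by move=> t u /(mulfI ab0) /invr_inj.
  rewrite (eq_bigl (fun t => t != 0)); last by move=> t; rewrite mulf_eq0 (negPf ab0) invr_eq0.
  rewrite /S -sumrN; apply: eq_bigr => t t0.
  have en0 : e != 0 by apply: contraNneq ab0 => e0'; rewrite abe e0' expr0n mulr0.
  rewrite -[RHS]mulNr -(gauss_nonsq F2 chiP e0 ens) //; congr (_ * chi _).
    rewrite -(gauss_sqr chi (eps * t) (u := e / t)) ?mulf_neq0 ?invr_eq0 // abe.
    by congr gauss_sum; field.
  by rewrite addrC; field; rewrite t0 b0 a0.
have : S = 0.
  apply/eqP; move/eqP: S0; rewrite -addr_eq0 -mulr2n -mulr_natr mulf_eq0 pnatr_eq0.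
  by rewrite orbF.
by move=> ->; rewrite normr0 mulr_ge0 ?ler0n.
Qed.

(** A function of the square class is a combination of 1 and of the quadratic
    character, that is, of 1 and of the Gauss sum G(t). *)
Lemma norm_twisted (H : F -> algC) B (a b : F) : a != 0 ->
  (forall t u, t != 0 -> u != 0 -> H (t * u ^+ 2) = H t) ->
  (forall t, t != 0 -> `|H t| <= B) ->
  `|\sum_(t | t != 0) H t * chi (a * t + b / t)| <= 4%:R * B * s.
Proof.
move=> a0 Hsq HB; have [eps [e0 ens dich]] := square_classes F2.
have s0 := sqrt_q_gt0.
have B0 : 0 <= B by apply: le_trans (HB 1 (oner_neq0 _)); apply: normr_ge0.
have g0 : gauss 1 != 0 by apply: (gauss_neq0 F2 chiP); apply: oner_neq0.
pose A1 := (H 1 + H eps) / 2%:R; pose A2 := (H 1 - H eps) / (2%:R * gauss 1).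
have HE t : t != 0 -> H t = A1 + A2 * gauss t.
  move=> t0; have [[y ty]|[y ty]] := dich t t0; have y0 : y != 0.
  - by apply: contraNneq t0 => y0; rewrite ty y0 expr0n.
  - rewrite ty -[y ^+ 2]mul1r Hsq ?oner_neq0 // gauss_sqr // /A1 /A2.
    by field.
  - by apply: contraNneq t0 => y0; rewrite ty y0 expr0n mulr0.
  rewrite ty Hsq // gauss_sqr // -[eps]mulr1 (gauss_nonsq F2 chiP e0 ens) ?oner_neq0 //.
  by rewrite mulr1 /A1 /A2; field.
rewrite (eq_bigr (fun t => A1 * chi (a * t + b / t) + A2 * (gauss t * chi (a * t + b / t)))); last first.
  by move=> t t0; rewrite HE // mulrDl mulrA.
rewrite big_split /= -!mulr_sumr (le_trans (ler_normD _ _)) //.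
have two_gt0 : 0 < 2%:R :> algC by rewrite ltr0n.
have hA1 : `|A1| <= B.
  rewrite /A1 normrM normfV normr_nat ler_pdivrMr // (le_trans (ler_normD _ _)) //.
  by rewrite mulr_natr mulr2n lerD ?HB ?oner_neq0.
have hA2 : `|A2| <= B / s.
  rewrite /A2 normrM normfV normrM normr_nat (norm_gauss_sqrt (oner_neq0 _)).
  rewrite invfM mulrA ler_wpM2r ?invr_ge0 ?(ltW s0) //.
  rewrite ler_pdivrMr // (le_trans (ler_normB _ _)) //.
  by rewrite mulr_natr mulr2n lerD ?HB ?oner_neq0.
have -> : 4%:R * B * s = B * (2%:R * s) + (B / s) * (2%:R * q%:R).
  have fz (z : algC) : z != 0 -> 4%:R * B * z = B * (2%:R * z) + (B / z) * (2%:R * z ^+ 2).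
    by move=> z0; field.
  by rewrite (fz s) ?sqrt_q2 // gt_eqF.
by apply: lerD; rewrite normrM; apply: ler_pM => //; [exact: norm_kloosterman_le|exact: norm_salie].
Qed.

End Twisted.

(** * Gauss sums of quadratic forms *)

Section MatrixGauss.
Variables (F : finFieldType) (chi : F -> algC).
Hypothesis (F2 : 2 \notin [pchar F]) (chiP : is_add_char chi).
Local Notation q := #|F|.
Local Notation s := (sqrtC (q%:R : algC)).
Let chiD := charD chiP.
Let two0 : 2%:R != 0 :> F := nat2_neq0 F2.

(** The dot product of two rows v and w is the entry of the 1 x 1 matrix v w^T. *)
Definition ent (A : 'M[F]_1) : F := A 0 0.
Lemma entD A B : ent (A + B) = ent A + ent B. Proof. by rewrite /ent mxE. Qed.
Lemma entN A : ent (- A) = - ent A. Proof. by rewrite /ent mxE. Qed.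
Lemma entZ a A : ent (a *: A) = a * ent A. Proof. by rewrite /ent mxE. Qed.
Lemma ent0 : ent 0 = 0. Proof. by rewrite /ent mxE. Qed.
Lemma ent_tr A : ent A^T = ent A. Proof. by rewrite /ent mxE. Qed.
Lemma ent_eq0 A : (ent A == 0) = (A == 0).
Proof.
apply/eqP/eqP => [h|->]; last exact: ent0.
by apply/matrixP => i j; rewrite !ord1 mxE.
Qed.

Lemma sum_char_vec n (v : 'cV[F]_n) :
  \sum_(w : 'rV_n) chi (ent (w *m v)) = if v == 0 then (q ^ n)%:R else 0.
Proof.
have [->|v0] := eqVneq v 0.
  rewrite (eq_bigr (fun=> 1)); first by rewrite sumr_const card_mx mul1n.
  by move=> w _; rewrite mulmx0 ent0 (char0 chiP).
have [j vj] : exists j, v j 0 != 0.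
  apply/existsP; apply: contraNT v0 => /existsPn h; apply/eqP/matrixP => i j.
  by rewrite ord1 mxE; apply/eqP; have := h i; rewrite negbK.
have [b hb] := char_nontriv chiP.
pose w0 : 'rV[F]_n := (b / v j 0) *: delta_mx 0 j.
have w0v : ent (w0 *m v) = b.
  by rewrite -scalemxAl entZ -rowE /ent mxE divfK.
set S := \sum_w _; have e : S = chi b * S.
  rewrite {1}/S (reindex_inj (addrI w0)) /= /S mulr_sumr; apply: eq_bigr => w _.
  by rewrite mulmxDl entD chiD w0v.
apply/eqP; move/eqP: e; rewrite -subr_eq0 -{1}[S]mul1r -mulrBl mulf_eq0.
by rewrite subr_eq0 eq_sym (negPf hb).
Qed.

Section Form.
Variables (m : nat) (M : 'M[F]_m).
Hypothesis symM : M^T = M.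

(** The Gauss sum of the quadratic form t v M v^T with a linear term v l. *)
Definition mgauss t (l : 'cV[F]_m) : algC :=
  \sum_(v : 'rV[F]_m) chi (t * ent (v *m M *m v^T) + ent (v *m l)).

Lemma formD (v w : 'rV[F]_m) : ent ((v + w) *m M *m (v + w)^T) =
  ent (v *m M *m v^T) + ent (w *m M *m w^T) + 2%:R * ent (v *m M *m w^T).
Proof.
rewrite linearD /= !(mulmxDl, mulmxDr) !entD.
have -> : ent (w *m M *m v^T) = ent (v *m M *m w^T).
  by rewrite -ent_tr !trmx_mul trmxK symM mulmxA.
by ring.
Qed.

Lemma mgauss_sqr t u : u != 0 -> mgauss (t * u ^+ 2) 0 = mgauss t 0.
Proof.
move=> u0; rewrite /mgauss [RHS](reindex_inj (h := fun v => u *: v)) /=.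
  apply: eq_bigr => v _; rewrite !mulmx0 linearZ /= -!scalemxAl -scalemxAr !entZ.
  by congr chi; ring.
by move=> v w /(congr1 (fun x => u^-1 *: x)); rewrite !scalerA mulVf // !scale1r.
Qed.

(** When the linear term is M u, completing the square removes it. *)
Lemma mgauss_im t (u : 'cV[F]_m) : t != 0 -> 
  mgauss t (M *m u) = chi (- (ent (u^T *m M *m u) / (4%:R * t))) * mgauss t 0.
Proof.
move=> t0; rewrite /mgauss (reindex_inj (addIr (- (2%:R * t)^-1 *: u^T))) /=.
rewrite mulr_sumr; apply: eq_bigr => v _; rewrite -chiD mulmx0 ent0 addr0; congr chi.
rewrite formD mulmxDl entD linearZ /= trmxK -!scalemxAl -!scalemxAr !entZ !mulmxA.
have f4 : 4%:R = 2%:R * 2%:R :> F by rewrite -natrM.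
by field; rewrite t0 f4 mulf_neq0 // two0.
Qed.

(** When the linear term does not vanish on the kernel of M, translating along
    the kernel multiplies the sum by a value of chi different from 1. *)
Lemma mgauss_ker t (l : 'cV[F]_m) (h : 'rV[F]_m) :
  h *m M = 0 -> ent (h *m l) != 0 -> mgauss t l = 0.
Proof.
move=> hM hl; have [b hb] := char_nontriv chiP.
pose w0 := (b / ent (h *m l)) *: h.
have w0v : ent (w0 *m l) = b by rewrite -scalemxAl entZ divfK.
have e : mgauss t l = chi b * mgauss t l.
  rewrite {1}/mgauss (reindex_inj (addIr w0)) /= /mgauss mulr_sumr.
  apply: eq_bigr => v _; rewrite -chiD; congr chi.
  rewrite formD mulmxDl entD w0v /w0 -scalemxAl hM scaler0 mul0mx ent0 linearZ /=.
  have MhT : M *m h^T = 0 by rewrite -[LHS]trmxK trmx_mul trmxK symM hM trmx0.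
  rewrite -scalemxAr -(mulmxA v M h^T) MhT.
  by rewrite mulmx0 scaler0 ent0; ring.
apply/eqP; move/eqP: e; rewrite -subr_eq0 -{1}[mgauss t l]mul1r -mulrBl mulf_eq0.
by rewrite subr_eq0 eq_sym (negPf hb).
Qed.

(** Expand the square and substitute v + h: the sum over v vanishes unless h is
    in the kernel of M. *)
Lemma mgauss_norm t l : t != 0 ->
  `|mgauss t l| ^+ 2 = (q ^ m)%:R * \sum_(h : 'rV[F]_m | h *m M == 0) chi (ent (h *m l)).
Proof.
move=> t0; rewrite normCK mulrC /mgauss rmorph_sum mulr_suml.
transitivity (\sum_h \sum_(v : 'rV_m) chi (t * ent (h *m M *m h^T) + ent (h *m l)) *
   chi (ent (v *m ((2%:R * t) *: (M *m h^T))))).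
  rewrite [RHS]exchange_big /=; apply: eq_bigr => v _.
  rewrite mulr_sumr (reindex_inj (addrI v)) /=.
  apply: eq_bigr => h _; rewrite (char_conj chiP) -!chiD; congr chi.
  by rewrite formD mulmxDl entD -scalemxAr entZ !mulmxA; ring.
rewrite mulr_sumr [RHS]big_mkcond; apply: eq_bigr => h _.
rewrite -mulr_sumr sum_char_vec scaler_eq0 (negPf (mulf_neq0 two0 t0)) /=.
have -> : (M *m h^T == 0) = (h *m M == 0).
  by rewrite -{1}symM -trmx_mul -[RHS](inj_eq trmx_inj) trmx0.
case: eqP => [hM|_]; last by rewrite mulr0.
by rewrite hM mul0mx ent0 mulr0 add0r mulrC.
Qed.

Lemma card_ker : #|[set h : 'rV[F]_m | h *m M == 0]| = (q ^ (m - \rank M))%N.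
Proof.
rewrite -(mxrank_ker M) -card_rowg; apply: eq_card => h.
by rewrite inE mem_rowg sub_kermx.
Qed.

Lemma mgauss_le t l : t != 0 -> `|mgauss t l| <= s ^+ (2 * m - \rank M).
Proof.
move=> t0; have s0 := sqrt_q_gt0 F; have rM := rank_leq_row M.
rewrite -(@ler_pXn2r _ 2) ?nnegrE ?exprn_ge0 ?(ltW s0) //.
rewrite (mgauss_norm _ t0) -exprM mulnC exprM sqrt_q2 -natrX.
have -> : (2 * m - \rank M = m + (m - \rank M))%N by lia.
rewrite expnD natrM ler_wpM2l ?ler0n // -card_ker -sum1dep_card natr_sum.
have h0 : 0 <= \sum_(h : 'rV[F]_m | h *m M == 0) chi (ent (h *m l)).
  have := exprn_ge0 2 (normr_ge0 (mgauss t l)); rewrite (mgauss_norm _ t0).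
  by rewrite pmulr_rge0 // ltr0n expn_gt0 (ltnW (finNzRing_gt1 F)).
rewrite -(ger0_norm h0) (le_trans (ler_norm_sum _ _ _)) //.
by apply: ler_sum => h _; rewrite (norm_char chiP).
Qed.

(** For symmetric M the image is the orthogonal complement of the kernel.  So
    either [mgauss_im] or [mgauss_ker] applies to any linear term. *)
Lemma im_or_ker (v : 'cV[F]_m) : (exists u, v = M *m u) \/
  (exists2 h : 'rV[F]_m, h *m M = 0 & ent (h *m v) != 0).
Proof.
have [/submxP [D vD]|] := boolP (v^T <= M)%MS.
  by left; exists D^T; rewrite -[v]trmxK vD trmx_mul symM.
rewrite submxE => nz; right.
have [j hj] : exists j, (v^T *m cokermx M) 0 j != 0.
  apply/existsP; apply: contraNT nz => /existsPn h; apply/eqP/matrixP => i j.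
  by rewrite ord1 [RHS]mxE; apply/eqP; have := h j; rewrite negbK.
exists (col j (cokermx M))^T.
  by apply: trmx_inj; rewrite trmx_mul trmxK symM trmx0 colE mulmxA mulmx_coker mul0mx.
by rewrite -ent_tr trmx_mul trmxK colE mulmxA -colE /ent mxE.
Qed.

End Form.

End MatrixGauss.

(** * The Fourier transform of a sphere *)

Lemma rank_corner (F : finFieldType) m (A : 'M[F]_(1 + m)) :
  (\rank A <= \rank (drsubmx A) + 2)%N.
Proof.
rewrite -{1}[A]submxK -[block_mx _ _ _ _]/(col_mx (row_mx _ _) (row_mx _ _)).
rewrite -addsmxE (leq_trans (mxrank_adds_leqif _ _)) //.
have h1 := rank_leq_row (row_mx (ulsubmx A) (ursubmx A)).
have h2 : (\rank (row_mx (dlsubmx A) (drsubmx A)) <= 1 + \rank (drsubmx A))%N.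
  rewrite -mxrank_tr tr_row_mx -addsmxE (leq_trans (mxrank_adds_leqif _ _)) //.
  by rewrite !mxrank_tr leq_add2r rank_leq_col.
by rewrite (leq_trans (leq_add h1 h2)) // addnA addnC.
Qed.

Section Sphere.
Variables (F : finFieldType) (chi : F -> algC).
Hypothesis (F2 : 2 \notin [pchar F]) (chiP : is_add_char chi).
Local Notation q := #|F|.
Local Notation s := (sqrtC (q%:R : algC)).
Let chiD := charD chiP.
Let two0 : 2%:R != 0 :> F := nat2_neq0 F2.
Let f4 : 4%:R = 2%:R * 2%:R :> F. Proof. by rewrite -natrM. Qed.

Variables (m d : nat) (X : 'M[F]_(m, d)) (b : 'cV[F]_m) (c : F).
Hypothesis freeX : row_free X.
Local Notation G := (X *m X^T).

Lemma gram_sym : G^T = G. Proof. by rewrite trmx_mul trmxK. Qed.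

(** The Gram matrix that the rows of X and a vector w on the sphere would
    have, w being placed first. *)
Definition gram_ext : 'M[F]_(1 + m) := block_mx c%:M b^T b G.
Local Notation rho := (\rank gram_ext).

Lemma rank_gram_ext : (rho <= \rank G + 2)%N.
Proof. by have := rank_corner gram_ext; rewrite block_mxKdr. Qed.

(** For b = G z the matrix is congruent to the block diagonal matrix of
    c - z^T G z and G. *)
Lemma rank_gram_ext_im z : b = G *m z ->
  (rho <= (c != ent (z^T *m G *m z)) + \rank G)%N.
Proof.
move=> bz; set g := c - ent (z^T *m G *m z).
pose T : 'M[F]_(1 + m) := block_mx 1%:M z^T 0 1%:M.
have e : gram_ext = T *m block_mx g%:M 0 0 G *m T^T.
  rewrite /T tr_block_mx !trmx1 trmx0 trmxK !mulmx_block.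
  rewrite !(mul1mx, mulmx1, mul0mx, mulmx0, addr0, add0r) /gram_ext bz.
  congr block_mx; last by rewrite trmx_mul gram_sym.
  by rewrite [X in _ = _ + X]mx11_scalar -raddfD /= /g subrK.
rewrite e (leq_trans (mxrankM_maxl _ _)) // (leq_trans (mxrankM_maxr _ _)) //.
rewrite rank_diag_block_mx leq_add2r /g; have [->|_] := eqVneq c _.
  by rewrite subrr raddf0 mxrank0.
exact: rank_leq_row.
Qed.

Definition on_sphere (w : 'rV[F]_d) := (X *m w^T == b) && (ent (w *m w^T) == c).
Definition sphere_hat (xi : 'rV[F]_d) : algC :=
  \sum_(w | on_sphere w) chi (ent (xi *m w^T)).

(** The part of the Fourier transform of the sphere with frequency t for the
    equation w.w = c; the variable v is dual to the linear equations X w = b. *)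
Definition slice xi t : algC := \sum_(v : 'rV[F]_m) \sum_(w : 'rV[F]_d)
  chi (t * (ent (w *m w^T) - c) + ent (v *m (X *m w^T - b)) + ent (xi *m w^T)).

Lemma sphere_hatE xi : (q ^ m.+1)%:R * sphere_hat xi = \sum_t slice xi t.
Proof.
rewrite /slice; under eq_bigr do rewrite exchange_big /=.
rewrite exchange_big /= /sphere_hat mulr_sumr big_mkcond; apply: eq_bigr => w _.
have -> : \sum_t \sum_(v : 'rV_m) chi (t * (ent (w *m w^T) - c) +
    ent (v *m (X *m w^T - b)) + ent (xi *m w^T)) =
  (\sum_t chi ((ent (w *m w^T) - c) * t)) * (\sum_(v : 'rV_m) chi (ent (v *m (X *m w^T - b))))
  * chi (ent (xi *m w^T)).
  rewrite big_distrl /= big_distrl /=; apply: eq_bigr => t _.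
  rewrite big_distrr /= big_distrl /=; apply: eq_bigr => v _.
  by rewrite !chiD [t * _]mulrC.
rewrite (sum_char chiP) (sum_char_vec chiP) !subr_eq0 /on_sphere andbC.
case: eqP => _ /=; last by rewrite !mul0r.
case: eqP => _ /=; last by rewrite mulr0 mul0r.
by rewrite -natrM expnS.
Qed.

(** At t = 0 the sphere degenerates to the affine subspace X w = b, whose Fourier
    transform lives on the span of X. *)
Lemma slice0E xi : slice xi 0 =
  \sum_(v : 'rV[F]_m | v *m X + xi == 0) (q ^ d)%:R * chi (- ent (v *m b)).
Proof.
rewrite /slice [RHS]big_mkcond; apply: eq_bigr => v _.
transitivity (\sum_w chi (- ent (v *m b)) * chi (ent (w *m (v *m X + xi)^T))).
  apply: eq_bigr => w _; rewrite -chiD; congr chi.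
  rewrite -(ent_tr (w *m _)) trmx_mul trmxK mulmxDl mulmxBr mul0r !entD entN.
  by rewrite mulmxA; ring.
rewrite -mulr_sumr (sum_char_vec chiP) -[_^T == 0](inj_eq trmx_inj) trmxK trmx0.
by case: ifP => _; rewrite ?mulr0 // mulrC.
Qed.

Lemma norm_slice0 xi : `|slice xi 0| <= if (xi <= X)%MS then (q ^ d)%:R else 0.
Proof.
rewrite slice0E; case: ifPn => [/submxP [v xv]|nx]; last first.
  rewrite big_pred0 ?normr0 // => v; apply: contraNF nx.
  rewrite addrC addr_eq0 => /eqP ->; rewrite -mulNmx; exact: submxMl.
rewrite (big_pred1 (- v)); first by rewrite normrM (norm_char chiP) mulr1 normr_nat.
move=> w; rewrite xv -mulmxDl /= -(addr_eq0 w v).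
apply/eqP/eqP => [|->]; last by rewrite mul0mx.
by rewrite -[0 in X in X -> _](mul0mx _ X) => /(row_free_inj freeX).
Qed.

Lemma slice00 : slice 0 0 = (q ^ d)%:R.
Proof.
rewrite slice0E (big_pred1 0); first by rewrite mul0mx ent0 oppr0 (char0 chiP) mulr1.
move=> w; rewrite addr0 /=; apply/eqP/eqP => [|->]; last by rewrite mul0mx.
by rewrite -[0 in X in X -> _](mul0mx _ X) => /(row_free_inj freeX).
Qed.

(** For t <> 0 the sum over w is a Gauss sum on F^d with linear term v X + xi;
    completing the square there and rescaling v by 2 t leaves a Gauss sum for the
    form X X^T, with linear term 2 t b + X xi. *)
Lemma sliceE xi t : t != 0 -> slice xi t =
  mgauss chi (1%:M : 'M[F]_d) t 0 * chi (- (t * c) - ent (xi *m xi^T) / (4%:R * t)) *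
  mgauss chi G (- t) (- (2%:R * t *: b + X *m xi^T)).
Proof.
move=> t0; have t20 : 2%:R * t != 0 by rewrite mulf_neq0.
rewrite /slice (reindex_inj (h := fun v : 'rV[F]_m => (2%:R * t) *: v)) /=; last first.
  by move=> v w /(congr1 (fun x => (2%:R * t)^-1 *: x)); rewrite !scalerA mulVf // !scale1r.
rewrite [X in _ = _ * X]/mgauss mulr_sumr; apply: eq_bigr => v _.
transitivity (mgauss chi (1%:M : 'M[F]_d) t (1%:M *m (((2%:R * t) *: v) *m X + xi)^T) *
   chi (- (t * c) - ent ((2%:R * t) *: v *m b))).
  rewrite mul1mx /mgauss mulr_suml; apply: eq_bigr => w _; rewrite -chiD; congr chi.
  rewrite mulmx1 -(ent_tr (w *m (_ + _)^T)) trmx_mul trmxK mulmxDl mulmxBr !entD entN.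
  by rewrite mulmxA; ring.
rewrite mgauss_im ?trmx1 // mulrC mulrA -chiD mulrC -[RHS]mulrA -chiD.
congr (_ * chi _).
rewrite mulmx1 trmxK linearD /= !trmx_mul linearZ /= !(mulmxDl, mulmxDr).
rewrite -!scalemxAl -!scalemxAr !entD !mulmxN !entN mulmxDr entD -scalemxAr !entZ.
have -> : ent (xi *m (X^T *m v^T)) = ent (v *m X *m xi^T).
  by rewrite -ent_tr !trmx_mul !trmxK.
rewrite !mulmxA.
by field; rewrite t0 f4 mulf_neq0.
Qed.

Lemma norm_slice xi t : t != 0 -> `|slice xi t| <= s ^+ (d + 2 * m - \rank G).
Proof.
move=> t0; rewrite sliceE // !normrM (norm_char chiP) mulr1.
have r1 := mgauss_le F2 chiP (trmx1 F d) 0 t0.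
have r2 := mgauss_le F2 chiP gram_sym (- (2%:R * t *: b + X *m xi^T)) (t := - t).
rewrite oppr_eq0 in r2; have {}r2 := r2 t0.
have -> : (d + 2 * m - \rank G = (2 * d - \rank (1%:M : 'M[F]_d)) + (2 * m - \rank G))%N.
  by rewrite mxrank1; have := rank_leq_row G; lia.
by rewrite exprD ler_pM ?normr_ge0.
Qed.

Lemma natq_sqrt n : (q ^ n)%:R = s ^+ (2 * n) :> algC.
Proof. by rewrite exprM sqrt_q2 natrX. Qed.

Lemma exp_sqrt_le i j : (i <= j)%N -> s ^+ i <= s ^+ j.
Proof. by move=> ij; apply: ler_weXn2l => //; apply: sqrt_q_ge1. Qed.

(** The exponents work out in three cases.  If b is not in the image of the
    form G, then only one t survives, and the rank grows by at most 2.  If b = G z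
    and c = z^T G z, then the rank does not grow, and the trivial bound in t is
    enough.  If b = G z and c <> z^T G z, then the rank grows by at most 1 and a sum
    over t with frequency z^T G z - c remains, where [norm_twisted] saves a
    factor sqrt(q). *)
Lemma norm_slice_tail xi :
  `|\sum_(t | t != 0) slice xi t| <= 4%:R * s ^+ (d + 2 * m.+1 - rho).
Proof.
have s0 := sqrt_q_gt0 F; have rG := rank_leq_row G.
have rr : (rho <= m.+1)%N := rank_leq_row _.
set P := s ^+ (d + 2 * m - \rank G).
have P0 : 0 <= P by rewrite exprn_ge0 // ltW.
set B := s ^+ (d + 2 * m.+1 - rho).
have B0 : 0 <= B by rewrite exprn_ge0 // ltW.
have B4 : B <= 4%:R * B by rewrite ler_peMl // ler1n.
have [[z bz]|[h hG hb]] := im_or_ker gram_sym b; last first.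
  pose t0 := - (ent (h *m (X *m xi^T)) / (2%:R * ent (h *m b))).
  apply: le_trans B4; apply: (@le_trans _ _ P); last first.
    by apply: exp_sqrt_le; have := rank_gram_ext; lia.
  rewrite (le_trans (ler_norm_sum _ _ _)) //.
  apply: (@le_trans _ _ (\sum_(t | t == t0) P)); last by rewrite big_pred1_eq.
  rewrite [leLHS]big_mkcond [leRHS]big_mkcond /=; apply: ler_sum => t _.
  case: ifPn => [tn0|_]; last by case: ifP.
  case: ifPn => [_|tt0]; first exact: norm_slice.
  rewrite sliceE // (mgauss_ker chiP gram_sym _ hG) ?mulr0 ?normr0 //.
  rewrite mulmxN entN oppr_eq0 mulmxDr entD -scalemxAr entZ.
  apply: contra tt0; rewrite addrC addr_eq0 /t0 => /eqP ->.
  by apply/eqP; field; rewrite hb.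
have hr := rank_gram_ext_im bz.
have [[u yu]|[h hG hy]] := im_or_ker gram_sym (X *m xi^T); last first.
  rewrite big1 ?normr0 ?mulr_ge0 ?ler0n // => t t0.
  rewrite sliceE // (mgauss_ker chiP gram_sym _ hG) ?mulr0 //.
  rewrite mulmxN entN oppr_eq0 mulmxDr entD -scalemxAr {1}bz mulmxA hG mul0mx.
  by rewrite scaler0 ent0 add0r.
pose g := c - ent (z^T *m G *m z).
pose be := (ent (u^T *m G *m u) - ent (xi *m xi^T)) / 4%:R.
pose H t := mgauss chi (1%:M : 'M[F]_d) t 0 * mgauss chi G (- t) 0.
have HP t : t != 0 -> `|H t| <= P.
  move=> t0; rewrite /H normrM.
  have r1 := mgauss_le F2 chiP (trmx1 F d) 0 t0.
  have r2 := mgauss_le F2 chiP gram_sym 0 (t := - t).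
  rewrite oppr_eq0 in r2; have {}r2 := r2 t0.
  rewrite /P (_ : (d + 2 * m - \rank G = (2 * d - \rank (1%:M : 'M[F]_d)) + (2 * m - \rank G))%N).
    by rewrite exprD ler_pM ?normr_ge0.
  by rewrite mxrank1; lia.
have Hsq t v : t != 0 -> v != 0 -> H (t * v ^+ 2) = H t.
  by move=> _ v0; rewrite /H -mulNr !mgauss_sqr.
have sE t : t != 0 -> slice xi t = chi (ent (z^T *m G *m u)) * (H t * chi (- g * t + be / t)).
  move=> t0; rewrite sliceE //.
  have -> : - (2%:R * t *: b + X *m xi^T) = G *m (- (2%:R * t *: z + u)).
    by rewrite mulmxN mulmxDr -scalemxAr -bz yu.
  rewrite (mgauss_im F2 chiP gram_sym) ?oppr_eq0 //.
  rewrite -!mulrA [chi _ * (chi _ * mgauss _ _ _ _)]mulrA -chiD.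
  rewrite [RHS]mulrC /H -!mulrA; congr (_ * _); rewrite mulrC; congr (_ * _).
  rewrite -chiD; congr chi.
  rewrite [(- _)^T]raddfN /= !(mulNmx, mulmxN) opprK [(_ + _)^T]raddfD /= [(_ *: _)^T]linearZ /=.
  rewrite !(mulmxDl, mulmxDr) -!scalemxAl -!scalemxAr !entD !entZ.
  have -> : ent (u^T *m G *m z) = ent (z^T *m G *m u).
    by rewrite -ent_tr trmx_mul [(u^T *m G)^T]trmx_mul gram_sym trmxK mulmxA.
  have f40 : 4%:R != 0 :> F by rewrite f4 mulf_neq0.
  by rewrite /g /be; field; rewrite t0 f40 oppr_eq0.
rewrite (eq_bigr _ sE) -mulr_sumr normrM (norm_char chiP) mul1r.
have [g0|g0] := eqVneq g 0.
  apply: le_trans B4; apply: (@le_trans _ _ (q%:R * P)); last first.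
    rewrite -[q]expn1 natq_sqrt /P -exprD; apply: exp_sqrt_le.
    by move/eqP: g0; rewrite subr_eq0 => ce; move: hr; rewrite ce /=; lia.
  rewrite (le_trans (ler_norm_sum _ _ _)) //.
  apply: (@le_trans _ _ (\sum_(t : F) P)); last by rewrite sumr_const mulr_natl.
  rewrite [leLHS]big_mkcond; apply: ler_sum => t _; case: ifP => // t0.
  by rewrite normrM (norm_char chiP) mulr1 HP.
rewrite (le_trans (norm_twisted F2 chiP be _ Hsq HP)) ?oppr_eq0 // -mulrA.
rewrite ler_wpM2l ?ler0n // /P -exprSr; apply: exp_sqrt_le.
by move: hr; case: (_ != _) => /=; lia.
Qed.

Hypothesis hd : (2 * m.+1 < d + rho)%N.

Lemma sphere_hat_le xi :
  `|sphere_hat xi - (if xi == 0 then (q ^ (d - m.+1))%:R else 0)| <=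
  (if (xi != 0) && (xi <= X)%MS then (q ^ (d - m.+1))%:R else 0)
  + 4%:R * s ^+ (d - rho).
Proof.
have s0 := sqrt_q_gt0 F; have rr : (rho <= m.+1)%N := rank_leq_row _.
have md : (m.+1 <= d)%N by lia.
have qm : 0 < (q ^ m.+1)%:R :> algC by rewrite ltr0n expn_gt0 (ltnW (finNzRing_gt1 F)).
rewrite -(ler_pM2l qm) -{1}(gtr0_norm qm) -normrM mulrBr sphere_hatE.
rewrite (bigD1 0) //= mulrDr.
have -> : (q ^ m.+1)%:R * (4%:R * s ^+ (d - rho)) = 4%:R * s ^+ (d + 2 * m.+1 - rho).
  rewrite natq_sqrt mulrCA -exprD; congr (_ * _ ^+ _); lia.
have qd : (q ^ m.+1)%:R * (q ^ (d - m.+1))%:R = (q ^ d)%:R :> algC.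
  by rewrite -natrM -expnD subnKC.
rewrite addrAC (le_trans (ler_normD _ _)) // lerD ?norm_slice_tail //.
have [->|x0] := eqVneq xi 0; first by rewrite slice00 qd subrr normr0 mulr0.
rewrite mulr0 subr0 /= (le_trans (norm_slice0 xi)) //.
by case: ifP; rewrite ?mulr0 // qd.
Qed.

(** The points of the span of X are removed from the sphere, because w must
    extend X to a row free matrix. *)
Definition free_sphere_hat (xi : 'rV[F]_d) : algC :=
  \sum_(w | on_sphere w && ~~ (w <= X)%MS) chi (ent (xi *m w^T)).

(** If the sphere meets the span of X, it does so in the translates of one
    point by the kernel of the Gram matrix; moreover b is then in the image of
    that matrix and the rank does not grow. *)
Lemma card_sphere_span :
  (#|[set w | on_sphere w && (w <= X)%MS]|)%:R <= s ^+ (d - rho).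
Proof.
have s0 := sqrt_q_gt0 F; have rr : (rho <= m.+1)%N := rank_leq_row _.
have rG := rank_leq_row G.
have [->|[w0]] := set_0Vmem [set w | on_sphere w && (w <= X)%MS].
  by rewrite cards0 exprn_ge0 // ltW.
rewrite inE => /andP[/andP[/eqP Xw0 /eqP ww0] /submxP [v0 wv0]].
have bz : b = G *m v0^T by rewrite -Xw0 wv0 trmx_mul mulmxA.
have hr := rank_gram_ext_im bz.
have ce : c = ent (v0 *m G *m v0^T) by rewrite -ww0 wv0 trmx_mul !mulmxA.
rewrite trmxK -ce eqxx /= add0n in hr.
pose K := [set h : 'rV[F]_m | h *m G == 0].
have sub : [set w | on_sphere w && (w <= X)%MS] \subset [set (v0 + h) *m X | h in K].
  apply/subsetP => w; rewrite inE => /andP[/andP[/eqP Xw _] /submxP [v wv]].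
  apply/imsetP; exists (v - v0); last by rewrite addrC subrK.
  rewrite inE mulmxBl subr_eq0 !(mulmxA _ X) -wv -wv0; apply/eqP.
  by apply: trmx_inj; rewrite !trmx_mul !trmxK Xw Xw0.
rewrite (@le_trans _ _ (#|K|%:R)) //.
  by rewrite ler_nat (leq_trans (subset_leq_card sub)) // leq_imset_card.
rewrite /K (card_ker G) natq_sqrt; apply: exp_sqrt_le; lia.
Qed.

Lemma free_sphere_hat_le xi :
  `|free_sphere_hat xi - (if xi == 0 then (q ^ (d - m.+1))%:R else 0)| <=
  (if (xi != 0) && (xi <= X)%MS then (q ^ (d - m.+1))%:R else 0)
  + 5%:R * s ^+ (d - rho).
Proof.
have e : free_sphere_hat xi = sphere_hat xi -
    \sum_(w | on_sphere w && (w <= X)%MS) chi (ent (xi *m w^T)).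
  by rewrite /sphere_hat (bigID (fun w => (w <= X)%MS)) /= addrC addrK.
rewrite e addrAC (le_trans (ler_normB _ _)) //.
have -> : 5%:R = 4%:R + 1 :> algC by rewrite natr1.
rewrite mulrDl mul1r addrA lerD ?sphere_hat_le // (le_trans _ card_sphere_span) //.
rewrite (le_trans (ler_norm_sum _ _ _)) // -sum1dep_card natr_sum.
by apply: ler_sum => w _; rewrite (norm_char chiP).
Qed.

Lemma card_free_sphere :
  (#|[set w | on_sphere w && ~~ (w <= X)%MS]| <= 6 * q ^ (d - m.+1))%N.
Proof.
have s0 := sqrt_q_gt0 F; have rr : (rho <= m.+1)%N := rank_leq_row _.
have := free_sphere_hat_le 0; rewrite !eqxx /= add0r.
have -> : free_sphere_hat 0 = (#|[set w | on_sphere w && ~~ (w <= X)%MS]|)%:R.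
  rewrite /free_sphere_hat -sum1dep_card natr_sum; apply: eq_bigr => w _.
  by rewrite mul0mx ent0 (char0 chiP).
move=> h; rewrite -(ler_nat algC) natrM.
have -> : 6%:R = 1 + 5%:R :> algC by rewrite nat1r.
rewrite mulrDl mul1r -lerBlDl (le_trans (real_ler_norm _)) ?rpredB ?realn //.
rewrite (le_trans h) // ler_wpM2l ?ler0n // natq_sqrt.
by apply: exp_sqrt_le; lia.
Qed.

End Sphere.

(** * Matrices with a given Gram matrix *)

Section Grams.
Variable F : finFieldType.
Local Notation q := #|F|.

Definition grams m d (G : 'M[F]_m) : {set 'M[F]_(m, d)} :=
  [set X | row_free X & X *m X^T == G].

Lemma row_free_col_mx m d (w : 'rV[F]_d) (X : 'M[F]_(m, d)) :
  row_free (col_mx w X) = row_free X && ~~ (w <= X)%MS.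
Proof.
apply/idP/andP => [fwX|[fX nw]].
  split.
    apply: inj_row_free => v vX.
    have : row_mx (0 : 'M_1) v *m col_mx w X = 0 by rewrite mul_row_col vX mul0mx addr0.
    rewrite -(mul0mx _ (col_mx w X)) => /(row_free_inj fwX).
    by rewrite -row_mx0 => /eq_row_mx [].
  apply/negP => /submxP [v wv].
  have : row_mx (1%:M : 'M_1) (- v) *m col_mx w X = 0.
    by rewrite mul_row_col mul1mx mulNmx wv subrr.
  rewrite -(mul0mx _ (col_mx w X)) => /(row_free_inj fwX).
  rewrite -row_mx0 => /eq_row_mx [] /(congr1 (@ent F)).
  by rewrite /ent !mxE eqxx /= => /eqP; rewrite oner_eq0.
apply: inj_row_free => u; rewrite -[u]hsubmxK mul_row_col.
set a := lsubmx u; set v := rsubmx u => e.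
have a0 : a = 0.
  apply/eqP; apply: contraNT nw; rewrite -ent_eq0 => a0; apply/submxP.
  exists (- (ent a)^-1 *: v); rewrite -scalemxAl.
  have aw : a *m w = ent a *: w by rewrite {1}[a]mx11_scalar mul_scalar_mx.
  move/eqP: e; rewrite addrC addr_eq0 => /eqP ->.
  by rewrite aw scalerN scaleNr opprK scalerA mulVf ?scale1r.
move: e; rewrite a0 mul0mx add0r -(mul0mx _ X) => /(row_free_inj fX) ->.
by rewrite row_mx0.
Qed.

Section Step.
Variables (m d : nat) (G : 'M[F]_(1 + m)).
Hypothesis symG : G^T = G.
Local Notation G' := (drsubmx G).
Local Notation b := (dlsubmx G).
Local Notation c := (ent (ulsubmx G)).

Lemma sub_gram_sym : G'^T = G'.
Proof. by rewrite trmx_drsub symG. Qed.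

Lemma gram_extE (X : 'M[F]_(m, d)) : X *m X^T = G' -> gram_ext X b c = G.
Proof.
move=> XG; rewrite /gram_ext XG -[RHS]submxK; congr block_mx.
  by rewrite [RHS]mx11_scalar.
by rewrite trmx_dlsub symG.
Qed.

Lemma grams_col_mx (w : 'rV[F]_d) (X : 'M[F]_(m, d)) :
  (col_mx w X \in grams d G) =
  (X \in grams d G') && (on_sphere X b c w && ~~ (w <= X)%MS).
Proof.
rewrite !inE row_free_col_mx tr_col_mx mul_col_row -[G in _ == G]submxK.
have -> : (block_mx (w *m w^T) (w *m X^T) (X *m w^T) (X *m X^T) ==
   block_mx (ulsubmx G) (ursubmx G) b G') = 
   [&& X *m X^T == G', X *m w^T == b & ent (w *m w^T) == c].
  apply/eqP/and3P => [/eq_block_mx [-> _ -> ->]|[/eqP -> /eqP e1 /eqP e2]]; first by rewrite !eqxx.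
  congr block_mx => //.
    by rewrite [LHS]mx11_scalar [RHS]mx11_scalar -/(ent _) e2.
  by rewrite -[w *m X^T]trmxK trmx_mul trmxK e1 trmx_dlsub symG.
rewrite /on_sphere; case: (row_free X) => //=; case: (w <= X)%MS => /=; rewrite ?andbF ?andbT //.
Qed.

Lemma sum_grams (V : nmodType) (f : 'M[F]_(1 + m, d) -> V) :
  \sum_(Y in grams d G) f Y =
  \sum_(X in grams d G') \sum_(w | on_sphere X b c w && ~~ (w <= X)%MS) f (col_mx w X).
Proof.
rewrite pair_big_dep /= (reindex (fun p : 'M[F]_(m, d) * 'rV[F]_d => col_mx p.2 p.1)) /=.
  by apply: eq_bigl => -[X w] /=; rewrite grams_col_mx.
exists (fun Y => (dsubmx Y, usubmx Y)) => [[X w] _|Y _] /=.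
  by rewrite col_mxKd col_mxKu.
exact: vsubmxK.
Qed.

End Step.
End Grams.

(** * Counting matrices with a given Gram matrix *)

Section CountGrams.
Variable F : finFieldType.
Hypothesis F2 : 2 \notin [pchar F].
Local Notation q := #|F|.

Lemma card_filter_grams m d (G : 'M[F]_(1 + m)) (P : pred 'M[F]_(1 + m, d)) (Q : pred 'M[F]_(m, d)) :
  G^T = G -> (2 * m.+1 < d + \rank G)%N -> (forall w X, P (col_mx w X) -> Q X) ->
  (#|[set Y in grams d G | P Y]| <=
     #|[set X in grams d (drsubmx G) | Q X]| * (6 * q ^ (d - m.+1)))%N.
Proof.
move=> symG hd PQ; have [chi chiP] := exists_add_char F.
rewrite -sum1dep_card big_mkcondr (sum_grams symG) /=.
rewrite -sum1dep_card big_distrl /= [leqRHS]big_mkcondr /=.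
apply: leq_sum => X; rewrite inE => /andP[fX /eqP XG].
rewrite -big_mkcondr sum1dep_card; case: (boolP (Q X)) => [qX|nqX]; last first.
  rewrite leqn0 cards_eq0; apply/eqP/setP => w; rewrite !inE.
  by apply: contraNF nqX => /andP[_ /PQ].
rewrite mul1n; have := card_free_sphere F2 chiP (c := ent (ulsubmx G)) (b := dlsubmx G) fX.
rewrite (gram_extE symG XG) => /(_ hd); apply: leq_trans.
by apply: subset_leq_card; apply/subsetP => w; rewrite !inE => /andP[].
Qed.

Lemma card_grams m d (G : 'M[F]_m) : G^T = G -> (2 * m < d + \rank G)%N ->
  (#|grams d G| * q ^ 'C(m.+1, 2) <= 6 ^ m * q ^ (m * d))%N.
Proof.
elim: m G => [|m IH] G symG hd.
  by rewrite bin_small // muln1 mul0n !expn0 -[leqRHS](card_mx F 0 d) max_card.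
have h := @card_filter_grams m d G xpredT xpredT symG hd (fun _ _ _ => isT).
have e n (H : 'M[F]_n) : [set Y in grams d H | true] = grams d H.
  by apply/setP => Y; rewrite inE andbT.
rewrite /= !e in h; have hr := rank_corner G.
have := IH (drsubmx (G : 'M_(1 + m))) (sub_gram_sym symG).
have -> : (2 * m < d + \rank (drsubmx (G : 'M_(1 + m))))%N.
  by move: hd hr; rewrite -[(1 + m)%N]/(m.+1); lia.
move=> /(_ isT) {}IH.
have dm : (m.+1 <= d)%N by have := rank_leq_row G; lia.
rewrite binS bin1 expnD mulnA.
have -> : (q ^ (m.+1 * d) = q ^ (d - m.+1) * q ^ (m * d) * q ^ m.+1)%N.
  by rewrite -!expnD; congr (_ ^ _)%N; rewrite mulSn; lia.
rewrite mulnA leq_mul2r; apply/orP; right.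
apply: (leq_trans (leq_mul h (leqnn _))).
rewrite mulnAC expnS.
have -> : (6 * 6 ^ m * (q ^ (d - m.+1) * q ^ (m * d)) = 6 ^ m * q ^ (m * d) * (6 * q ^ (d - m.+1)))%N.
  by ring.
by rewrite leq_mul2r IH orbT.
Qed.

(** Prescribing one row lowers the bound by a factor q^(d-1).  The row is the
    last one because the induction adds rows on top. *)
Lemma card_grams_last m d (G : 'M[F]_m.+1) (xi : 'rV[F]_d) : G^T = G ->
  (2 * m.+1 < d + \rank G)%N ->
  (#|[set X in grams d G | row ord_max X == xi]| * q ^ 'C(m.+2, 2) <= 6 ^ m * q ^ (m * d).+1)%N.
Proof.
elim: m G => [|m IH] G symG hd.
  rewrite expn0 mul1n mul0n (_ : 'C(2, 2) = 1)%N // -[leqRHS]mul1n leq_mul2r; apply/orP; right.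
  apply: (@leq_trans #|[set xi]|); last by rewrite cards1.
  apply: subset_leq_card; apply/subsetP => X; rewrite !inE => /andP[_ /eqP <-].
  apply/eqP/matrixP => i j; rewrite !mxE; congr (X _ _); apply: val_inj.
  by rewrite /= ord1.
have PQ (w : 'rV[F]_d) (X : 'M[F]_(m.+1, d)) :
    row ord_max (col_mx w X) == xi -> row ord_max X == xi.
  suff -> : row ord_max (col_mx w X) = row ord_max X by [].
  apply/rowP => j; rewrite !mxE.
  have -> : (ord_max : 'I_(1 + m.+1)) = rshift 1 (ord_max : 'I_m.+1) by apply: val_inj.
  by rewrite (unsplitK (inr _)).
have h := @card_filter_grams m.+1 d G
  (fun Y : 'M_(m.+2, d) => row ord_max Y == xi)
  (fun X : 'M_(m.+1, d) => row ord_max X == xi) symG hd PQ.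
have hr := rank_corner (G : 'M_(1 + m.+1)).
have := IH (drsubmx (G : 'M_(1 + m.+1))) (sub_gram_sym symG).
have -> : (2 * m.+1 < d + \rank (drsubmx (G : 'M_(1 + m.+1))))%N.
  by move: hd hr; rewrite -[(1 + m.+1)%N]/(m.+2); lia.
move=> /(_ isT) {}IH.
have dm : (m.+2 <= d)%N by have := rank_leq_row G; lia.
rewrite binS bin1 expnD mulnA.
have -> : (q ^ (m.+1 * d).+1 = q ^ (d - m.+2) * q ^ (m * d).+1 * q ^ m.+2)%N.
  by rewrite -!expnD; congr (_ ^ _)%N; rewrite mulSn; lia.
rewrite mulnA leq_mul2r; apply/orP; right.
apply: (leq_trans (leq_mul h (leqnn _))).
rewrite mulnAC expnS.
have -> : (6 * 6 ^ m * (q ^ (d - m.+2) * q ^ (m * d).+1) = 6 ^ m * q ^ (m * d).+1 * (6 * q ^ (d - m.+2)))%N.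
  by ring.
by rewrite leq_mul2r IH orbT.
Qed.

Lemma extend_row n (v : 'rV[F]_n.+1) : v != 0 ->
  exists2 T : 'M[F]_n.+1, T \in unitmx & row ord_max T = v.
Proof.
move=> v0; have [|T uT eT] := @complete_unitmx F 1 n.+1 (delta_mx 0 ord_max) (delta_mx ord_max 0 *m v).
  rewrite mulmxA mul_delta_mx mxrank_delta.
  rewrite (_ : delta_mx 0 0 = 1%:M) ?mul1mx ?rank_rV ?v0 //.
  by apply/matrixP => i j; rewrite !ord1 !mxE eqxx.
exists T; rewrite // rowE -eT mulmxA mul_delta_mx (_ : delta_mx 0 0 = 1%:M) ?mul1mx //.
by apply/matrixP => i j; rewrite !ord1 !mxE eqxx.
Qed.

(** If xi = v X with v <> 0, then an invertible change of rows makes xi the last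
    row of X and replaces G by a congruent matrix; there are at most q^m
    choices of v. *)
Lemma card_grams_span m d (G : 'M[F]_m) (xi : 'rV[F]_d) : G^T = G ->
  (2 * m < d + \rank G)%N -> xi != 0 ->
  (#|[set X in grams d G | (xi <= X)%MS]| * q ^ d * q ^ 'C(m.+1, 2) <=
     6 ^ m * q ^ (m * d) * q ^ m.+1)%N.
Proof.
case: m G => [|m] G symG hd xi0.
  rewrite (_ : [set X in _ | _] = set0) ?cards0 //.
  apply/setP => X; rewrite !inE; apply/negP => /andP[_ h].
  by move: xi0; rewrite -mxrank_eq0 -leqn0; apply/negP/negPn; rewrite (leq_trans (mxrankS h)) // rank_leq_row.
have bnd (v : 'rV[F]_m.+1) : v != 0 ->
    (#|[set X in grams d G | v *m X == xi]| * q ^ 'C(m.+2, 2) <= 6 ^ m * q ^ (m * d).+1)%N.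
  move=> v0; have [T uT rT] := extend_row v0.
  have symT : (T *m G *m T^T)^T = T *m G *m T^T by rewrite !trmx_mul trmxK symG mulmxA.
  have rkT : \rank (T *m G *m T^T) = \rank G.
    rewrite mxrankMfree; last by rewrite row_free_unit unitmx_tr.
    by rewrite -mxrank_tr trmx_mul mxrankMfree ?mxrank_tr // row_free_unit unitmx_tr.
  have := card_grams_last xi symT; rewrite rkT => /(_ hd); apply: leq_trans.
  rewrite leq_mul2r; apply/orP; right.
  rewrite -(card_imset _ (can_inj (mulKmx uT))); apply: subset_leq_card.
  apply/subsetP => _ /imsetP [X + ->]; rewrite !inE => /andP[/andP[fX /eqP XG] /eqP vX].
  rewrite -XG row_mul rT vX eqxx andbT trmx_mul !mulmxA eqxx andbT.
  by rewrite /row_free mxrankMfree // mxrank_unit.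
have sub : (#|[set X in grams d G | (xi <= X)%MS]| <=
    \sum_(v : 'rV[F]_m.+1 | (v != 0)%R) #|[set X in grams d G | (v *m X == xi)%R]|)%N.
  rewrite -sum1dep_card; under [leqRHS]eq_bigr do rewrite -sum1dep_card big_mkcondr.
  rewrite big_mkcondr exchange_big /=; apply: leq_sum => X gX.
  case: ifP => // /submxP [v xv]; rewrite (bigD1 v) ?xv ?eqxx //.
  by apply: contraNneq xi0 => v0; rewrite xv v0 mul0mx.
have h : (#|[set X in grams d G | (xi <= X)%MS]| * q ^ 'C(m.+2, 2) <=
          q ^ m.+1 * (6 ^ m * q ^ (m * d).+1))%N.
  apply: (leq_trans (leq_mul sub (leqnn _))); rewrite big_distrl /=.
  apply: (@leq_trans (\sum_(v : 'rV[F]_m.+1) 6 ^ m * q ^ (m * d).+1)%N).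
    by rewrite big_mkcond; apply: leq_sum => v _; case: ifP => // /bnd.
  by rewrite sum_nat_const card_mx mul1n.
rewrite mulnAC (leq_trans (leq_mul h (leqnn _))) //.
have -> : (q ^ (m.+1 * d) = q ^ (m * d) * q ^ d)%N by rewrite -expnD mulSn addnC.
have -> : (q ^ (m * d).+1 = q ^ (m * d) * q)%N by rewrite expnSr.
have -> : (q ^ m.+2 = q ^ m.+1 * q)%N by rewrite expnSr.
rewrite (expnS 6) (_ : forall A B C D E : nat, A * (B * (C * D)) * E = B * (C * E) * (A * D))%N; last by move=> *; ring.
by rewrite leq_mul2r leq_mul2r leq_pmull ?orbT.
Qed.

End CountGrams.

(** * Parseval and the variance of the sphere count *)

Section Variance.
Variables (F : finFieldType) (chi : F -> algC).
Hypothesis (F2 : 2 \notin [pchar F]) (chiP : is_add_char chi).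
Local Notation q := #|F|.
Let chiD := charD chiP.

Lemma parseval d (g : 'rV[F]_d -> algC) :
  \sum_xi `|\sum_x g x * chi (ent (xi *m x^T))| ^+ 2 = (q ^ d)%:R * \sum_x `|g x| ^+ 2.
Proof.
transitivity (\sum_x \sum_y g x * (g y)^* * \sum_(xi : 'rV[F]_d) chi (ent (xi *m (x - y)^T))).
  under [RHS]eq_bigr do under eq_bigr do rewrite mulr_sumr.
  under [RHS]eq_bigr do rewrite exchange_big.
  rewrite [RHS]exchange_big /=; apply: eq_bigr => xi _.
  rewrite normCK rmorph_sum mulr_suml; apply: eq_bigr => x _.
  rewrite mulr_sumr; apply: eq_bigr => y _.
  rewrite rmorphM /= (char_conj chiP) [(_ - _)^T]raddfB /= mulmxBr entD entN chiD.
  by rewrite mulrACA.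
rewrite mulr_sumr; apply: eq_bigr => x _.
rewrite (bigD1 x) //= subrr (sum_char_vec chiP) trmx0 eqxx big1 ?addr0.
  by rewrite normCK mulrC.
move=> y yx; rewrite (sum_char_vec chiP) -trmx0 (inj_eq trmx_inj) subr_eq0.
by rewrite eq_sym (negPf yx) mulr0.
Qed.

Definition set_hat d (A : {set 'rV[F]_d}) xi : algC := \sum_(x in A) chi (ent (xi *m x^T)).

Lemma sum_set_hat d (A : {set 'rV[F]_d}) :
  \sum_xi `|set_hat A xi| ^+ 2 = (q ^ d * #|A|)%:R.
Proof.
transitivity (\sum_(xi : 'rV[F]_d) `|\sum_x (x \in A)%:R * chi (ent (xi *m x^T))| ^+ 2).
  apply: eq_bigr => xi _; congr (`|_| ^+ 2); rewrite /set_hat big_mkcond.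
  by apply: eq_bigr => x _; case: (x \in A); rewrite ?mul1r ?mul0r.
rewrite parseval natrM; congr (_ * _).
rewrite -sum1_card natr_sum [RHS]big_mkcond; apply: eq_bigr => x _.
by case: (x \in A); rewrite ?normr1 ?normr0 ?expr1n ?expr0n.
Qed.

Definition discrepancy d (A : {set 'rV[F]_d}) (W : pred 'rV[F]_d) (k : nat) x : algC :=
  (\sum_(w | W w) (x + w \in A)%:R) - #|A|%:R / (q ^ k)%:R.

(** The count of w with x + w in A is a correlation, so its Fourier transform
    is the product of that of A and of the conjugate of that of W; the constant
    |A| / q^k only changes the value at 0. *)
Lemma discrepancy_hat d (A : {set 'rV[F]_d}) (W : pred 'rV[F]_d) k xi : (k <= d)%N ->
  \sum_x discrepancy A W k x * chi (ent (xi *m x^T)) = set_hat A xi *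
    (\sum_(w | W w) chi (ent (xi *m w^T)) - (if xi == 0 then (q ^ (d - k))%:R else 0))^*.
Proof.
move=> kd; rewrite /discrepancy; under eq_bigr do rewrite mulrBl.
rewrite sumrB -mulr_sumr rmorphB mulrBr; congr (_ - _).
  under eq_bigr do rewrite mulr_suml.
  rewrite exchange_big /= rmorph_sum mulr_sumr; apply: eq_bigr => w _.
  rewrite (reindex_inj (addIr (- w))) /= (char_conj chiP) /set_hat mulr_suml.
  rewrite [RHS]big_mkcond; apply: eq_bigr => x _.
  rewrite subrK; case: (x \in A); rewrite ?mul0r // mul1r.
  by rewrite [(_ - _)^T]raddfB /= mulmxBr entD entN chiD.
have -> : \sum_(x : 'rV[F]_d) chi (ent (xi *m x^T)) = if xi == 0 then (q ^ d)%:R else 0.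
  rewrite (eq_bigr (fun x : 'rV_d => chi (ent (x *m xi^T)))).
    by rewrite (sum_char_vec chiP) -trmx0 (inj_eq trmx_inj).
  by move=> x _; rewrite -ent_tr trmx_mul trmxK.
case: eqP => [->|_]; last by rewrite rmorph0 !mulr0.
rewrite rmorph_nat /set_hat (eq_bigr (fun=> 1)); last first.
  by move=> x _; rewrite mul0mx ent0 (char0 chiP).
have -> : (q ^ d)%:R = (q ^ (d - k))%:R * (q ^ k)%:R :> algC.
  by rewrite -natrM -expnD subnK.
rewrite sumr_const mulrA mulrAC mulfVK //.
by rewrite pnatr_eq0 -lt0n expn_gt0 (ltnW (finNzRing_gt1 F)).
Qed.

Lemma discrepancy_real d (A : {set 'rV[F]_d}) W k x : discrepancy A W k x \is Num.real.
Proof.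
by rewrite rpredB ?rpred_sum // ?rpred_div ?realn // => w _; apply: realn.
Qed.

Section Step.
Variables (m d : nat) (G : 'M[F]_(1 + m)).
Hypothesis (symG : G^T = G) (hd : (2 * m.+1 < d + \rank G)%N).
Local Notation G' := (drsubmx G).
Local Notation free_sphere X :=
  (fun w => on_sphere X (dlsubmx G) (ent (ulsubmx G)) w && ~~ (w <= X)%MS).

Lemma combine_bounds (x1 x2 y C r B : nat) : (x1 * x2 * C * r <= B)%N ->
  (y * C * r <= B)%N -> ((50 * x1 * x2 + 2 * y) * C * r <= 50 * B + 2 * B)%N.
Proof.
move=> h1 h2; have -> : ((50 * x1 * x2 + 2 * y) * C * r =
  50 * (x1 * x2 * C * r) + 2 * (y * C * r))%N by ring.
by rewrite leq_add // leq_mul2l ?h1 ?h2 orbT.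
Qed.

(** By Parseval, the sum over x is an average over xi of the squared error in
    [free_sphere_hat_le], weighted by |hat A|^2.  Summing that error over X first,
    the peaks on the span contribute no more than the generic term, by
    [card_grams_span]. *)
Lemma variance_grams (A : {set 'rV[F]_d}) :
  (\sum_(X in grams d G') \sum_x `|discrepancy A (free_sphere X) m.+1 x| ^+ 2)
    * (q ^ 'C(m.+1, 2))%:R * (q ^ \rank G)%:R <=
  (52 * 6 ^ m * q ^ (m * d + d) * #|A|)%:R.
Proof.
have q0 : (0 < q)%N := ltnW (finNzRing_gt1 F).
have rG : (\rank G <= m.+1)%N := rank_leq_row G.
have md : (m.+1 <= d)%N by lia.
have hd' : (2 * m < d + \rank G')%N.
  by have := rank_corner G; move: hd; lia.
pose E (X : 'M[F]_(m, d)) xi : algC :=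
  \sum_(w | free_sphere X w) chi (ent (xi *m w^T)) - (if xi == 0 then (q ^ (d - m.+1))%:R else 0).
pose V := (q ^ (d - \rank G))%:R : algC.
(* From (u + v)^2 <= 2 u^2 + 2 v^2 with v = 5 sqrt(V), and u the peak. *)
have EE X xi : X \in grams d G' -> `|E X xi| ^+ 2 <=
    50%:R * V + 2%:R * (if (xi != 0) && (xi <= X)%MS then (q ^ (2 * (d - m.+1)))%:R else 0).
  rewrite inE => /andP[fX /eqP XG].
  have := free_sphere_hat_le F2 chiP (b := dlsubmx G) (c := ent (ulsubmx G)) fX.
  rewrite (gram_extE symG XG) => /(_ hd xi); rewrite -/(E X xi) => h.
  have s0 := sqrt_q_gt0 F.
  set u := (if _ then _ else _) in h; set v := 5%:R * _ in h.
  have v2 : v ^+ 2 = 25%:R * V.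
    by rewrite /v exprMn -exprM mulnC -natq_sqrt -natrX.
  have u2 : u ^+ 2 = if (xi != 0) && (xi <= X)%MS then (q ^ (2 * (d - m.+1)))%:R else 0.
    by rewrite /u; case: ifP; rewrite ?expr0n // -natrX -expnM mulnC.
  rewrite -u2; have uv0 : 0 <= u + v by apply: le_trans h.
  apply: (@le_trans _ _ ((u + v) ^+ 2)); first by rewrite ler_pXn2r ?nnegrE.
  have ur : u \is Num.real by rewrite /u; case: ifP => // _; apply: realn.
  have vr : v \is Num.real by rewrite rpredM ?realn // rpredX // ger0_real // ltW.
  have -> : 50%:R * V = 2%:R * v ^+ 2 by rewrite v2 mulrA; congr (_ * _); rewrite -natrM.
  rewrite -subr_ge0; have -> : 2%:R * v ^+ 2 + 2%:R * u ^+ 2 - (u + v) ^+ 2 = (u - v) ^+ 2 by ring.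
  by rewrite real_exprn_even_ge0 // rpredB.
have SE xi : (\sum_(X in grams d G') `|E X xi| ^+ 2) * (q ^ 'C(m.+1, 2))%:R * (q ^ \rank G)%:R <=
    (52 * 6 ^ m * q ^ (m * d + d))%:R.
  apply: (@le_trans _ _ ((50 * q ^ (d - \rank G) * #|grams d G'|
     + 2 * ((xi != 0)%R * (q ^ (2 * (d - m.+1)) * #|[set X in grams d G' | (xi <= X)%MS]|)))%N%:R
     * (q ^ 'C(m.+1, 2))%:R * (q ^ \rank G)%:R)).
    rewrite !ler_wpM2r ?ler0n //; apply: le_trans (ler_sum _ (fun X gX => EE X xi gX)) _.
    rewrite big_split /= natrD; apply: lerD.
      by rewrite sumr_const -[leLHS]mulr_natr !natrM.
    rewrite -mulr_sumr natrM ler_wpM2l ?ler0n //; case: eqP => _ /=.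
      by rewrite big1 ?mul0n.
    rewrite mul1n -big_mkcondr natrM -sum1dep_card natr_sum mulr_sumr.
    by apply: ler_sum => X _; rewrite mulr1.
  rewrite -!natrM ler_nat.
  have h1 := card_grams F2 (sub_gram_sym symG) hd'.
  have qd : (q ^ d = q ^ (d - \rank G) * q ^ \rank G)%N by rewrite -expnD subnK //; lia.
  have h2 : ((xi != 0)%R * (q ^ (2 * (d - m.+1)) * #|[set X in grams d G' | (xi <= X)%MS]|)
       * q ^ 'C(m.+1, 2) * q ^ \rank G <= 6 ^ m * q ^ (m * d + d))%N.
    case: eqP => [//|/eqP xi0]; rewrite mul1n.
    have h2 := card_grams_span F2 (sub_gram_sym symG) hd' xi0.
    rewrite -(@leq_pmul2r (q ^ d)) ?expn_gt0 ?q0 //.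
    set N := #|_| in h2 *.
    have -> : (q ^ (2 * (d - m.+1)) * N * q ^ 'C(m.+1, 2) * q ^ \rank G * q ^ d =
      (N * q ^ d * q ^ 'C(m.+1, 2)) * (q ^ (2 * (d - m.+1)) * q ^ \rank G))%N by ring.
    apply: (leq_trans (leq_mul h2 (leqnn _))).
    rewrite -!mulnA leq_mul2l -!expnD; apply/orP; right.
    by rewrite leq_exp2l ?finNzRing_gt1 //; lia.
  have h3 : (q ^ (d - \rank G) * #|grams d G'| * q ^ 'C(m.+1, 2) * q ^ \rank G <= 6 ^ m * q ^ (m * d + d))%N.
    rewrite expnD qd; set x := (q ^ (d - \rank G))%N; set y := (q ^ \rank G)%N.
    have -> : (x * #|grams d G'| * q ^ 'C(m.+1, 2) * y = #|grams d G'| * q ^ 'C(m.+1, 2) * (x * y))%N by ring.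
    by rewrite [leqRHS]mulnA leq_mul2r h1 orbT.
  have -> : (52 * 6 ^ m * q ^ (m * d + d) = 50 * (6 ^ m * q ^ (m * d + d)) + 2 * (6 ^ m * q ^ (m * d + d)))%N.
    by rewrite -mulnA -mulnDl.
  exact: combine_bounds h3 h2.
rewrite -(@ler_pM2l _ (q ^ d)%:R); last by rewrite ltr0n expn_gt0 q0.
have -> : (q ^ d)%:R * ((\sum_(X in grams d G') \sum_x `|discrepancy A (free_sphere X) m.+1 x| ^+ 2)
    * (q ^ 'C(m.+1, 2))%:R * (q ^ \rank G)%:R) =
  \sum_xi `|set_hat A xi| ^+ 2 * ((\sum_(X in grams d G') `|E X xi| ^+ 2) * (q ^ 'C(m.+1, 2))%:R * (q ^ \rank G)%:R).
  transitivity ((\sum_xi `|set_hat A xi| ^+ 2 * \sum_(X in grams d G') `|E X xi| ^+ 2)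
      * (q ^ 'C(m.+1, 2))%:R * (q ^ \rank G)%:R); last first.
    by rewrite !mulr_suml; apply: eq_bigr => xi _; rewrite !mulrA.
  rewrite !mulrA; congr (_ * _ * _).
  transitivity (\sum_(X in grams d G') \sum_xi `|set_hat A xi| ^+ 2 * `|E X xi| ^+ 2).
    rewrite mulr_sumr; apply: eq_bigr => X _; rewrite -parseval; apply: eq_bigr => xi _.
    by rewrite discrepancy_hat // normrM norm_conjC exprMn.
  rewrite exchange_big /=; apply: eq_bigr => xi _; by rewrite mulr_sumr.
apply: (@le_trans _ _ (\sum_xi `|set_hat A xi| ^+ 2 * (52 * 6 ^ m * q ^ (m * d + d))%:R)).
  by apply: ler_sum => xi _; rewrite ler_wpM2l ?exprn_ge0.
by rewrite -mulr_suml sum_set_hat -!natrM; rewrite ler_nat mulnAC -!mulnA mulnC -!mulnA; lia.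
Qed.

End Step.
End Variance.

(** * The induction on the number of edges *)

Lemma cauchy_schwarz_sum (I : finType) (S : {set I}) (D : I -> algC) :
  (forall i, D i \is Num.real) ->
  (\sum_(i in S) D i) ^+ 2 <= #|S|%:R * \sum_(i in S) `|D i| ^+ 2.
Proof.
move=> Dr; set n : algC := #|S|%:R; set T := \sum_(i in S) D i.
have frob_trace : T \is Num.real by apply: rpred_sum => i _.
have nr : n \is Num.real by apply: realn.
have e : \sum_(i in S) (n * D i - T) ^+ 2 = n * (n * (\sum_(i in S) `|D i| ^+ 2) - T ^+ 2).
  transitivity (\sum_(i in S) (n ^+ 2 * `|D i| ^+ 2 - 2%:R * n * T * D i + T ^+ 2)).
    by apply: eq_bigr => i _; rewrite real_normK //; ring.
  rewrite big_split sumrB /= -!mulr_sumr sumr_const -mulr_natr -/n -/T; ring.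
have : 0 <= \sum_(i in S) (n * D i - T) ^+ 2.
  by apply: sumr_ge0 => i _; rewrite real_exprn_even_ge0 // rpredB ?rpredM.
rewrite e; have [n0|n0] := eqVneq n 0; last by rewrite pmulr_rge0 ?subr_ge0 // lt_def n0 ler0n.
move=> _; rewrite n0 mul0r; suff -> : T = 0 by rewrite expr0n.
move/eqP: n0; rewrite pnatr_eq0 cards_eq0 => /eqP S0.
by rewrite /T S0 big_set0.
Qed.

Section Copies.
Variable F : finFieldType.
Hypothesis F2 : 2 \notin [pchar F].
Local Notation q := #|F|.

(** The configurations with base point p.2 and edges the rows of p.1. *)
Definition copies m d (G : 'M[F]_m) (A : {set 'rV[F]_d}) :
    {set 'M[F]_(m, d) * 'rV[F]_d} :=
  [set p | (p.1 \in grams d G) && ((p.2 \in A) && [forall i, p.2 + row i p.1 \in A])].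

Section Step.
Variables (m d : nat) (G : 'M[F]_(1 + m)) (A : {set 'rV[F]_d}).
Hypothesis (symG : G^T = G) (hd : (2 * m.+1 < d + \rank G)%N).
Local Notation G' := (drsubmx G).
Local Notation free_sphere X :=
  (fun w => on_sphere X (dlsubmx G) (ent (ulsubmx G)) w && ~~ (w <= X)%MS).

(** A configuration with m + 1 edges is one with m edges together with a point
    of the sphere for its first edge. *)
Lemma card_copies_rec : #|copies G A| =
  (\sum_(p in copies G' A) \sum_(w | free_sphere p.1 w) ((p.2 + w)%R \in A))%N.
Proof.
pose f k (Y : 'M[F]_(k, d)) : nat :=
  (\sum_x ((x \in A) && [forall i, (x + row i Y)%R \in A]))%N.
have cE k (H : 'M[F]_k) : #|copies H A| = (\sum_(Y in grams d H) f k Y)%N.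
  rewrite -sum1dep_card big_mkcondr /= pair_big_dep /=.
  by apply: eq_big => [p|p _]; rewrite ?andbT //; case: ifP.
have fE (w : 'rV[F]_d) (X : 'M[F]_(m, d)) x : [forall i, (x + row i (col_mx w X)) \in A] =
    (x + w \in A) && [forall i, x + row i X \in A].
  apply/forallP/andP => [h|[h1 /forallP h2] i].
    split; first by have := h (lshift m 0); rewrite rowKu row_id.
    by apply/forallP => i; have := h (rshift 1 i); rewrite rowKd.
  case: (split_ordP i) => j ->; last by rewrite rowKd.
  by rewrite rowKu row_id.
rewrite cE (sum_grams symG).
transitivity (\sum_(X in grams d G') \sum_(x | (x \in A) && [forall i, (x + row i X)%R \in A])
    \sum_(w | free_sphere X w) ((x + w)%R \in A))%N; last first.
  by rewrite pair_big_dep /=; apply: eq_bigl => p; rewrite [in RHS]inE.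
apply: eq_bigr => X _; rewrite [RHS]exchange_big /=; apply: eq_bigr => w _.
rewrite /f [RHS]big_mkcond; apply: eq_bigr => x _; rewrite fE.
by case: (x \in A); case: [forall _, _]; case: (_ \in A).
Qed.

(** Cauchy-Schwarz over the configurations with m edges, after which the
    restriction to A can be dropped at the cost of an upper bound only. *)
Lemma copies_step : 
  ((#|copies G A| * q ^ m.+1)%:Z - (#|A| * #|copies G' A|)%:Z) ^+ 2
     * (q ^ 'C(m.+1, 2) * q ^ \rank G)%:Z <=
  (52 * 6 ^ m * q ^ (2 * m.+1) * q ^ (m * d + d) * #|A| * #|copies G' A|)%:Z.
Proof.
have [chi chiP] := exists_add_char F.
have q0 : (0 < q)%N := ltnW (finNzRing_gt1 F).
pose D (p : 'M[F]_(m, d) * 'rV[F]_d) := discrepancy A (free_sphere p.1) m.+1 p.2.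
have qn0 : (q ^ m.+1)%:R != 0 :> algC by rewrite pnatr_eq0 -lt0n expn_gt0 q0.
have SD : \sum_(p in copies G' A) D p =
   #|copies G A|%:R - #|A|%:R / (q ^ m.+1)%:R * #|copies G' A|%:R.
  rewrite /D /discrepancy sumrB sumr_const -[X in _ - X]mulr_natr; congr (_ - _).
  by rewrite card_copies_rec natr_sum; apply: eq_bigr => p _; rewrite natr_sum.
have CS := cauchy_schwarz_sum (copies G' A) (fun p => discrepancy_real A (free_sphere p.1) m.+1 p.2).
rewrite SD in CS.
have V := variance_grams F2 chiP symG hd A.
have sub : \sum_(p in copies G' A) `|D p| ^+ 2 <=
   \sum_(X in grams d G') \sum_x `|discrepancy A (free_sphere X) m.+1 x| ^+ 2.
  rewrite pair_big_dep /= [leLHS]big_mkcond [leRHS]big_mkcond /=; apply: ler_sum => -[X x] _.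
  rewrite inE /= andbT; case: (X \in _) => //=; case: ifP => // _; exact: exprn_ge0.
rewrite -(ler_int algC) rmorphM rmorphXn rmorphB /= -!pmulrn.
have -> : (#|copies G A| * q ^ m.+1)%:R - (#|A| * #|copies G' A|)%:R =
   (q ^ m.+1)%:R * (#|copies G A|%:R - #|A|%:R / (q ^ m.+1)%:R * #|copies G' A|%:R) :> algC.
  by rewrite !natrM; field.
rewrite exprMn; set t : algC := _ - _ in CS *; set c1 : algC := (q ^ 'C(_, _))%:R in V *.
set rk : algC := (q ^ \rank G)%:R in V *.
have c1_ge0 : 0 <= c1 by apply: ler0n.
have rk_ge0 : 0 <= rk by apply: ler0n.
have -> : (q ^ 'C(m.+1, 2) * q ^ \rank G)%:R = c1 * rk :> algC by rewrite natrM.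
have -> : (52 * 6 ^ m * q ^ (2 * m.+1) * q ^ (m * d + d) * #|A| * #|copies G' A|)%:R =
  (q ^ m.+1)%:R ^+ 2 * (#|copies G' A|%:R * (52 * 6 ^ m * q ^ (m * d + d) * #|A|)%:R) :> algC.
  rewrite -natrX -!natrM; congr (_%:R); rewrite -expnM [(m.+1 * 2)%N]mulnC; ring.
rewrite -mulrA ler_wpM2l ?exprn_ge0 ?ler0n //.
apply: (@le_trans _ _ (#|copies G' A|%:R * (\sum_(p in copies G' A) `|D p| ^+ 2) * (c1 * rk))).
  by rewrite ler_wpM2r ?mulr_ge0.
rewrite -mulrA ler_wpM2l ?ler0n // mulrA; apply: le_trans V.
by rewrite ler_wpM2r // ler_wpM2r.
Qed.

End Step.
End Copies.

(** The bookkeeping of the induction step, with a = |A|, am = a^(m+1),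
    M = q^(m(d+2)), pd = q^d, p2 = q^2, and R and R' the powers of q to the old and the
    new rank.  The difference to be bounded splits into the new error and
    a times the previous one.  For the latter a <= q^d and R <= R' q^2 are used, and
    for the former the previous estimate in the weak form
    N c1 <= (K + 1) a^(m+1). *)
Lemma step_arith (K B N' N a c1 Q R R' M am p2 pd : nat) :
  (0 < R')%N -> (0 < pd)%N -> (0 < p2)%N ->
  (M * (pd * p2) <= a * am * R)%N -> (R <= R' * p2)%N -> (a <= pd)%N ->
  (((M <= am * R')%N) -> ((N * c1)%:Z - am%:Z) ^+ 2 * R'%:Z <= (K * am * M)%:Z) ->
  ((N' * Q)%:Z - (a * N)%:Z) ^+ 2 * (c1 * R)%:Z <= (B * (M * (pd * p2)) * a * N)%:Z ->
  ((N' * (c1 * Q))%:Z - (a * am)%:Z) ^+ 2 * R%:Z <=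
    ((2 * (K + 1) * B + 2 * K) * (a * am) * (M * (pd * p2)))%:Z.
Proof.
move=> R0 pd0 p20 hM hR ha IH step.
have hM' : (M <= am * R')%N.
  rewrite -(@leq_pmul2r (pd * p2)) ?muln_gt0 ?pd0 ?p20 //.
  apply: (leq_trans hM); apply: (leq_trans (leq_mul (leq_mul ha (leqnn am)) hR)).
  by apply: eq_leq; ring.
have {}IH := IH hM'.
(* Otherwise N c1 - am exceeds K am, and its square times R' is more than the
   K am^2 R' that the previous estimate leaves. *)
have hN : (N * c1 <= (K + 1) * am)%N.
  rewrite leqNgt; apply/negP => hlt.
  have h1 : (K * am)%:Z + 1 <= (N * c1)%:Z - am%:Z by lia.
  have h2 : ((K * am)%:Z + 1) ^+ 2 <= ((N * c1)%:Z - am%:Z) ^+ 2.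
    by rewrite ler_pXn2r ?nnegrE //; lia.
  have h3 : ((K * am)%:Z + 1) ^+ 2 * R'%:Z <= (K * am * (am * R'))%:Z.
    apply: (le_trans (ler_wpM2r _ h2)) => //; apply: (le_trans IH).
    by rewrite lez_nat leq_mul2l hM' orbT.
  have h4 : (K * am)%:Z * am%:Z <= (K * am)%:Z * (K * am)%:Z.
    rewrite -!PoszM lez_nat; case: (K) => [|K']; first by rewrite !mul0n.
    by rewrite leq_mul2l leq_pmull ?orbT.
  have e3 : (K * am * (am * R'))%:Z = (K * am)%:Z * am%:Z * R'%:Z.
    by rewrite !PoszM; ring.
  rewrite e3 ler_pM2r // in h3; have := le_trans h3 h4.
  have : 0 <= (K * am)%:Z by []. move: (K * am)%:Z => z z0.
  rewrite sqrrD expr1n mulr1 -expr2 -addrA gerDl; lia.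
set T1 := (N' * Q)%:Z - _ in step; set T2 := (N * c1)%:Z - am%:Z in IH.
have -> : (N' * (c1 * Q))%:Z - (a * am)%:Z = T1 * c1%:Z + a%:Z * T2.
  by rewrite /T1 /T2 !PoszM; ring.
have s1 : (T1 * c1%:Z) ^+ 2 * R%:Z <= ((K + 1) * B * (a * am) * (M * (pd * p2)))%:Z.
  have -> : (T1 * c1%:Z) ^+ 2 * R%:Z = (T1 ^+ 2 * (c1 * R)%:Z) * c1%:Z by rewrite PoszM; ring.
  apply: (le_trans (ler_wpM2r _ step)) => //; rewrite -PoszM lez_nat.
  have -> : (B * (M * (pd * p2)) * a * N * c1 = B * (M * (pd * p2)) * a * (N * c1))%N by ring.
  by apply: (leq_trans (leq_mul (leqnn _) hN)); apply: eq_leq; ring.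
have s2 : (a%:Z * T2) ^+ 2 * R%:Z <= (K * (a * am) * (M * (pd * p2)))%:Z.
  have h1 : (a%:Z * T2) ^+ 2 * R%:Z <= (a%:Z * T2) ^+ 2 * (R' * p2)%:Z.
    by rewrite ler_wpM2l ?sqr_ge0 // lez_nat.
  apply: (le_trans h1).
  have -> : (a%:Z * T2) ^+ 2 * (R' * p2)%:Z = (a * a * p2)%:Z * (T2 ^+ 2 * R'%:Z).
    by rewrite !PoszM; ring.
  apply: (le_trans (ler_wpM2l _ IH)) => //; rewrite -PoszM lez_nat.
  have -> : (a * a * p2 * (K * am * M) = a * (a * p2 * (K * am * M)))%N by ring.
  by apply: (leq_trans (leq_mul ha (leqnn _))); apply: eq_leq; ring.
have s3 : (T1 * c1%:Z + a%:Z * T2) ^+ 2 <= 2 * (T1 * c1%:Z) ^+ 2 + 2 * (a%:Z * T2) ^+ 2.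
  rewrite -subr_ge0; set x := T1 * _; set y := a%:Z * _.
  have -> : 2 * x ^+ 2 + 2 * y ^+ 2 - (x + y) ^+ 2 = (x - y) ^+ 2 by ring.
  exact: sqr_ge0.
apply: (le_trans (ler_wpM2r _ s3)) => //.
have -> : ((2 * (K + 1) * B + 2 * K) * (a * am) * (M * (pd * p2)))%:Z =
  2 * ((K + 1) * B * (a * am) * (M * (pd * p2)))%:Z + 2 * (K * (a * am) * (M * (pd * p2)))%:Z.
  by rewrite !(PoszM, PoszD); ring.
rewrite mulrDl -(mulrA 2 ((T1 * _) ^+ 2)) -(mulrA 2 ((_ * T2) ^+ 2)).
by apply: lerD; rewrite ler_wpM2l.
Qed.

(** The statement is cleared of denominators, so that it is an inequality
    between integers.  In terms of the density alpha = a / q^d the hypothesis on A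
    is alpha^(m+1) >= q^(2m-d-rank G), and the conclusion bounds the square of the
    relative error by K q^(2m-d-rank G) / alpha^(m+1). *)
Lemma copies_main m : exists K : nat, forall (F : finFieldType) (d : nat)
    (G : 'M[F]_m) (A : {set 'rV[F]_d}),
  2 \notin [pchar F] -> G^T = G -> (2 * m < d + \rank G)%N ->
  (#|F| ^ (m * (d + 2)) <= #|A| ^ m.+1 * #|F| ^ \rank G)%N ->
  ((#|copies G A| * #|F| ^ 'C(m.+1, 2))%:Z - (#|A| ^ m.+1)%:Z) ^+ 2 * (#|F| ^ \rank G)%:Z
    <= (K * #|A| ^ m.+1 * #|F| ^ (m * (d + 2)))%:Z.
Proof.
elim: m => [|m [K IH]].
  exists 0%N => F d G A F2 symG hd hA.
  have -> : #|copies G A| = #|A|.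
    rewrite -(card_imset A (f := fun x => ((0 : 'M[F]_(0, d)), x))); last by move=> x y [].
    apply: eq_card => -[X x]; rewrite inE /=.
    apply/andP/imsetP => [[_ /andP[xA _]]|[y yA [-> ->]]].
      by exists x => //; congr (_, _); apply/matrixP => -[].
    rewrite yA inE; split; last by apply/forallP => -[].
    apply/andP; split; last by apply/eqP/matrixP => -[].
    by rewrite -row_leq_rank.
  by rewrite bin_small // expn0 muln1 expn1 subrr expr0n mul0r.
exists (2 * (K + 1) * (52 * 6 ^ m) + 2 * K)%N => F d G A F2 symG hd hA.
have q0 : (0 < #|F|)%N := ltnW (finNzRing_gt1 F).
have hr := rank_corner (G : 'M_(1 + m)).
have e1 : (#|F| ^ (m.+1 * (d + 2)) = #|F| ^ (m * (d + 2)) * (#|F| ^ d * #|F| ^ 2))%N.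
  by rewrite -!expnD mulSn addnC.
rewrite binS bin1 expnD e1 [(#|A| ^ m.+2)%N]expnS.
apply: (step_arith (N := #|copies (drsubmx (G : 'M_(1 + m))) A|)
  (R' := #|F| ^ \rank (drsubmx (G : 'M_(1 + m))))) => //.
- by rewrite expn_gt0 q0.
- by rewrite expn_gt0 q0.
- by rewrite expn_gt0 q0.
- by rewrite -e1 -expnS.
- by rewrite -expnD leq_exp2l ?finNzRing_gt1.
- by rewrite (leq_trans (max_card _)) // card_mx mul1n.
- move=> h; apply: IH => //; first exact: (sub_gram_sym symG).
  by move: hr hd; rewrite -[(1 + m)%N]/(m.+1); lia.
have := copies_step F2 (G := G : 'M_(1 + m)) A symG hd; congr (_ <= _%:Z).
have -> : (#|F| ^ (m * (d + 2)) * (#|F| ^ d * #|F| ^ 2) = #|F| ^ (2 * m.+1) * #|F| ^ (m * d + d))%N.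
  by rewrite -!expnD; congr (_ ^ _)%N; lia.
ring.
Qed.

(** * From simplices to Gram matrices *)

Section Transfer.
Variables (F : finFieldType) (d k : nat).
Implicit Types x y : {ffun 'I_k.+1 -> 'rV[F]_d}.
Local Notation q := #|F|.

Definition edge_mx x : 'M[F]_(k, d) := \matrix_(i < k) edge x i.
Definition edge_gram x : 'M[F]_k := edge_mx x *m (edge_mx x)^T.

Lemma edge_gram_sym x : (edge_gram x)^T = edge_gram x.
Proof. by rewrite trmx_mul trmxK. Qed.

Lemma dot_ent (v w : 'rV[F]_d) : dot v w = ent (v *m w^T).
Proof. by rewrite /dot /ent mxE; apply: eq_bigr => i _; rewrite mxE. Qed.

Lemma dotC (v w : 'rV[F]_d) : dot v w = dot w v.
Proof. by apply: eq_bigr => i _; rewrite mulrC. Qed.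

Lemma edge_gramE x i j : edge_gram x i j = dot (edge x i) (edge x j).
Proof. by rewrite mxE; apply: eq_bigr => l _; rewrite !mxE. Qed.

Lemma isometricE x y : isometric x y = (edge_gram y == edge_gram x).
Proof.
apply/idP/eqP => [/'forall_forallP h|e].
  apply/matrixP => i j; rewrite !edge_gramE.
  have [ij|/ltnW ji] := leqP i j; first by rewrite (eqP (implyP (h i j) ij)).
  by rewrite dotC [RHS]dotC (eqP (implyP (h j i) ji)).
by apply/'forall_forallP => i j; apply/implyP => _; rewrite -!edge_gramE e.
Qed.

Lemma mul_edge_mx x (v : 'rV[F]_k) : v *m edge_mx x = \sum_(i < k) v 0 i *: edge x i.
Proof. by rewrite mulmx_sum_row; apply: eq_bigr => i _; rewrite rowK. Qed.

Definition edge_tuple x : k.-tuple 'rV[F]_d := [tuple edge x i | i < k].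

Lemma edge_tupleE x : edges x = edge_tuple x. Proof. by []. Qed.

Lemma simplexE x : simplex x = row_free (edge_mx x).
Proof.
rewrite /simplex edge_tupleE; apply/freeP/idP => [h|fX c e i].
  apply: inj_row_free => v; rewrite mul_edge_mx => e.
  apply/rowP => i; rewrite mxE; apply: (h (fun i => v 0 i)).
  by rewrite -[RHS]e; apply: eq_bigr => j _; rewrite (nth_map j) ?size_enum_ord // nth_ord_enum.
have : (\row_i c i) *m edge_mx x = 0.
  rewrite mul_edge_mx -[RHS]e; apply: eq_bigr => j _.
  by rewrite mxE (nth_map j) ?size_enum_ord // nth_ord_enum.
rewrite -(mul0mx _ (edge_mx x)) => /(row_free_inj fX) /rowP /(_ i).
by rewrite !mxE.
Qed.

Lemma mem_simplex_span x w : w \in simplex_span x -> exists v : 'rV[F]_k, w = v *m edge_mx x.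
Proof.
rewrite /simplex_span edge_tupleE => /coord_span ->.
exists (\row_i coord (edge_tuple x) i w); rewrite mul_edge_mx; apply: eq_bigr => i _.
by rewrite mxE (nth_map i) ?size_enum_ord // nth_ord_enum.
Qed.

Lemma simplex_span_mul x (v : 'rV[F]_k) : v *m edge_mx x \in simplex_span x.
Proof.
rewrite mul_edge_mx; apply: memv_suml => i _; apply: memvZ; apply: memv_span.
by apply: map_f; rewrite mem_enum.
Qed.

(** The injective map h |-> h X carries the kernel of the Gram matrix onto the
    radical, so both have the same number of elements, hence the same
    dimension. *)
Lemma radicalE x : simplex x ->
  \dim (simplex_span x :&: perp (simplex_span x)) = (k - \rank (edge_gram x))%N.
Proof.
rewrite simplexE => fX; set U := (_ :&: _)%VS.
have inj : injective (fun h : 'rV[F]_k => h *m edge_mx x) := row_free_inj fX.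
apply/eqP; rewrite -(@eqn_exp2l q) ?finNzRing_gt1 // -card_vspace -card_ker.
rewrite -(card_imset _ inj); apply/eqP; apply: eq_card => w.
have perpE v : (v *m edge_mx x \in perp (simplex_span x)) = (v *m edge_gram x == 0).
  apply/memv_perp/eqP => [h|vG u /mem_simplex_span [u' ->]].
    apply/rowP => i; rewrite [RHS]mxE /edge_gram mulmxA.
    have := h (edge x i) (memv_span (map_f _ (mem_enum _ _))).
    by rewrite dotC => <-; rewrite mxE; apply: eq_bigr => j _; rewrite !mxE.
  by rewrite dotC dot_ent trmx_mul mulmxA -(mulmxA v) vG mul0mx ent0.
rewrite memv_cap; apply/andP/imsetP => [[/mem_simplex_span [v ->]]|[v]].
  by rewrite perpE => h; exists v; rewrite ?inE.
by rewrite inE => h ->; rewrite perpE h simplex_span_mul.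
Qed.

Lemma rank_edge_gram x r : simplex x -> simplex_rank x = r -> \rank (edge_gram x) = r.
Proof.
move=> sx; rewrite /simplex_rank radicalE // => <-.
by rewrite subKn // rank_leq_row.
Qed.

(** An ordered simplex is the same as its first vertex and its edge matrix. *)
Lemma card_isometric_copies (A : {set 'rV[F]_d}) x :
  #|isometric_copies A x| = #|copies (edge_gram x) A|.
Proof.
pose f y := (edge_mx y, y ord0).
have yE y i : y (lift ord0 i) = y ord0 + row i (edge_mx y).
  by rewrite rowK /edge addrC subrK.
have injf : injective f.
  move=> y z [e1 e2]; apply/ffunP => i; case: (unliftP ord0 i) => [j ->|-> //].
  by rewrite !yE e1 e2.
rewrite -(card_imset _ injf); apply: eq_card => -[X v]; rewrite [RHS]inE.
apply/imsetP/idP => [[y]|].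
  rewrite inE => /and3P[sy /forallP yA iy] [-> ->] /=; apply/and3P; split.
  - by rewrite inE -simplexE sy -isometricE.
  - exact: yA.
  by apply/forallP => i; rewrite -yE.
case/and3P=> /=; rewrite inE => /andP[fX /eqP XG] vA /forallP hA.
pose y : {ffun 'I_k.+1 -> 'rV[F]_d} :=
  [ffun i => if unlift ord0 i is Some j then v + row j X else v].
have y0 : y ord0 = v by rewrite ffunE unlift_none.
have yX : edge_mx y = X.
  apply/row_matrixP => i; rewrite rowK /edge y0 ffunE liftK.
  by rewrite addrC addrA addNr add0r.
exists y; last by rewrite /f yX y0.
rewrite inE simplexE isometricE /edge_gram yX fX XG eqxx andbT /=.
apply/forallP => i; rewrite ffunE; case: unliftP => [j _|//]; exact: hA.
Qed.

End Transfer.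

(** * The count of isometric simplices *)

Section RealForm.
Variable R : realType.

(** With B the claimed error term, B^2 q^(d+r) = alpha^(k+1) q^(2k); this turns the
    bound for the squared integral error into a bound for E^2 by K B^2. *)
Lemma real_error_form (q alpha N : R) (k d r c K : nat) :
  1 < q -> 0 < alpha ->
  (N * q ^+ c - (alpha * q ^+ d) ^+ k.+1) ^+ 2 * q ^+ r <=
     K%:R * (alpha * q ^+ d) ^+ k.+1 * q ^+ (k * (d + 2)) ->
  exists2 E : R,
    `|E| <= K.+1%:R * (alpha `^ ((k%:R + 1) / 2) * q `^ (k%:R - (d%:R + r%:R) / 2)) &
    N = (alpha ^+ k.+1 + E) * q `^ ((k.+1 * d)%:R - c%:R).
Proof.
move=> q1 a0 h; have q0 : 0 < q by apply: lt_trans q1.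
have qi P : P ==> (q != 0) by rewrite (gt_eqF q0) implybT.
pose W := q `^ ((k.+1 * d)%:R - c%:R).
have W0 : 0 < W by apply: powR_gt0.
have Wc : W * q ^+ c = q ^+ (k.+1 * d).
  by rewrite -!powR_mulrn ?(ltW q0) // /W -powRD ?subrK.
set B := alpha `^ _ * _.
have B0 : 0 <= B by rewrite mulr_ge0 ?powR_ge0.
have B2 : B ^+ 2 * q ^+ (d + r) = alpha ^+ k.+1 * q ^+ (2 * k).
  rewrite /B exprMn -![(_ `^ _) ^+ 2]powR_mulrn ?powR_ge0 // -!powRrM.
  rewrite divfK ?pnatr_eq0 // natr1 powR_mulrn ?(ltW a0) // -mulrA; congr (_ * _).
  rewrite -!powR_mulrn ?(ltW q0) // -powRD //.
  by congr (_ `^ _); rewrite natrD natrM; field.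
move: B B0 B2 => B B0 B2.
exists (N / W - alpha ^+ k.+1); last by rewrite addrC subrK divfK // gt_eqF.
set E := N / W - _.
have EW : E * q ^+ (k.+1 * d) = N * q ^+ c - (alpha * q ^+ d) ^+ k.+1.
  rewrite /E mulrBl -{1}Wc mulrA divfK ?gt_eqF // exprMn -exprM.
  by rewrite [(d * _)%N]mulnC.
have E2 : E ^+ 2 <= K%:R * B ^+ 2.
  have p0 : 0 < q ^+ (2 * (k.+1 * d) + r) by apply: exprn_gt0.
  rewrite -(ler_pM2r p0); move: h; rewrite -EW.
  have -> : (E * q ^+ (k.+1 * d)) ^+ 2 * q ^+ r = E ^+ 2 * q ^+ (2 * (k.+1 * d) + r).
    by rewrite exprD exprMn -[(q ^+ _) ^+ 2]exprM [(2 * _)%N]mulnC mulrA.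
  move/le_trans; apply; rewrite le_eqVlt; apply/orP; left; apply/eqP.
  have -> : (2 * (k.+1 * d) + r = (d + r) + (k.+1 * d + k * d))%N by lia.
  rewrite exprD -[LHS]mulrA -[RHS]mulrA; congr (_ * _); rewrite [RHS]mulrA B2 exprMn -exprM.
  rewrite -!mulrA; congr (_ * _); rewrite -!exprD; congr (_ ^+ _); lia.
rewrite -(@ler_pXn2r _ 2) ?nnegrE ?mulr_ge0 //.
rewrite real_normK ?num_real // exprMn (le_trans E2) // ler_wpM2r ?exprn_ge0 //.
by rewrite -natrX ler_nat; lia.
Qed.

End RealForm.

Theorem theorem1 (R : realType) (k : nat) (k_ge1 : (1 <= k)%N) :
  exists C K : R, [/\ 0 < C, 0 < K &
    forall (F : finFieldType) (d r : nat)
           (Delta : {ffun 'I_k.+1 -> 'rV[F]_d}) (A : {set 'rV[F]_d}) (alpha : R),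
      let q : R := #|F|%:R in
      2%N \notin [pchar F] ->
      (r <= k)%N ->
      (2 * k - r < d)%N ->
      simplex Delta ->
      simplex_rank Delta = r ->
      C * q `^ ((2 * k%:R - d%:R - r%:R) / (k%:R + 1)) <= alpha ->
      #|A|%:R = alpha * q ^+ d ->
      exists2 E : R,
        `|E| <= K * (alpha `^ ((k%:R + 1) / 2) * q `^ (k%:R - (d%:R + r%:R) / 2))
        & #|isometric_copies A Delta|%:R =
          (alpha ^+ k.+1 + E) * q `^ ((k.+1 * d)%:R - 'C(k.+1, 2)%:R)].
Proof.
have [K main] := copies_main k.
exists 1, K.+1%:R; split; rewrite ?ltr0n //.
move=> F d r Delta A alpha q F2 rk hd sD rD; rewrite mul1r => ha hA.
have q1 : 1 < q by rewrite ltr1n finNzRing_gt1.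
have q0 : 0 < q by apply: lt_trans q1.
have a0 : 0 < alpha by apply: lt_le_trans ha; apply: powR_gt0.
have rG := rank_edge_gram sD rD.
have k10 : k%:R + 1 != 0 :> R by rewrite natr1 pnatr_eq0.
have ak : q ^+ (2 * k) <= alpha ^+ k.+1 * q ^+ (d + r).
  set e := (_ / _) in ha.
  have h : (q `^ e) ^+ k.+1 <= alpha ^+ k.+1.
    by rewrite ler_pXn2r ?nnegrE ?powR_ge0 // ltW.
  apply: le_trans (ler_wpM2r _ h); last by rewrite exprn_ge0 // ltW.
  rewrite -[(q `^ e) ^+ _]powR_mulrn ?powR_ge0 // -powRrM -natr1 /e divfK //.
  rewrite -!powR_mulrn ?(ltW q0) // -powRD; last by rewrite (gt_eqF q0) implybT.
  rewrite natrD natrM.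
  by have -> : 2 * k%:R - d%:R - r%:R + (d%:R + r%:R) = 2 * k%:R :> R by ring.
rewrite card_isometric_copies; apply: real_error_form => //.
have := main F d (edge_gram Delta) A F2 (edge_gram_sym _); rewrite rG.
have -> : (2 * k < d + r)%N by lia.
have -> : (#|F| ^ (k * (d + 2)) <= #|A| ^ k.+1 * #|F| ^ r)%N.
  rewrite -(ler_nat R) natrM !natrX hA exprMn -/q mulrAC -exprM.
  have -> : (k * (d + 2) = 2 * k + d * k)%N by lia.
  rewrite exprD mulnS exprD mulrA ler_wpM2r ?exprn_ge0 ?(ltW q0) //.
  by rewrite -mulrA -exprD [(r + d)%N]addnC.
move=> /(_ isT isT); rewrite -(ler_int R) !(rmorphM, rmorphXn, rmorphB) /=.
by rewrite -!pmulrn hA.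
Qed.
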